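(* Let $\rho\in(-1,1)$, $S_0,V_0>0$, and let $\eta,\sigma:(0,\infty)\to(0,\infty)$ be twice continuously differentiable and such that the expansions $$\eta(S)=\eta_0+\eta_1\log\tfrac{S}{S_0}+\eta_2\log^2\tfrac{S}{S_0}+O\bigl(\log^3(S/S_0)\bigr),\qquad \sigma(V)=\sigma_0+\sigma_1\log\tfrac{V}{V_0}+\sigma_2\log^2\tfrac{V}{V_0}+O\bigl(\log^3(V/V_0)\bigr)$$ hold around $S_0$ and $V_0$ respectively. Put $D=\sigma_0^2+4\rho\sigma_0\sqrt{V_0}\,\eta_1+4\eta_1^2V_0$. Then, with log-moneyness $x=\log\left(\frac{K}{V_0\eta^2(S_0)}\right)$, as $x\to0$, $$\mathcal{I}_\rho\bigl(S_0,V_0,V_0\eta^2(S_0)e^x\bigr)=\frac{3}{2D}x^2-\frac{3}{10D^3}\Bigl(\sigma_0^4+2\sigma_0^3\bigl(3\sigma_1+7\eta_1\rho\sqrt{V_0}\bigr)+\beta_2\sigma_0^2+\beta_1\sigma_0+\beta_0\Bigr)x^3+O(x^4),$$ where $$\beta_0=16\eta_1^2V_0^2(\eta_1^2+6\eta_0\eta_2),$$ $$\beta_1=8\eta_1\rho V_0\bigl(3\eta_1\rho\sigma_1+7\eta_1^2\sqrt{V_0}+12\eta_0\eta_2\sqrt{V_0}\bigr),$$ $$\beta_2=4\bigl(6\eta_1\rho\sigma_1\sqrt{V_0}+6\eta_0\eta_2\rho^2V_0+\eta_1^2(5+7\rho^2)V_0\bigr).$$ Moreover, the optimal $g,h$ in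 the variational problem defining $\mathcal{I}_\rho(S_0,V_0,V_0\eta^2(S_0)e^x)$ admit the expansion $$g(t)=\log S_0+x\,g_1(t)+O(x^2),\qquad h(t)=\log V_0+x\,h_1(t)+O(x^2),\qquad x\to0,\ t\in[0,1],$$ with $$g_1(t)=\frac32\,\frac{(2\eta_1\sqrt{V_0}+\rho\sigma_0)\sqrt{V_0}\,\eta_0}{D}\,(2t-t^2),\qquad h_1(t)=\frac32\,\frac{\sigma_0(\sigma_0+2\eta_1\rho\sqrt{V_0})}{D}\,(2t-t^2).$$
   Context: For $K>0$, $$\mathcal{I}_\rho(S_0,V_0,K)=\inf_{g,h}\left\{\frac{1}{2(1-\rho^2)}\int_0^1\left(\frac{g'(t)}{\eta(e^{g(t)})\sqrt{e^{h(t)}}}-\frac{\rho h'(t)}{\sigma(e^{h(t)})}\right)^2dt+\frac12\int_0^1\left(\frac{h'(t)}{\sigma(e^{h(t)})}\right)^2dt\right\},$$ where the infimum is over absolutely continuous $g,h:[0,1]\to\mathbb{R}$ with $g(0)=\log S_0$, $h(0)=\log V_0$ and $\int_0^1e^{h(t)}\eta^2(e^{g(t)})\,dt=K$. In the expansions, $\eta_0=\eta(S_0)$, $\eta_1=S_0\eta'(S_0)$, $\sigma_0=\sigma(V_0)$, $\sigma_1=V_0\sigma'(V_0)$, and $\eta_2,\sigma_2$ are the coefficients of the squared logarithms. *)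

(* Defs.v *)
From HB Require Import structures.
From mathcomp Require Import all_boot all_order all_algebra.
From mathcomp Require Import all_classical all_reals all_analysis.

Set Implicit Arguments.
Unset Strict Implicit.
Unset Printing Implicit Defensive.

Import Order.TTheory GRing.Theory Num.Theory.
Import numFieldNormedType.Exports.

Local Open Scope ring_scope.
Local Open Scope classical_set_scope.

(* Functions on (0, +oo) are total functions R -> R of which only the values
   at positive arguments are constrained. *)
Definition twice_continuously_differentiable_pos (R : realType) (f : R -> R)
    : Prop :=
  forall s : R, 0 < s ->
    [/\ derivable f s 1, derivable f^`() s 1 & {for s, continuous f^`(2)}].

(* Only the values of f on [a, b] matter.  Degenerate intervals u i = v i are
   allowed and contribute 0 to both sums. *)
Definition absolutely_continuous_on (R : realType) (a b : R) (f : R -> R)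
    : Prop :=
  forall e : R, 0 < e ->
  exists2 d : R, 0 < d &
    forall (n : nat) (u v : 'I_n -> R),
      (forall i, [/\ a <= u i, u i <= v i & v i <= b]) ->
      trivIset [set: 'I_n] (fun i => `]u i, v i[%classic) ->
      \sum_(i < n) (v i - u i) < d ->
      \sum_(i < n) `|f (v i) - f (u i)| < e.

(* Paths [0, 1] -> R are total functions R -> R of which only the restriction
   to [0, 1] is constrained. *)
Definition admissible (R : realType) (eta : R -> R) (S0 V0 K : R)
    (g h : R -> R) : Prop :=
  [/\ absolutely_continuous_on 0 1 g,
      absolutely_continuous_on 0 1 h,
      g 0 = ln S0,
      h 0 = ln V0 &
      (\int[lebesgue_measure]_(t in `[0%R, 1%R])
         (expR (h t) * eta (expR (g t)) ^+ 2)%:E = K%:E)%E].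

(* The value may be +oo.  For absolutely continuous paths the derivatives exist
   almost everywhere on ]0, 1[ and there depend only on the paths on [0, 1];
   the (total) derivatives of g and h on the remaining null set are
   irrelevant to the integrals. *)
Definition action (R : realType) (rho : R) (eta sigma g h : R -> R) : \bar R :=
  ((2 * (1 - rho ^+ 2))^-1%:E *
     \int[lebesgue_measure]_(t in `[0%R, 1%R])
       ((derive1 g t / (eta (expR (g t)) * Num.sqrt (expR (h t)))
         - rho * derive1 h t / sigma (expR (h t))) ^+ 2)%:E
   + 2^-1%:E *
     \int[lebesgue_measure]_(t in `[0%R, 1%R])
       ((derive1 h t / sigma (expR (h t))) ^+ 2)%:E)%E.

Definition rate_function (R : realType) (rho : R) (eta sigma : R -> R)
    (S0 V0 K : R) : \bar R :=
  ereal_inf [set a | exists g h : R -> R,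
    admissible eta S0 V0 K g h /\ a = action rho eta sigma g h].

Definition optimal (R : realType) (rho : R) (eta sigma : R -> R)
    (S0 V0 K : R) (g h : R -> R) : Prop :=
  admissible eta S0 V0 K g h /\
  action rho eta sigma g h = rate_function rho eta sigma S0 V0 K.

(* Main.v *)
(* In logarithmic coordinates the action is the integral of a Lagrangian dual to
   a quadratic Hamiltonian H = (A p^2 + 2 B p q + C q^2) / 2, and the constraint
   fixes the integral of A.  A critical path solves the Hamiltonian system of
   H + lam * A, for some multiplier lam, with zero momentum at the right end;
   for small lam a Picard iteration yields such a path y_lam.  A verification
   (calibration) argument shows that, for a reference path y solving this system
   up to a defect r, every admissible (g, h) near the base point satisfies
     action (g, h) >= value y + lam * int A (g, h)
                      + c * int |(g, h) - y|^2 - C * r^2,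
   where value y is the dual value of y.  With r = 0 this gives optimality and
   uniqueness of y_lam, paths far away being excluded by their large action.
   The multiplier lam = lam1 * x + O(x^2) is found by the intermediate value
   theorem.  Since r enters squared, comparing y_lam in both directions with the
   explicit first-order path, whose defect is O(x^2), determines the optimal
   action up to O(x^4).  Competitors are merely absolutely continuous: their
   densities come from the Radon-Nikodym theorem applied to Stieltjes measures. *)
Require Import Defs.
From HB Require Import structures.
From mathcomp Require Import all_boot all_order all_algebra.
From mathcomp Require Import all_classical all_reals all_analysis.
From mathcomp Require Import measurable_realfun lebesgue_integral_differentiation.
From mathcomp Require Import ring lra.

Set Implicit Arguments.
Unset Strict Implicit.
Unset Printing Implicit Defensive.

Import Order.TTheory GRing.Theory Num.Theory.
Import numFieldNormedType.Exports.

Local Open Scope ring_scope.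
Local Open Scope classical_set_scope.


(** * Absolutely continuous functions *)

Section absolute_continuity.
Variable R : realType.
Implicit Types (a b c d e s t x y : R) (f F : R -> R).

(** The optimum is constructed and then verified, which replaces any compactness or regularity
    theory for minimisers. The obstacle in the verification: the calibrating function
    [p1 * (g - y1) + p2 * (h - y2)] leaves errors quadratic in the deviation [d] and of either sign.
    They are small because the momenta are O(lam), and a further summand [k(t) * |d|^2 / 2] with the
    weight [k(t) = (1 - t) / (4 * M)] absorbs them: [- k'(t) / 2] outweighs these errors together
    with the term of order [k^2] caused by the extra momentum [k * d]. Why a first-order path fixes
    the cubic coefficient: it misses the constraint by an amount [G] of order x^2, which the
    multiplier prices at [lam * G]; replacing [lam] by [lam1 * x] there costs only O(x^4). The cubic
    coefficient thus collects the variation of H along the explicit path, the quadratic term of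
    [exp x] and that of [A] along the path. Dividing path and momentum by lam makes the Picard
    problem regular at lam = 0, so that one contraction estimate yields both existence and Lipschitz
    dependence on lam. *)

Definition disjoint_family (I : Type) s t (u v : I -> R) :=
  (forall i, [/\ s <= u i, u i <= v i & v i <= t]) /\
  trivIset [set: I] (fun i => `]u i, v i[%classic).

Lemma disjoint_familyP (I : Type) s t (u v : I -> R) :
  (forall i, [/\ s <= u i, u i <= v i & v i <= t]) ->
  (forall i j z, u i < z < v i -> u j < z < v j -> i = j) ->
  disjoint_family s t u v.
Proof.
move=> uv dis; split=> // i j _ _ [z [/=]]; rewrite !in_itv/=.
exact: dis.
Qed.

Lemma disjoint_family_eq (I : Type) s t (u v : I -> R) i j z :
  disjoint_family s t u v -> u i < z < v i -> u j < z < v j -> i = j.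
Proof.
by move=> [_ dis] iz jz; apply: dis => //; exists z; rewrite /= !in_itv.
Qed.

(** Reindexing by [enum_val] frees the definition from ordinals; the families indexed by a sigma
    type in [ac_variation] need this. *)
Lemma ac_finType a b f e : absolutely_continuous_on a b f -> 0 < e ->
  exists2 d, 0 < d & forall (I : finType) (u v : I -> R),
    disjoint_family a b u v -> \sum_i (v i - u i) < d ->
    \sum_i `|f (v i) - f (u i)| < e.
Proof.
move=> acf e0; have [d d0 H] := acf e e0; exists d => // I u v uv.
rewrite big_enum_val/= => lt_d.
rewrite big_enum_val/=; apply: (H _ (u \o enum_val) (v \o enum_val)) => //.
- by move=> i; exact: uv.1.
- apply/trivIsetP => i j _ _ ij; apply/seteqP; split=> // z [] /=.
  rewrite !in_itv/= => iz jz; move/eqP: ij; apply.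
  exact/enum_val_inj/(disjoint_family_eq uv iz jz).
Qed.

(** Clipping every endpoint at [c] keeps the index type: an interval on the wrong side of [c]
    degenerates to a point and contributes nothing, and one that straddles [c] is split, where the
    triangle inequality applies. *)
Lemma disjoint_family_clip (I : finType) s t c (u v : I -> R) f :
  disjoint_family s t u v -> s <= c <= t ->
  exists u1 v1 u2 v2 : I -> R,
    [/\ disjoint_family s c u1 v1, disjoint_family c t u2 v2,
        \sum_i `|f (v i) - f (u i)| <=
        \sum_i `|f (v1 i) - f (u1 i)| + \sum_i `|f (v2 i) - f (u2 i)|,
        \sum_i (v1 i - u1 i) <= \sum_i (v i - u i) &
        \sum_i (v2 i - u2 i) <= \sum_i (v i - u i)].
Proof.
move=> uv /andP[sc ct].
exists (fun i => Num.min (u i) c), (fun i => Num.min (v i) c),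
  (fun i => Num.max (u i) c), (fun i => Num.max (v i) c).
split.
- apply: disjoint_familyP.
    move=> i; have [? ? ?] := uv.1 i; split.
    + by rewrite le_min; apply/andP.
    + by rewrite le_min ge_min ge_min lexx orbT andbT; apply/orP; left.
    + by rewrite ge_min lexx orbT.
  move=> i j z; rewrite !lt_min !gt_min => /andP[zi1 /andP[zi2 zc]].
  rewrite (ltNge c) (ltW zc) orbF in zi1 *.
  rewrite orbF => /andP[zj1 /andP[zj2 _]].
  by apply: (disjoint_family_eq uv (z := z)); apply/andP.
- apply: disjoint_familyP.
    move=> i; have [? ? ?] := uv.1 i; split.
    + by rewrite le_max lexx orbT.
    + by rewrite ge_max le_max le_max lexx orbT andbT; apply/orP; left.
    + by rewrite ge_max; apply/andP.
  move=> i j z; rewrite !lt_max !gt_max => /andP[/andP[zi1 cz] zi2].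
  rewrite (ltNge z c) (ltW cz) orbF in zi2 *.
  rewrite orbF => /andP[/andP[zj1 _] zj2].
  by apply: (disjoint_family_eq uv (z := z)); apply/andP.
- rewrite -big_split/=; apply: ler_sum => i _; have [su uvi vt] := uv.1 i.
  have [vc|cv] := leP (v i) c.
    have uc := le_trans uvi vc.
    by rewrite !(min_idPl _)// !(max_idPr _)// subrr normr0 addr0.
  have [uc|cu] := leP (u i) c.
    rewrite (le_trans _ (ler_normD _ _))//.
    by rewrite (_ : f c - f (u i) + (f (v i) - f c) = f (v i) - f (u i))//; ring.
  by rewrite subrr normr0 add0r.
- apply: ler_sum => i _; have [su uvi vt] := uv.1 i.
  by have [] := leP (v i) c; have [] := leP (u i) c; lra.
- apply: ler_sum => i _; have [su uvi vt] := uv.1 i.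
  by have [] := leP (v i) c; have [] := leP (u i) c; lra.
Qed.

(** The total length is the Lebesgue measure of a disjoint union contained in [[s, t]]. *)
Lemma disjoint_family_length n s t (u v : 'I_n -> R) :
  s <= t -> disjoint_family s t u v -> \sum_i (v i - u i) <= t - s.
Proof.
move=> st uv; rewrite -lee_fin.
pose mu := @lebesgue_measure R.
pose F i := `]u i, v i[%classic.
have muF i : mu (F i) = (v i - u i)%:E.
  have [_ uvi _] := uv.1 i; rewrite /mu /F lebesgue_measure_itv/= lte_fin.
  by case: ltP => // vu; rewrite (@le_anti _ _ (u i) (v i)) ?subrr// uvi vu.
have -> : (\sum_i (v i - u i))%:E = mu (\big[setU/set0]_i F i).
  transitivity (\sum_i mu (F i))%E.
    by rewrite -sumEFin; apply: eq_bigr => i _; rewrite muF.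
  apply: esym; apply: (@measure_bigsetU_ord _ _ _ (@lebesgue_measure R)).
    by move=> i; exact: measurable_itv.
  exact: uv.2.
have -> : (t - s)%:E = mu `[s, t]%classic.
  rewrite /mu lebesgue_measure_itv/= lte_fin.
  by case: ltP => // ts; rewrite (@le_anti _ _ s t) ?subrr// st ts.
apply: le_measure; rewrite ?inE//.
  by apply: bigsetU_measurable => i _; exact: measurable_itv.
move=> z; rewrite -bigcup_seq => -[i _]; have [? ? ?] := uv.1 i.
by apply: subset_itv; rewrite bnd_simp.
Qed.

(** Let [d] answer the tolerance 1. Each piece of length [d / 2] adds at most 1 to any variation
    sum, and finitely many pieces exhaust [[a, b]]. Half of [d] is taken because the length bound on
    a piece is not strict. *)
Lemma ac_bounded_variation a b f : absolutely_continuous_on a b f ->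
  exists M, forall n (u v : 'I_n -> R), disjoint_family a b u v ->
    \sum_i `|f (v i) - f (u i)| <= M.
Proof.
move=> acf; have [d d0 Hd] := acf 1 ltr01.
pose e := d / 2; have e0 : 0 < e by rewrite /e; lra.
have H k : forall t, a <= t -> t <= b -> t <= a + e *+ k ->
    forall n (u v : 'I_n -> R), disjoint_family a t u v ->
    \sum_i `|f (v i) - f (u i)| <= 1 *+ k.
  elim: k => [|k IH] t at_ tb tk n u v uv.
    rewrite big1// => i _; have [? ? ?] := uv.1 i.
    rewrite mulr0n addr0 in tk.
    by rewrite (_ : v i = u i) ?subrr ?normr0//; lra.
  pose c := Num.min t (a + e *+ k).
  have ck : c <= a + e *+ k by rewrite /c ge_min lexx orbT.
  have ct : c <= t by rewrite /c ge_min lexx.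
  have ac : a <= c by rewrite /c le_min at_ lerDl mulrn_wge0// ltW.
  have tce : t - c <= e.
    rewrite /c; case: (leP t (a + e *+ k)) => _; rewrite ?subrr ?(ltW e0)//.
    by move: tk; rewrite mulrS; lra.
  have act : a <= c <= t by rewrite ac ct.
  have [u1 [v1 [u2 [v2 [d1 d2 sum12 _ _]]]]] := disjoint_family_clip f uv act.
  rewrite mulrS addrC (le_trans sum12)// lerD//.
    by apply: (IH c) => //; lra.
  apply/ltW/Hd; [|exact: d2.2|].
    by move=> i; have [? ? ?] := d2.1 i; split; lra.
  apply: (@le_lt_trans _ _ e); last by rewrite /e; lra.
  by rewrite (le_trans (disjoint_family_length ct d2)).
pose k := Num.bound ((b - a) / e).
exists (1 *+ k) => n u v uv.
case: n u v uv => [|n] u v uv; first by rewrite big_ord0 mulrn_wge0.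
have [? ? ?] := uv.1 ord0.
apply: (H k b) => //; first lra.
rewrite -lerBlDl -mulr_natl -ler_pdivrMr//.
apply/ltW; apply: le_lt_trans (archi_boundP _); rewrite ?ler_norm//.
by rewrite divr_ge0//; lra.
Qed.

Definition variations f s t := [set x | exists n (u v : 'I_n -> R),
  disjoint_family s t u v /\ x = \sum_i `|f (v i) - f (u i)|].

Definition variation a f t := sup (variations f a t).

Section variation_of_ac.
Variables (a b : R) (f : R -> R).
Hypothesis acf : absolutely_continuous_on a b f.

Lemma variations_has_sup t : t <= b -> has_sup (variations f a t).
Proof.
move=> tb; split.
  exists 0, 0%N, (fun=> 0), (fun=> 0); split; last by rewrite big_ord0.
  by apply: disjoint_familyP => -[].
have [M HM] := ac_bounded_variation acf.
exists M => _ [n [u [v [uv ->]]]]; apply: HM; split; last exact: uv.2.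
by move=> i; have [? ? ?] := uv.1 i; split => //; lra.
Qed.

Lemma variation_ub (I : finType) t (u v : I -> R) : t <= b ->
  disjoint_family a t u v -> \sum_i `|f (v i) - f (u i)| <= variation a f t.
Proof.
move=> tb uv; rewrite big_enum_val/=.
apply: ub_le_sup; first exact: (variations_has_sup tb).2.
exists #|I|, (u \o enum_val), (v \o enum_val); split=> //.
apply: disjoint_familyP => [i|i j z iz jz]; first exact: uv.1.
exact/enum_val_inj/(disjoint_family_eq uv iz jz).
Qed.

(** A family in [[a, s]], extended by the single interval from [s] to [t], is a family in
    [[a, t]]. *)
Lemma variation_increment s t : a <= s -> s <= t -> t <= b ->
  `|f t - f s| <= variation a f t - variation a f s.
Proof.
move=> as_ st tb; have sb := le_trans st tb.
rewrite lerBrDr -lerBrDl; apply: ge_sup; first exact: (variations_has_sup sb).1.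
move=> _ [n [u [v [uv ->]]]]; rewrite lerBrDl.
pose u' (i : 'I_n.+1) := if unlift ord0 i is Some j then u j else s.
pose v' (i : 'I_n.+1) := if unlift ord0 i is Some j then v j else t.
have := @variation_ub _ t u' v' tb.
rewrite big_ord_recl /u' /v' unlift_none.
under eq_bigr do rewrite !liftK.
move=> H; apply: H; apply: disjoint_familyP => [i|i j z].
  case: unliftP => [k _|_]; last by split.
  by have [? ? ?] := uv.1 k; split => //; lra.
case: unliftP => [k ->|->]; case: unliftP => [l ->|->]//.
- by move=> iz jz; rewrite (disjoint_family_eq uv iz jz).
- by move=> /andP[? ?] /andP[? ?]; exfalso; have [? ? ?] := uv.1 k; lra.
- by move=> /andP[? ?] /andP[? ?]; exfalso; have [? ? ?] := uv.1 l; lra.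
Qed.

Lemma variation_nondecreasing s t : a <= s -> s <= t -> t <= b ->
  variation a f s <= variation a f t.
Proof.
by move=> as_ st tb; rewrite -subr_ge0 (le_trans _ (variation_increment _ _ _)).
Qed.

(** Clip an almost optimal family on [[a, t]] at [s]: its left part is at most the variation up to
    [s], so its right part loses at most [e]. *)
Lemma variation_approx s t e : a <= s -> s <= t -> t <= b -> 0 < e ->
  exists n (u v : 'I_n -> R), disjoint_family s t u v /\
    variation a f t - variation a f s <= \sum_i `|f (v i) - f (u i)| + e.
Proof.
move=> as_ st tb e0.
have [_ [n [u [v [uv ->]]]] lt_e] := sup_adherent e0 (variations_has_sup tb).
have ast : a <= s <= t by rewrite as_ st.
have [u1 [v1 [u2 [v2 [d1 d2 sum12 _ _]]]]] := disjoint_family_clip f uv ast.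
exists n, u2, v2; split => //.
have := variation_ub (le_trans st tb) d1.
move: lt_e; rewrite -/(variation a f t); lra.
Qed.

Lemma ac_variation : absolutely_continuous_on a b (variation a f).
Proof.
move=> e e0; have e20 : 0 < e / 2 by lra.
have [d d0 Hd] := ac_finType acf e20; exists d => // n u v uv dis lt_d.
(* Each of the [n] increments may lose [e'], at most [e / 2] in all; [n.+1] covers [n = 0]. *)
pose e' := e / 2 / n.+1%:R.
have e'0 : 0 < e' by rewrite /e' divr_gt0.
have /choice[w Hw] : forall i : 'I_n,
    exists w : {m : nat & ('I_m -> R) * ('I_m -> R)}%type,
    disjoint_family (u i) (v i) (projT2 w).1 (projT2 w).2 /\
    variation a f (v i) - variation a f (u i) <=
    \sum_j `|f ((projT2 w).2 j) - f ((projT2 w).1 j)| + e'.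
  move=> i; have [aui uvi vib] := uv i.
  have [m [p [q [pq H]]]] := variation_approx aui uvi vib e'0.
  by exists (existT _ m (p, q)).
(* The approximating families inside the given intervals, taken together, form one disjoint family
   of total length less than [d]. *)
pose J : finType := {i : 'I_n & 'I_(projT1 (w i))}.
pose p (j : J) := (projT2 (w (tag j))).1 (tagged j).
pose q (j : J) := (projT2 (w (tag j))).2 (tagged j).
have pq : disjoint_family a b p q.
  apply: disjoint_familyP => [[i k]|[i k] [j l] z].
    rewrite /p /q/=; have [? ? ?] := (Hw i).1.1 k.
    by have [? ? ?] := uv i; split=> //; lra.
  rewrite /p /q/= => iz jz.
  have [? ? ?] := (Hw i).1.1 k; have [? ? ?] := (Hw j).1.1 l.
  have ij : i = j.
    apply: (disjoint_family_eq (conj uv dis) (z := z)); last lra.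
    lra.
  subst j.
  by rewrite (disjoint_family_eq (Hw i).1 iz jz).
have sum_pq : \sum_j (q j - p j) < d.
  apply: le_lt_trans lt_d.
  rewrite /p /q -(sig_big_dep xpredT (fun _ => xpredT)
    (fun i k => (projT2 (w i)).2 k - (projT2 (w i)).1 k))/=.
  apply: ler_sum => i _; have [_ uvi _] := uv i.
  exact: (disjoint_family_length uvi (Hw i).1).
have := Hd _ _ _ pq sum_pq.
rewrite /p /q -(sig_big_dep xpredT (fun _ => xpredT)
    (fun i k => `|f ((projT2 (w i)).2 k) - f ((projT2 (w i)).1 k)|))/=.
move=> lt_e2.
apply: (@le_lt_trans _ _ (\sum_i
  (\sum_k `|f ((projT2 (w i)).2 k) - f ((projT2 (w i)).1 k)| + e'))).
  apply: ler_sum => i _; have [aui uvi vib] := uv i.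
  by rewrite ger0_norm ?(Hw i).2// subr_ge0 variation_nondecreasing.
rewrite big_split/= sumr_const card_ord.
suff : e' *+ n <= e / 2 by lra.
rewrite /e' -mulr_natr -mulrA ler_piMr//; first exact: ltW.
by rewrite mulrC ler_pdivrMr// mul1r ler_nat.
Qed.

End variation_of_ac.

End absolute_continuity.

(** * Radon-Nikodym densities of monotone absolutely continuous functions *)

Section density_of_ac.
Variable R : realType.
Implicit Types (a b c d e s t x y : R) (f F : R -> R).
Let mu := @lebesgue_measure R.

(** Composition with [clip 0 1] extends a function on [[0, 1]] by its end values, which turns
    statements about restrictions into statements about total functions. *)
Definition clip a b x := Num.max a (Num.min b x).

Lemma clip_in a b x : a <= b -> a <= clip a b x <= b.
Proof. by move=> ab; rewrite /clip le_max lexx ge_max ab ge_min lexx. Qed.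

Lemma clip_id a b x : a <= x -> x <= b -> clip a b x = x.
Proof. by move=> ax xb; rewrite /clip (min_idPr xb) (max_idPr ax). Qed.

Lemma clip_nondecreasing a b x y : x <= y -> clip a b x <= clip a b y.
Proof.
by move=> xy; rewrite /clip; have [] := leP b x; have [] := leP b y;
  (have [] := leP a b; have [] := leP a x; have [] := leP a y); lra.
Qed.

Lemma clip_dist a b x y : x <= y -> clip a b y - clip a b x <= y - x.
Proof.
by move=> xy; rewrite /clip; have [] := leP b x; have [] := leP b y;
  (have [] := leP a b; have [] := leP a x; have [] := leP a y); lra.
Qed.

Lemma ac_clip_continuous a b f : a <= b -> absolutely_continuous_on a b f ->
  continuous (fun x => f (clip a b x)).
Proof.
move=> ab acF; set G0 := (fun x => _); have clab x := clip_in x ab.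
move=> x; apply/(@cvgrPdist_lt _ R^o) => e e0.
have [d d0 Hd] := acF e e0.
have Hd1 s t : s <= t -> t - s < d -> `|G0 t - G0 s| < e.
  move=> st tsd; have := Hd 1%N (fun=> clip a b s) (fun=> clip a b t).
  rewrite !big_ord1; apply.
  - move=> _; split; last by have /andP[] := clab t.
      by have /andP[] := clab s.
    exact: clip_nondecreasing.
  - by apply/trivIsetP => i j _ _; rewrite !ord1 eqxx.
  - exact: le_lt_trans (clip_dist a b st) tsd.
near=> y; have xyd : `|x - y| < d.
  by near: y; exact: (@nbhsx_ballx _ R^o).
have [xy|/ltW yx] := leP x y.
  by rewrite distrC; apply: Hd1 => //; rewrite -[X in X < _]ger0_norm
    ?subr_ge0// distrC.
by apply: Hd1 => //; rewrite -[X in X < _]ger0_norm ?subr_ge0.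
Unshelve. all: by end_near. Qed.

Lemma stieltjes_itv (G : cumulative R R) s t : s <= t ->
  lebesgue_stieltjes_measure G `]s, t]%classic = (G t - G s)%:E.
Proof.
move=> st; rewrite /lebesgue_stieltjes_measure/= /measure_extension/=.
rewrite measurable_mu_extE/=; last exact: is_ocitv.
rewrite wlength_itv/= lte_fin.
by case: ltP => // ts; rewrite (@le_anti _ _ s t) ?subrr// st ts.
Qed.

Lemma open_bounded_interval (A : set R) : open A -> is_interval A ->
  has_lbound A -> has_ubound A ->
  A = `]inf A, sup A[%classic /\ inf A <= sup A.
Proof.
move=> oA iA lA uA; split.
  rewrite [LHS](_ : _ = A°); last by exact/esym/interior_id.
  by rewrite interval_bounded_interior.
have [->|/set0P[x Ax]] := eqVneq A set0; first by rewrite inf0 sup0.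
by apply: (@le_trans _ _ x); [exact: ge_inf|exact: ub_le_sup].
Qed.

(** The Stieltjes measure of the clipped [F], restricted to []a, b]], is dominated by Lebesgue
    measure: a null set lies in an open set of measure less than [d], and absolute continuity
    applies to the components of that set. The density is the Radon-Nikodym derivative. *)
Lemma nondecreasing_ac_density a b F : a < b ->
  (forall s t, a <= s -> s <= t -> t <= b -> F s <= F t) ->
  absolutely_continuous_on a b F ->
  exists2 phi : R -> R, mu.-integrable setT (EFin \o phi) &
    forall s t, a <= s -> s <= t -> t <= b ->
      F t - F s = \int[mu]_(x in `]s, t]) phi x.
Proof.
move=> ab ndF acF; pose G0 x := F (clip a b x).
have clab x := clip_in x (ltW ab).
have ndG : {homo G0 : x y / x <= y}.
  move=> x y xy; rewrite /G0; apply: ndF; last first.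
  - by have /andP[] := clab y.
  - exact: clip_nondecreasing.
  - by have /andP[] := clab x.
have cG0 : continuous G0 by apply: ac_clip_continuous => //; exact: ltW.
have rcG := right_continuousW cG0.
pose G : cumulative R R := HB.pack G0 (isCumulative.Build R _ R G0 ndG rcG).
pose nu0 : {measure set (measurableTypeR R) -> \bar R} :=
  lebesgue_stieltjes_measure G.
have mab : measurable (`]a, b]%classic : set (measurableTypeR R)).
  exact: measurable_itv.
have nu0ab : (nu0 `]a, b]%classic < +oo)%E.
  rewrite [X in (X < _)%E](_ : _ = (G b - G a)%:E) ?ltry//.
  exact: stieltjes_itv (ltW ab).
pose nu : {finite_measure set _ -> \bar R} := mfrestr mab nu0ab.
have nu_mu : nu `<< mu.
  apply/(null_content_dominatesP _ mu) => N mN muN0.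
  apply/eqP; rewrite eq_le measure_ge0 andbT; apply/lee_addgt0Pr => e e0.
  rewrite add0e; have [d d0 Hd] := acF e e0.
  pose N1 := N `&` `]a, b]%classic.
  have mN1 : measurable N1 by exact: measurableI.
  have muN1 : mu N1 = 0%E.
    apply/eqP; rewrite eq_le measure_ge0 andbT -[leRHS]muN0.
    by apply: le_measure; [rewrite inE.. | exact: subIsetl].
  have [|U [oU NU lt_d]] := @lebesgue_regularity_outer _ N1 d mN1 _ d0.
    by rewrite [X in (X < _)%E]muN1.
  (* Boundedness of the open set makes the real numbers [inf] and [sup] of each component its actual
     endpoints. *)
  pose U1 := U `&` `]a - 1, b + 1[%classic.
  have oU1 : open U1 by apply: openI => //; exact: interval_open.
  have N1U1 : N1 `<=` U1.
    move=> x Nx; split; first exact: NU.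
    by case: Nx => _ /=; rewrite !in_itv/= => /andP[? ?]; apply/andP; split; lra.
  have muU1 : (mu U1 < d%:E)%E.
    apply: le_lt_trans lt_d.
    have mU : measurable U by exact: open_measurable.
    rewrite -[leRHS]add0e -[X in (_ <= X + _)%E]muN1.
    apply: (@le_trans _ _ (mu (N1 `|` (U `\` N1)))).
      apply: le_measure; rewrite ?inE.
      - exact: open_measurable.
      - by apply: measurableU => //; exact: measurableD.
      - by move=> x [Ux _]; have [Nx|Nx] := pselect (N1 x); [left|right].
    by apply: measureU2 => //; exact: measurableD.
  pose I := open_disjoint_itv oU1.
  have IE k : I k = `]inf (I k), sup (I k)[%classic /\ inf (I k) <= sup (I k).
    have IU : I k `<=` `]a - 1, b + 1[%classic.
      move=> x Ix; have : U1 x by rewrite (open_disjoint_itv_bigcup oU1); exists k.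
      by case.
    apply: open_bounded_interval.
    - exact: open_disjoint_itv_open.
    - exact: open_disjoint_itv_is_interval.
    - by exists (a - 1) => x /IU /=; rewrite in_itv/= => /andP[/ltW].
    - by exists (b + 1) => x /IU /=; rewrite in_itv/= => /andP[_ /ltW].
  have mI k : measurable (I k) by rewrite (IE k).1; exact: measurable_itv.
  have muI k : mu (I k) = (sup (I k) - inf (I k))%:E.
    rewrite {1}(IE k).1 /mu lebesgue_measure_itv/= lte_fin.
    case: ltP => // ts; rewrite (@le_anti _ _ (inf (I k)) (sup (I k))) ?subrr//.
    by rewrite (IE k).2 ts.
  have tI : trivIset setT I by exact: open_disjoint_itv_trivIset.
  have UI : U1 = \bigcup_k I k by exact: open_disjoint_itv_bigcup.
  have mUI : measurable (\bigcup_k I k) by rewrite -UI; exact: open_measurable.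
  have nuI k : (nu (I k) <= (G0 (sup (I k)) - G0 (inf (I k)))%:E)%E.
    rewrite -[leRHS](stieltjes_itv G (IE k).2).
    change (nu0 (I k `&` `]a, b]%classic) <= nu0 `]inf (I k), sup (I k)]%classic)%E.
    apply: le_measure.
    - by rewrite inE; apply: measurableI; [exact: mI|exact: mab].
    - by rewrite inE; exact: measurable_itv.
    - by apply: subset_trans (@subIsetl _ _ _) _; rewrite {1}(IE k).1;
        exact: subset_itv_oo_oc.
  apply: (@le_trans _ _ (nu U1)).
    change (nu0 N1 <= nu0 (U1 `&` `]a, b]%classic))%E.
    apply: le_measure.
    - by rewrite inE.
    - by rewrite inE; apply: measurableI; [exact: (open_measurable oU1)|exact: mab].
    - by move=> x Nx; split; [exact: (N1U1 x Nx)|exact: Nx.2].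
  rewrite UI (@measure_semi_bigcup _ _ _ nu _ mI tI mUI).
  (* Bounding the finite partial sums suffices, and finite families are what absolute continuity
     speaks of. *)
  apply: lime_le; first exact: is_cvg_nneseries.
  apply: nearW => n; rewrite big_mkord.
  apply: (@le_trans _ _ (\sum_(i < n) (G0 (sup (I i)) - G0 (inf (I i)))%:E)%E).
    by apply: lee_sum => i _; exact: nuI.
  rewrite sumEFin lee_fin.
  apply: (@le_trans _ _ (\sum_(i < n) `|G0 (sup (I i)) - G0 (inf (I i))|)).
    by apply: ler_sum => i _; exact: ler_norm.
  apply/ltW/Hd.
  - move=> i; split.
    + by have /andP[] := clab (inf (I i)).
    + exact/clip_nondecreasing/(IE i).2.
    + by have /andP[] := clab (sup (I i)).
  - apply/trivIsetP => i j _ _ ij; apply/seteqP; split=> // z [] /=.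
    rewrite !in_itv/= => /andP[iz zi] /andP[jz zj].
    have clipI k :
        clip a b (inf (I k)) < z -> z < clip a b (sup (I k)) -> I k z.
      rewrite [X in _ -> _ -> X](_ : _ = `]inf (I k), sup (I k)[%classic z);
        last by rewrite -(IE k).1.
      rewrite /= in_itv/= /clip !gt_max !lt_max !gt_min !lt_min.
      move=> /andP[az /orP[bz|->]] /orP[za|/andP[zb ->]]//; exfalso; lra.
    have := trivIsetP.1 tI i j Logic.I Logic.I.
    rewrite val_eqE => /(_ ij) /seteqP[+ _] => /(_ z); apply; split.
      exact: clipI.
    exact: clipI.
  - rewrite -lte_fin; apply: le_lt_trans muU1.
    apply: (@le_trans _ _ (\sum_(i < n) mu (I i))%E).
      rewrite -sumEFin; apply: lee_sum => i _; rewrite muI lee_fin.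
      exact/clip_dist/(IE i).2.
    have -> : mu U1 = (\sum_(k <oo) mu (I k))%E.
      rewrite {1}UI.
      exact: (@measure_semi_bigcup _ _ _ (@lebesgue_measure R) _ mI tI mUI).
    by rewrite -(big_mkord xpredT (fun i => mu (I i))); apply: nneseries_lim_ge.
have [phi [phi0 phifin intphi nuE]] := radon_nikodym_sigma_finite nu_mu.
have phiE : EFin \o (fine \o phi) = phi.
  by apply/funext => x /=; rewrite fineK.
exists (fine \o phi); first by rewrite phiE.
move=> s t as_ st tb.
have mst : measurable (`]s, t]%classic : set (measurableTypeR R)).
  exact: measurable_itv.
have nust : nu `]s, t]%classic = (F t - F s)%:E.
  change (nu0 (`]s, t]%classic `&` `]a, b]%classic) = (F t - F s)%:E).
  rewrite setIidl; last by apply: subset_itv; rewrite bnd_simp.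
  rewrite [LHS](stieltjes_itv G st) /= /G0 !clip_id//.
  - exact: le_trans st tb.
  - exact: le_trans as_ st.
have := nuE _ mst; rewrite nust /Rintegral => FE.
rewrite [X in fine X](_ : _ = (F t - F s)%:E)//.
by rewrite FE; apply: eq_integral => x _ /=; rewrite fineK.
Qed.

End density_of_ac.

(** * Differentiation almost everywhere of absolutely continuous functions *)

Section ac_derivative.
Variable R : realType.
Implicit Types (a b c d e s t x y : R) (f g W : R -> R).
Let mu := @lebesgue_measure R.

(** The common source of the closure properties: increments of sums, products and Lipschitz
    functions are all dominated in this way. *)
Lemma ac_dominated a b f g W C : 0 <= C ->
  absolutely_continuous_on a b f -> absolutely_continuous_on a b g ->
  (forall s t, a <= s -> s <= t -> t <= b ->
    `|W t - W s| <= C * (`|f t - f s| + `|g t - g s| + (t - s))) ->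
  absolutely_continuous_on a b W.
Proof.
move=> C0 acf acg HW e e0.
(* One third of the tolerance for each of the three sums; [C + 1] keeps the quotient meaningful when
   [C = 0]. *)
pose e' := e / (3 * (C + 1)).
have C1 : 0 < 3 * (C + 1) by lra.
have e'0 : 0 < e' by rewrite /e' divr_gt0.
have [d1 d10 H1] := acf e' e'0; have [d2 d20 H2] := acg e' e'0.
exists (Num.min e' (Num.min d1 d2)).
  by rewrite !lt_min e'0 d10.
move=> n u v uv tr; rewrite !lt_min => /andP[lte' /andP[ltd1 ltd2]].
have := H1 _ _ _ uv tr ltd1; have := H2 _ _ _ uv tr ltd2 => Hg Hf.
apply: (@le_lt_trans _ _ (\sum_(i < n)
    C * (`|f (v i) - f (u i)| + `|g (v i) - g (u i)| + (v i - u i)))).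
  by apply: ler_sum => i _; have [? ? ?] := uv i; exact: HW.
rewrite -mulr_sumr big_split [X in _ * (X + _)]big_split/=.
set Sf := \sum_(i < n) `|f _ - _| in Hf *.
set Sg := \sum_(i < n) `|g _ - _| in Hg *.
set Sl := \sum_(i < n) _ in lte' *.
have -> : e = (C + 1) * (e' + e' + e') by rewrite /e'; field; lra.
have [Sl0 Sf0 Sg0] : [/\ 0 <= Sl, 0 <= Sf & 0 <= Sg].
  split; apply: sumr_ge0 => i _ //; have [? ? ?] := uv i; lra.
apply: (@le_lt_trans _ _ ((C + 1) * (Sf + Sg + Sl))).
  by apply: ler_wpM2r; lra.
by rewrite ltr_pM2l; lra.
Qed.

(** Jordan decomposition: [f] is the difference of [V + f] and its variation [V], both nondecreasing
    because [f] moves at most as much as [V] grows. The Lebesgue differentiation form of the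
    fundamental theorem then turns the density into a derivative almost everywhere. *)
Theorem ac_density a b f : a < b -> absolutely_continuous_on a b f ->
  exists psi : R -> R, [/\ mu.-integrable setT (EFin \o psi),
    (forall s t, a <= s -> s <= t -> t <= b ->
      f t - f s = \int[mu]_(x in `]s, t]) psi x) &
    {ae mu, forall x, a < x < b -> is_derive x (1 : R) f (psi x)}].
Proof.
move=> ab acf; pose V := variation a f.
have acV : absolutely_continuous_on a b V by exact: ac_variation.
pose F x := V x + f x.
have acF : absolutely_continuous_on a b F.
  apply: (ac_dominated ler01 acV acf) => s t as_ st tb.
  rewrite mul1r (_ : F t - F s = (V t - V s) + (f t - f s)).
    by have := ler_normD (V t - V s) (f t - f s); lra.
  by rewrite /F; ring.
have incr s t : a <= s -> s <= t -> t <= b -> `|f t - f s| <= V t - V s.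
  by move=> as_ st tb; exact: (variation_increment acf).
have [p1 ip1 p1E] : exists2 phi : R -> R, mu.-integrable setT (EFin \o phi) &
    forall s t, a <= s -> s <= t -> t <= b ->
      F t - F s = \int[mu]_(x in `]s, t]) phi x.
  apply: nondecreasing_ac_density => // s t as_ st tb.
  by have := incr _ _ as_ st tb; rewrite ler_norml /F => /andP[]; lra.
have [p2 ip2 p2E] : exists2 phi : R -> R, mu.-integrable setT (EFin \o phi) &
    forall s t, a <= s -> s <= t -> t <= b ->
      V t - V s = \int[mu]_(x in `]s, t]) phi x.
  apply: nondecreasing_ac_density => // s t as_ st tb.
  exact: (variation_nondecreasing acf as_ st tb).
have ipsi : mu.-integrable setT (EFin \o (p1 \- p2)).
  rewrite (_ : _ \o _ = (EFin \o p1) \- (EFin \o p2))%E; last by apply/funext.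
  exact: integrableB.
have psiE s t : a <= s -> s <= t -> t <= b ->
      f t - f s = \int[mu]_(x in `]s, t]) (p1 \- p2) x.
  move=> as_ st tb; rewrite /= RintegralB//; last 2 first.
    by apply: integrableS ip1.
    by apply: integrableS ip2.
  by rewrite -p1E// -p2E// /F; ring.
exists (p1 \- p2); split => //.
have locp : locally_integrable setT (p1 \- p2).
  by apply: open_integrable_locally => //; exact: openT.
have ip y : mu.-integrable [set` Interval (BRight a) (BRight y)]
    (EFin \o (p1 \- p2)).
  by apply: integrableS ipsi.
have := FTC1 ip locp.
apply: filterS; first exact: (ae_filter_ringOfSetsType mu).
move=> x /= Hx /andP[ax xb].
have [] := Hx ax.
set G := (fun y => \int[mu]_(t in _) _) => dG G'.
have dfG : is_derive x (1 : R) (cst (f a) + G) ((p1 \- p2) x).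
  rewrite -[X in is_derive _ _ _ X]add0r; apply: is_deriveD.
  by apply: DeriveDef; [exact: dG|rewrite -derive1E; exact: G'].
apply: near_eq_is_derive dfG; near=> y.
rewrite fctE /cst/= /G -psiE//; first ring.
- by apply/ltW; near: y; exact: lt_nbhsr.
- by apply/ltW; near: y; exact: lt_nbhsl.
Unshelve. all: by end_near. Qed.

End ac_derivative.

(** * The action *)

Section action_density.
Variable R : realType.
Let mu := @lebesgue_measure R.
Local Notation I01 := (`[0%R, 1%R]%classic : set (measurableTypeR R)).

Section nonmeasurable.
Import HBNNSimple.
Context d (T : measurableType d) (m : {measure set T -> \bar R}).
Local Open Scope ereal_scope.

(** A simple function below [f], multiplied by the indicator of the complement of the null set, lies
    below [g] and keeps its integral. *)
Lemma le_ae_integral_ge0 (D : set T) (f g : T -> \bar R) : measurable D ->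
  (forall x, D x -> 0 <= f x) -> (forall x, D x -> 0 <= g x) ->
  {ae m, forall x, D x -> f x = g x} ->
  \int[m]_(x in D) f x <= \int[m]_(x in D) g x.
Proof.
move=> mD f0 g0 [N [mN N0 subN]].
rewrite !ge0_integralE//; apply: ge_ereal_sup => _ [h /= hf <-].
have mNC : measurable (~` N) by exact: measurableC.
pose k := mul_nnsfun h (indic_nnsfun R mNC).
have <- : sintegral m k = sintegral m h.
  rewrite -!integralT_nnsfun; apply: ae_eq_integral => //.
  - exact/measurable_EFinP.
  - exact/measurable_EFinP.
  - exists N; split => // x /= xk; apply: contrapT => Nx; apply: xk => _.
    by rewrite /= /mindic/= indicE mem_set// mulr1.
apply: ereal_sup_ubound; exists k => //= x.
rewrite /mindic/= indicE; have [/set_mem Nx|/negP xN] := boolP (x \in ~` N).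
  rewrite mulr1 (le_trans (hf x))// !patchE; case: ifPn => // /set_mem Dx.
  rewrite le_eqVlt; apply/orP; left; apply/eqP.
  by apply: contrapT => fg; apply: Nx; apply: subN => /= H; exact/fg/H.
by rewrite mulr0 erestrict_ge0.
Qed.

(* [f] need not be measurable: the integral of a nonnegative function is a
   supremum over the simple functions below it. *)
Lemma ae_eq_integral_ge0 (D : set T) (f g : T -> \bar R) : measurable D ->
  (forall x, D x -> 0 <= f x) -> (forall x, D x -> 0 <= g x) ->
  {ae m, forall x, D x -> f x = g x} ->
  \int[m]_(x in D) f x = \int[m]_(x in D) g x.
Proof.
move=> mD f0 g0 fg; apply/eqP; rewrite eq_le !le_ae_integral_ge0//.
by apply: filterS fg => x /[apply].
Qed.

End nonmeasurable.

Definition lagrangian (rho : R) (eta sigma : R -> R) (y1 y2 v1 v2 : R) : R :=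
  (2 * (1 - rho ^+ 2))^-1 *
    (v1 / (eta (expR y1) * Num.sqrt (expR y2))
     - rho * v2 / sigma (expR y2)) ^+ 2
  + 2^-1 * (v2 / sigma (expR y2)) ^+ 2.

Section action.
Variables (rho : R) (eta sigma : R -> R).
Hypothesis rho_lt1 : -1 < rho < 1.
Hypothesis eta_gt0 : forall s : R, 0 < s -> 0 < eta s.
Hypothesis sigma_gt0 : forall s : R, 0 < s -> 0 < sigma s.
Hypothesis eta_cont : forall s : R, 0 < s -> {for s, continuous eta}.
Hypothesis sigma_cont : forall s : R, 0 < s -> {for s, continuous sigma}.
Variables (g h : R -> R).
Hypothesis acg : absolutely_continuous_on 0 1 g.
Hypothesis ach : absolutely_continuous_on 0 1 h.

Lemma one_rho2_gt0 : 0 < 1 - rho ^+ 2.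
Proof. by have /andP[? ?] := rho_lt1; nra. Qed.

Lemma lagrangian_ge0 y1 y2 v1 v2 : 0 <= lagrangian rho eta sigma y1 y2 v1 v2.
Proof.
have ? := one_rho2_gt0.
by rewrite addr_ge0// mulr_ge0 ?sqr_ge0 ?invr_ge0//; lra.
Qed.

Lemma continuous_comp_expR (f k : R -> R) :
  (forall s : R, 0 < s -> {for s, continuous f}) -> continuous k ->
  continuous (fun t => f (expR (k t))).
Proof.
move=> cf ck t.
apply: (@continuous_comp _ _ _ (expR \o k) f).
  by apply: continuous_comp; [exact: ck|exact: continuous_expR].
by apply: cf; exact: expR_gt0.
Qed.

(** Nothing is known about the measurability of [derive1 g] and [derive1 h] as total functions; the
    densities give an integrand that is measurable and equal to the original one almost
    everywhere. *)
Lemma action_density (p q : R -> R) :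
  mu.-integrable setT (EFin \o p) -> mu.-integrable setT (EFin \o q) ->
  {ae mu, forall x : R, 0 < x < 1 -> is_derive x (1 : R) g (p x)} ->
  {ae mu, forall x : R, 0 < x < 1 -> is_derive x (1 : R) h (q x)} ->
  measurable_fun I01
    (fun t => lagrangian rho eta sigma (g t) (h t) (p t) (q t)) /\
  action rho eta sigma g h = (\int[mu]_(t in `[0%R, 1%R])
    (lagrangian rho eta sigma (g t) (h t) (p t) (q t))%:E)%E.
Proof.
move=> ip iq gp hq.
pose cg t := g (clip 0 1 t); pose ch t := h (clip 0 1 t).
have ccg : continuous cg by exact: ac_clip_continuous.
have cch : continuous ch by exact: ac_clip_continuous.
pose e1 t := p t / (eta (expR (g t)) * Num.sqrt (expR (h t)))
  - rho * q t / sigma (expR (h t)).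
pose e2 t := q t / sigma (expR (h t)).
have m01 : measurable I01.
  exact: measurable_itv.
have mp : measurable_fun I01 p.
  by apply: measurable_funTS; apply/measurable_EFinP; exact: measurable_int ip.
have mq : measurable_fun I01 q.
  by apply: measurable_funTS; apply/measurable_EFinP; exact: measurable_int iq.
have msig : continuous (fun t => (sigma (expR (ch t)))^-1).
  move=> t; apply: cvgV; first by rewrite gt_eqF// sigma_gt0 ?expR_gt0.
  exact: continuous_comp_expR.
have meta : continuous (fun t => (eta (expR (cg t)) * Num.sqrt (expR (ch t)))^-1).
  move=> t; apply: cvgV.
    by rewrite gt_eqF// mulr_gt0 ?eta_gt0 ?sqrtr_gt0 ?expR_gt0.
  apply: cvgM; first exact: continuous_comp_expR.
  apply: (@continuous_comp_expR _ ch) => // s s0; exact: sqrt_continuous.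
have me2 : measurable_fun I01 e2.
  apply: (@eq_measurable_fun _ _ _ _ _ (fun t => q t * (sigma (expR (ch t)))^-1)).
    by move=> t /set_mem /=; rewrite in_itv/= /e2 /ch => /andP[? ?]; rewrite clip_id.
  apply: measurable_funM => //; apply: measurable_funTS.
  exact: continuous_measurable_fun.
have me1 : measurable_fun I01 e1.
  apply: (@eq_measurable_fun _ _ _ _ _
    (fun t => p t * (eta (expR (cg t)) * Num.sqrt (expR (ch t)))^-1 - rho * e2 t)).
    move=> t /set_mem /=; rewrite in_itv/= /e1 /e2 /ch /cg => /andP[? ?].
    by rewrite clip_id// mulrA.
  apply: measurable_funB; last exact: measurable_funM.
  apply: measurable_funM => //; apply: measurable_funTS.
  exact: continuous_measurable_fun.
(* Differentiability is available in the open interval only; the two endpoints form a null set. *)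
have aeoo : {ae mu, forall x : R, `[0%R, 1%R]%classic x -> 0 < x < 1}.
  exists [set 0; 1]; split.
  - exact: measurableU.
  - exact/countable_lebesgue_measure0/finite_set_countable.
  - move=> x /= H; apply: contrapT => /not_orP[x0 x1]; apply: H.
    rewrite in_itv/= !le_eqVlt => /andP[/predU1P[|->]]; first by move/esym.
    by move=> /predU1P[|->].
have aeF : Filter (almost_everywhere mu) by exact: (ae_filter_ringOfSetsType mu).
have aeg : {ae mu, forall x : R, `[0%R, 1%R]%classic x -> g^`() x = p x}.
  apply: filterS2 aeoo gp => x Hx Hp /Hx/Hp gpx.
  by rewrite derive1E; exact: derive_val.
have aeh : {ae mu, forall x : R, `[0%R, 1%R]%classic x -> h^`() x = q x}.
  apply: filterS2 aeoo hq => x Hx Hp /Hx/Hp gpx.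
  by rewrite derive1E; exact: derive_val.
have rho0 := one_rho2_gt0.
split.
  apply: measurable_funD; apply: measurable_funM => //; exact: measurable_funX.
have sqr0 x : (0 <= (x ^+ 2 : R)%:E)%E by rewrite lee_fin sqr_ge0.
transitivity ((2 * (1 - rho ^+ 2))^-1%:E * \int[mu]_(t in I01) (e1 t ^+ 2)%:E +
    2^-1%:E * \int[mu]_(t in I01) (e2 t ^+ 2)%:E)%E.
  rewrite /action; congr (_ * _ + _ * _)%E.
    apply: (@ae_eq_integral_ge0 _ _ mu) => //.
    by apply: filterS2 aeg aeh => x Hg Hh xD; rewrite /e1 -Hg// -Hh.
  apply: (@ae_eq_integral_ge0 _ _ mu) => //.
  by apply: filterS aeh => x Hh xD; rewrite /e2 -Hh.
have me (k : R -> R) : measurable_fun I01 k ->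
  measurable_fun I01
    (fun t => (k t ^+ 2)%:E).
  by move=> mk; apply/measurable_EFinP; exact: measurable_funX.
have c1 : 0 <= (2 * (1 - rho ^+ 2))^-1 by rewrite invr_ge0; lra.
rewrite -!ge0_integralZl//; [|exact: me|exact: me].
rewrite -ge0_integralD//.
- by move=> t _; rewrite mule_ge0.
- by apply: emeasurable_funM => //; exact: me.
- by move=> t _; rewrite mule_ge0.
- by apply: emeasurable_funM => //; exact: me.
Qed.

End action.
End action_density.

(** * Evaluation of the action and lower bounds for it *)

Section action_bounds.
Variable R : realType.
Let mu := @lebesgue_measure R.
Local Notation I01 := (`[0%R, 1%R]%classic : set (measurableTypeR R)).

Lemma ac_subitv (a b a' b' : R) (f : R -> R) : a <= a' -> b' <= b ->
  absolutely_continuous_on a b f -> absolutely_continuous_on a' b' f.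
Proof.
move=> aa bb acf e e0; have [d d0 Hd] := acf e e0; exists d => // n u v uv.
by apply: Hd => i; have [? ? ?] := uv i; split => //; lra.
Qed.

Variables (rho : R) (eta sigma : R -> R).
Hypothesis rho_lt1 : -1 < rho < 1.
Hypothesis eta_gt0 : forall s : R, 0 < s -> 0 < eta s.
Hypothesis sigma_gt0 : forall s : R, 0 < s -> 0 < sigma s.
Hypothesis eta_cont : forall s : R, 0 < s -> {for s, continuous eta}.
Hypothesis sigma_cont : forall s : R, 0 < s -> {for s, continuous sigma}.
Variables (g h : R -> R).
Hypothesis acg : absolutely_continuous_on 0 1 g.
Hypothesis ach : absolutely_continuous_on 0 1 h.
Local Notation lag := (lagrangian rho eta sigma).

Lemma action_smooth (L : R -> R) : continuous L ->
  (forall t : R, 0 < t < 1 -> exists dg dh, [/\ is_derive t (1 : R) g dg,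
    is_derive t (1 : R) h dh & lag (g t) (h t) dg dh = L t]) ->
  action rho eta sigma g h = (\int[mu]_(t in `[0%R, 1%R]) (L t)%:E)%E.
Proof.
move=> cL HL.
have [p [ip _ gp]] := ac_density ltr01 acg.
have [q [iq _ hq]] := ac_density ltr01 ach.
have [mlag ->] := action_density rho_lt1 eta_gt0 sigma_gt0 eta_cont sigma_cont
  acg ach ip iq gp hq.
have aeF : Filter (almost_everywhere mu) by exact: (ae_filter_ringOfSetsType mu).
rewrite integral_itv_bndoo; last first.
  apply: measurable_funS (measurable_itv _) _ _; last first.
    by apply/measurable_EFinP; exact: mlag.
  exact: subset_itv_oo_cc.
rewrite [RHS]integral_itv_bndoo; last first.
  by apply: measurable_funTS; apply/measurable_EFinP; exact: continuous_measurable_fun.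
apply: ae_eq_integral.
- exact: measurable_itv.
- apply: measurable_funS (measurable_itv _) _ _; last first.
    by apply/measurable_EFinP; exact: mlag.
  exact: subset_itv_oo_cc.
- by apply: measurable_funTS; apply/measurable_EFinP; exact: continuous_measurable_fun.
apply: filterS2 gp hq => t Hg Hh /=; rewrite in_itv/= => t01.
have [dg [dh [gdg hdh <-]]] := HL t t01.
have := @derive_val _ _ _ _ _ _ _ (Hg t01).
have := @derive_val _ _ _ _ _ _ _ (Hh t01).
by rewrite !derive_val => <- <-.
Qed.

(** Integrated form of a verification inequality: [m] collects the terms that do not involve the
    velocities. The final time [tau] may be smaller than 1, so that a path can be followed just
    until it leaves a box. *)
Lemma action_ge (tau N : R) (W m : R -> R) : 0 < tau <= 1 -> 0 < N ->
  absolutely_continuous_on 0 tau W ->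
  mu.-integrable `]0%R, tau] (EFin \o m) ->
  (forall t dg dh : R, 0 < t < tau -> is_derive t (1 : R) g dg ->
    is_derive t (1 : R) h dh ->
    exists2 dW, is_derive t (1 : R) W dW & dW <= N * lag (g t) (h t) dg dh + m t) ->
  ((W tau - W 0 - \int[mu]_(t in `]0%R, tau]) m t)%:E <=
    N%:E * action rho eta sigma g h)%E.
Proof.
move=> /andP[tau0 tau1] N0 acW im HW.
have [p [ip _ gp]] := ac_density ltr01 acg.
have [q [iq _ hq]] := ac_density ltr01 ach.
have [w [iw wE Ww]] := ac_density tau0 acW.
have [mlag ->] := action_density rho_lt1 eta_gt0 sigma_gt0 eta_cont sigma_cont
  acg ach ip iq gp hq.
have aeF : Filter (almost_everywhere mu) by exact: (ae_filter_ringOfSetsType mu).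
have mtau : measurable (`]0, tau]%classic : set (measurableTypeR R)).
  exact: measurable_itv.
have sub : (`]0, tau]%classic : set (measurableTypeR R)) `<=` I01.
  by apply: subset_itv; rewrite bnd_simp.
rewrite wE//; last exact: ltW.
have iw' : mu.-integrable `]0%R, tau] (EFin \o w) by apply: integrableS iw.
pose k := w \- m.
have iwm : mu.-integrable `]0%R, tau] (EFin \o k).
  rewrite (_ : _ \o _ = (EFin \o w) \- (EFin \o m))%E; last by apply/funext.
  exact: integrableB.
rewrite -RintegralB// -/k /Rintegral fineK; last exact: integrable_fin_num.
have mL : measurable_fun (`]0, tau]%classic : set (measurableTypeR R))
    (fun t => (lag (g t) (h t) (p t) (q t))%:E).
  apply: measurable_funS (measurable_itv _) sub _.
  by apply/measurable_EFinP; exact: mlag.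
have lag0 t : (0 <= (lag (g t) (h t) (p t) (q t))%:E)%E.
  by rewrite lee_fin lagrangian_ge0.
have mwm : measurable_fun (`]0, tau]%classic : set (measurableTypeR R))
    (EFin \o k) by exact: measurable_int iwm.
(* The action may be infinite, so the comparison goes through the positive part of [k]; it stays
   below [N * lag] because the Lagrangian is nonnegative. *)
apply: (@le_trans _ _ (\int[mu]_(t in `]0%R, tau]) ((EFin \o k)^\+ t))%E).
  by rewrite [leLHS]integralE -[leRHS]sube0 leeB// integral_ge0.
apply: (@le_trans _ _ (\int[mu]_(t in `]0%R, tau])
    (N%:E * (lag (g t) (h t) (p t) (q t))%:E))%E).
  apply: ae_ge0_le_integral => //.
  - exact: measurable_funepos.
  - by move=> t _; rewrite mule_ge0// lee_fin ltW.
  - exact: emeasurable_funM.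
  have aet : {ae mu, forall x : R, x != tau}.
    exists [set tau]; split => //; first exact: lebesgue_measure_set1.
    by move=> x /= /negP; rewrite negbK => /eqP.
  apply: filterS2 (filterI aet Ww) (filterI gp hq) => t [tn Hw] [Hg Hh] /=.
  rewrite in_itv/= => /andP[t0 tt].
  have t0tau : 0 < t < tau by rewrite t0 lt_neqAle tn.
  have t01 : 0 < t < 1 by move: t0tau; lra.
  have [dW WdW dWle] := HW _ _ _ t0tau (Hg t01) (Hh t01).
  have wdW : w t = dW.
    by rewrite -(@derive_val _ _ _ _ _ _ _ (Hw t0tau)) derive_val.
  rewrite funeposE ge_max mule_ge0 ?lee_fin ?(ltW N0)//.
    by rewrite andbT /k /= wdW; lra.
  exact: lagrangian_ge0.
rewrite ge0_integralZl//; last by rewrite lee_fin ltW.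
rewrite lee_pmul2l ?lte_fin//; apply: ge0_subset_integral => //.
by apply/measurable_EFinP; exact: mlag.
Qed.

End action_bounds.

(** * Calculus on the unit interval *)

Section integral01.
Variable R : realType.
Let mu := @lebesgue_measure R.
Implicit Types (f g : R -> R) (t x y k : R).

Definition cont01 f := continuous (fun t => f (clip 0 1 t)).

Definition integral01 f : R := \int[mu]_(t in `[0, 1]) f t.

Lemma clip_continuous (a b : R) : a <= b -> continuous (clip a b).
Proof.
move=> ab; apply: (@ac_clip_continuous _ a b id) => // e e0; exists e => // n u v uv _.
by congr (_ < _); apply: eq_bigr => i _; have [_ ? _] := uv i; rewrite ger0_norm ?subr_ge0.
Qed.

Lemma continuous_cont01 f : continuous f -> cont01 f.
Proof.
by move=> cf t; apply: continuous_comp; [exact: clip_continuous|exact: cf].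
Qed.

Lemma ac_cont01 f : absolutely_continuous_on 0 1 f -> cont01 f.
Proof. exact: ac_clip_continuous. Qed.

Lemma cont01_cst k : cont01 (fun=> k).
Proof. by move=> t; exact: cvg_cst. Qed.

Lemma cont01D f g : cont01 f -> cont01 g -> cont01 (fun t => f t + g t).
Proof. by move=> cf cg t; apply: cvgD; [exact: cf|exact: cg]. Qed.

Lemma cont01B f g : cont01 f -> cont01 g -> cont01 (fun t => f t - g t).
Proof. by move=> cf cg t; apply: cvgB; [exact: cf|exact: cg]. Qed.

Lemma cont01M f g : cont01 f -> cont01 g -> cont01 (fun t => f t * g t).
Proof. by move=> cf cg t; apply: cvgM; [exact: cf|exact: cg]. Qed.

Lemma cont01X f n : cont01 f -> cont01 (fun t => f t ^+ n).
Proof.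
move=> cf; elim: n => [|n IH].
  rewrite (_ : (fun t => _) = fun=> 1); first exact: cont01_cst.
  by apply/funext => t; rewrite expr0.
rewrite (_ : (fun t => _) = fun t => f t * f t ^+ n); first exact: cont01M.
by apply/funext => t; rewrite exprS.
Qed.

Lemma cont01_comp f g : continuous g -> cont01 f -> cont01 (fun t => g (f t)).
Proof. by move=> cg cf t; apply: continuous_comp; [exact: cf|exact: cg]. Qed.

Lemma cont01_measurable f : cont01 f ->
  measurable_fun (`[0, 1]%classic : set (measurableTypeR R)) f.
Proof.
move=> cf; apply: (@eq_measurable_fun _ _ _ _ _ (fun t => f (clip 0 1 t))).
  by move=> t /set_mem /=; rewrite in_itv/= => /andP[? ?]; rewrite clip_id.
by apply: measurable_funTS; exact: continuous_measurable_fun.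
Qed.

Lemma cont01_integrable f : cont01 f -> mu.-integrable `[0, 1] (EFin \o f).
Proof.
move=> cf; have : mu.-integrable `[0, 1] (EFin \o (fun t => f (clip 0 1 t))).
  apply: continuous_compact_integrable; first exact: segment_compact.
  by apply: continuous_subspaceT => x; exact: cf.
apply: eq_integrable => //= t /set_mem /=; rewrite in_itv/= => /andP[? ?].
by rewrite clip_id.
Qed.

Lemma integral01E f : cont01 f ->
  (\int[mu]_(t in `[0%R, 1%R]) (f t)%:E)%E = (integral01 f)%:E.
Proof.
move=> cf; rewrite /integral01 /Rintegral fineK//.
by apply: integrable_fin_num => //; exact: cont01_integrable.
Qed.

Lemma eq_integral01 f g : (forall t, 0 <= t <= 1 -> f t = g t) ->
  integral01 f = integral01 g.
Proof.
move=> fg; apply: eq_Rintegral => t /set_mem /=; rewrite in_itv/=; exact: fg.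
Qed.

Lemma integral01D f g : cont01 f -> cont01 g ->
  integral01 (fun t => f t + g t) = integral01 f + integral01 g.
Proof. by move=> cf cg; apply: RintegralD => //; exact: cont01_integrable. Qed.

Lemma integral01B f g : cont01 f -> cont01 g ->
  integral01 (fun t => f t - g t) = integral01 f - integral01 g.
Proof. by move=> cf cg; apply: RintegralB => //; exact: cont01_integrable. Qed.

Lemma integral01Z f k : cont01 f -> integral01 (fun t => k * f t) = k * integral01 f.
Proof. by move=> cf; apply: RintegralZl => //; exact: cont01_integrable. Qed.

Lemma le_integral01 f g : cont01 f -> cont01 g ->
  (forall t, 0 <= t <= 1 -> f t <= g t) -> integral01 f <= integral01 g.
Proof.
move=> cf cg fg.
apply: (le_Rintegral _ (cont01_integrable cf) (cont01_integrable cg)) => //.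
Qed.

Lemma integral01_cst k : integral01 (fun=> k) = k.
Proof.
rewrite /integral01 Rintegral_cst//= lebesgue_measure_itv/= lte_fin ltr01.
by rewrite oppr0 adde0 mulr1.
Qed.

Lemma integral01_ge0 f : (forall t, 0 <= t <= 1 -> 0 <= f t) -> 0 <= integral01 f.
Proof.
by move=> f0; apply: Rintegral_ge0 => t /=; rewrite in_itv/=; exact: f0.
Qed.

Lemma integral01_dist f g e : cont01 f -> cont01 g ->
  (forall t, 0 <= t <= 1 -> `|f t - g t| <= e) ->
  `|integral01 f - integral01 g| <= e.
Proof.
move=> cf cg fg; rewrite -integral01B//; have cfg := cont01B cf cg.
rewrite ler_norml -{2}(integral01_cst e) -{1}(integral01_cst (- e)).
by apply/andP; split; apply: le_integral01 => //;
  [exact: cont01_cst| |exact: cont01_cst|];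
  move=> t /fg; rewrite ler_norml => /andP[].
Qed.

(** A positive value persists on a nondegenerate interval, to the right or to the left of the point
    according to where [[0, 1]] leaves room. This yields the uniqueness of the optimum. *)
Lemma integral01_eq0 f : cont01 f -> (forall t, 0 <= t <= 1 -> 0 <= f t) ->
  integral01 f <= 0 -> forall t, 0 <= t <= 1 -> f t = 0.
Proof.
move=> cf f0 If t t01; apply: contrapT => ft.
have ft0 : 0 < f t by rewrite lt_neqAle eq_sym f0// andbT; apply/eqP.
have /andP[t0 t1] := t01.
have ft20 : 0 < f t / 2 by lra.
have /(@cvgrPdist_lt _ R^o)/(_ _ ft20) := cf t.
rewrite clip_id// => /nbhs_ballP[d /= d0 Hd].
have {}Hd x : 0 <= x -> x <= 1 -> `|t - x| < d -> f t / 2 <= f x.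
  move=> x0 x1 /Hd /=; rewrite clip_id// ltr_norml => /andP[_]; lra.
pose e := Num.min (d / 2) (1 / 2).
have [e0 ed e1] : [/\ 0 < e, e < d & e <= 1 / 2].
  by rewrite /e; case: (leP (d / 2) (1 / 2)) => ?; split; lra.
have [a [b [a0 ab b1 Hab]]] : exists a b, [/\ 0 <= a, a < b, b <= 1 &
    forall x, a <= x -> x <= b -> f t / 2 <= f x].
  have [t2|t2] := leP t (1 / 2).
    exists t, (t + e); split => [||| x ? ?]; try lra.
    by apply: Hd; try lra; rewrite ler0_norm; lra.
  exists (t - e), t; split => [||| x ? ?]; try lra.
  by apply: Hd; try lra; rewrite ger0_norm; lra.
have mab : measurable (`[a, b]%classic : set (measurableTypeR R)).
  exact: measurable_itv.
have sub : (`[a, b]%classic : set R) `<=` `[0, 1]%classic.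
  by apply: subset_itv; rewrite bnd_simp.
have mf := cont01_measurable cf.
have : ((f t / 2 * (b - a))%:E <= (integral01 f)%:E)%E.
  rewrite -integral01E//.
  apply: (@le_trans _ _ (\int[mu]_(x in `[a, b]) (f x)%:E)%E).
    apply: (@le_trans _ _ (\int[mu]_(x in `[a, b]) (f t / 2)%:E)%E).
      by rewrite integral_cst//= lebesgue_measure_itv/= lte_fin ab -EFinB -EFinM.
    apply: ge0_le_integral => //.
    - by move=> x _; rewrite lee_fin ltW.
    - by apply: measurable_funS (measurable_itv _) sub _; apply/measurable_EFinP.
    - by move=> x /=; rewrite in_itv/= lee_fin => /andP[? ?]; exact: Hab.
  by apply: ge0_subset_integral => //; exact/measurable_EFinP.
rewrite lee_fin => H; have : 0 < f t / 2 * (b - a) by rewrite mulr_gt0//; lra.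
lra.
Qed.

Lemma integral01_deriv f g : continuous g ->
  (forall t, is_derive t (1 : R) f (g t)) -> integral01 g = f 1 - f 0.
Proof.
move=> cg df; rewrite /integral01 /Rintegral (@continuous_FTC2 _ g f 0 1)//.
- by apply: continuous_subspaceT => x; exact: cg.
- split => [x _||].
  + by have := df x; move=> [].
  + apply: cvg_at_right_filter.
    by apply/differentiable_continuous/derivable1_diffP; have := df 0; move=> [].
  + apply: cvg_at_left_filter.
    by apply/differentiable_continuous/derivable1_diffP; have := df 1; move=> [].
- by move=> x _; rewrite derive1E; have := df x; move=> H; rewrite derive_val.
Qed.

End integral01.

Section pointwise_derivatives.
Variable R : realType.
Implicit Types (f g : R -> R) (x : R).

Lemma is_deriveD1 f g x df dg : is_derive x (1 : R) f df ->
  is_derive x (1 : R) g dg -> is_derive x (1 : R) (fun t => f t + g t) (df + dg).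
Proof. by move=> Hf Hg; exact: is_deriveD. Qed.

Lemma is_deriveB1 f g x df dg : is_derive x (1 : R) f df ->
  is_derive x (1 : R) g dg -> is_derive x (1 : R) (fun t => f t - g t) (df - dg).
Proof. by move=> Hf Hg; exact: is_deriveB. Qed.

Lemma is_deriveM1 f g x df dg : is_derive x (1 : R) f df ->
  is_derive x (1 : R) g dg ->
  is_derive x (1 : R) (fun t => f t * g t) (df * g x + f x * dg).
Proof.
move=> Hf Hg; have := is_deriveM Hf Hg.
by rewrite addrC /GRing.scale/= [g x * _]mulrC.
Qed.

Lemma is_derive_lin k x : is_derive x (1 : R) (fun t => k * (1 - t)) (- k).
Proof.
have -> : - k = 0 * (1 - x) + k * (0 - 1) by ring.
exact: is_deriveM1.
Qed.

Lemma C2_pos_continuous (f : R -> R) : twice_continuously_differentiable_pos f ->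
  forall s : R, 0 < s -> {for s, continuous f}.
Proof.
move=> Hf s s0; apply/differentiable_continuous/derivable1_diffP.
have [df _ _] := Hf s s0; exact: df.
Qed.

End pointwise_derivatives.

(** * Uniform second-order bounds on unit balls *)

Section c11.
Variable R : realType.
Implicit Types (s t x y M p q : R) (u v du dv f : R -> R).

Definition c2 u du := exists ddu : R -> R,
  [/\ forall s, is_derive s (1 : R) u (du s),
      forall s, is_derive s (1 : R) du (ddu s) & continuous ddu].

Lemma is_derive1_continuous u du : (forall s, is_derive s (1 : R) u (du s)) ->
  continuous u.
Proof.
move=> H s; apply/differentiable_continuous/derivable1_diffP.
by have := H s; case.
Qed.

Lemma c2M u v du dv : c2 u du -> c2 v dv ->
  c2 (fun s => u s * v s) (fun s => du s * v s + u s * dv s).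
Proof.
move=> [ddu [u1 u2 cu]] [ddv [v1 v2 cv]].
exists (fun s => ddu s * v s + du s * dv s + (du s * dv s + u s * ddv s)).
split.
- by move=> s; exact: (is_deriveM1 (u1 s) (v1 s)).
- move=> s; exact: (is_deriveD1 (is_deriveM1 (u2 s) (v1 s)) (is_deriveM1 (u1 s) (v2 s))).
- move=> s; have cu0 := is_derive1_continuous u1; have cu1 := is_derive1_continuous u2.
  have cv0 := is_derive1_continuous v1; have cv1 := is_derive1_continuous v2.
  apply: cvgD; apply: cvgD; apply: cvgM;
    solve [exact: cu|exact: cv|exact: cu0|exact: cu1|exact: cv0|exact: cv1].
Qed.

Lemma c2Z u du k : c2 u du -> c2 (fun s => k * u s) (fun s => k * du s).
Proof.
move=> [ddu [u1 u2 cu]]; exists (fun s => k * ddu s); split.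
- by move=> s; have := is_deriveZ k (u1 s).
- by move=> s; have := is_deriveZ k (u2 s).
- by move=> s; apply: cvgM; [exact: cvg_cst|exact: cu].
Qed.

Lemma c2_expR : c2 (@expR R) (@expR R).
Proof.
exists expR; split=> [s|s|]; [exact: is_derive_expR..|exact: continuous_expR].
Qed.

(** In the logarithmic coordinate this function is the square root of the variance. *)
Lemma c2_expR_half : c2 (fun s => expR (s / 2)) (fun s => expR (s / 2) / 2).
Proof.
have dZ (f : R -> R) df (s : R) : is_derive s (1 : R) f df ->
    is_derive s (1 : R) (fun t => f t / 2) (df / 2).
  by move=> Hf; have := is_deriveM1 Hf (is_derive_cst (2^-1 : R) s 1); rewrite mulr0 addr0.
have H (s : R) : is_derive s (1 : R) (fun t => expR (t / 2)) (expR (s / 2) / 2).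
  have := is_derive1_comp (f := expR) (g := fun t : R => t / 2) (x := s).
  move=> /(_ _ _ (is_derive_expR _) (dZ _ _ _ (@is_derive_id _ _ s (1 : R)))).
  by rewrite /GRing.scale/= mul1r mulrC.
exists (fun s => expR (s / 2) / 2 / 2); split => // s; first exact: dZ.
apply: cvgM; last exact: cvg_cst.
by apply: cvgM; [exact: (is_derive1_continuous H)|exact: cvg_cst].
Qed.

Lemma c2_comp_expR u : twice_continuously_differentiable_pos u ->
  c2 (fun s => u (expR s)) (fun s => expR s * derive1 u (expR s)).
Proof.
move=> Hu.
have comp v dv : (forall s, 0 < s -> is_derive s (1 : R) v (dv s)) ->
    forall s, is_derive s (1 : R) (fun t => v (expR t)) (expR s * dv (expR s)).
  move=> Hv s; have := is_derive1_comp (f := v) (g := expR) (x := s).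
  move=> /(_ _ _ (Hv _ (expR_gt0 s)) (is_derive_expR s)).
  by rewrite /GRing.scale/= mulrC.
have u1 s : 0 < s -> is_derive s (1 : R) u (u^`() s).
  by move=> /Hu[d1 _ _]; apply: DeriveDef => //; rewrite derive1E.
have u2 s : 0 < s -> is_derive s (1 : R) u^`() (u^`(2) s).
  move=> /Hu[_ d2 _]; have -> : u^`(2) s = 'D_1 u^`() s.
    by rewrite derive1nS derive1n1 derive1E.
  exact: derivableP.
exists (fun s => expR s * derive1 u (expR s) + expR s * (expR s * derive1n 2 u (expR s))).
split.
- exact: comp.
- by move=> s; exact: (is_deriveM1 (is_derive_expR s) (comp _ _ u2 s)).
- move=> s; apply: cvgD.
    apply: cvgM; first exact: continuous_expR.
    exact: (is_derive1_continuous (comp _ _ u2)).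
  apply: cvgM; first exact: continuous_expR.
  apply: cvgM; first exact: continuous_expR.
  apply: (@continuous_comp _ _ _ expR u^`(2)); first exact: continuous_expR.
  by have [] := Hu _ (expR_gt0 s).
Qed.

(** A single constant serves for the value, the derivative, both Lipschitz bounds and the Taylor
    remainder; the Hamiltonian estimates see the coefficients only through bounds of this kind. *)
Definition c11 p u du M := forall s t, `|s - p| <= 1 -> `|t - p| <= 1 ->
  [/\ `|u s| <= M, `|du s| <= M, `|u t - u s| <= M * `|t - s|,
      `|du t - du s| <= M * `|t - s| &
      `|u t - u s - du s * (t - s)| <= M * (t - s) ^+ 2].

Lemma c11_le p u du M N : M <= N -> c11 p u du M -> c11 p u du N.
Proof.
move=> MN H s t sp tp; have [? ? ? ? ?] := H s t sp tp.
have ? : M * `|t - s| <= N * `|t - s| by apply: ler_wpM2r.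
have ? : M * (t - s) ^+ 2 <= N * (t - s) ^+ 2 by apply: ler_wpM2r => //; exact: sqr_ge0.
by split; lra.
Qed.

Lemma continuous_bounded p u : continuous u ->
  exists2 M, 0 <= M & forall s, `|s - p| <= 1 -> `|u s| <= M.
Proof.
move=> cu; have le1 : p - 1 <= p + 1 by lra.
have cau : {within `[p - 1, p + 1], continuous (fun s => `|u s|)}.
  apply: continuous_subspaceT => s; apply: continuous_comp; first exact: cu.
  exact: norm_continuous.
have [c _ Hc] := EVT_max le1 cau.
exists `|u c| => // s; rewrite ler_norml => /andP[? ?]; apply: Hc.
by rewrite in_itv/=; apply/andP; split; lra.
Qed.

Lemma MVT_le u du p M : (forall s, is_derive s (1 : R) u (du s)) ->
  (forall s, `|s - p| <= 1 -> `|du s| <= M) ->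
  forall s t, `|s - p| <= 1 -> `|t - p| <= 1 -> `|u t - u s| <= M * `|t - s|.
Proof.
move=> Hu HM.
have H s t : s <= t -> `|s - p| <= 1 -> `|t - p| <= 1 -> `|u t - u s| <= M * `|t - s|.
  move=> st sp tp; have : `|s - p| <= 1 by [].
  rewrite {1}ler_norml => /andP[? ?]; have : `|t - p| <= 1 by [].
  rewrite {1}ler_norml => /andP[? ?].
  have cu : {within `[s, t], continuous u}.
    by apply: continuous_subspaceT; exact: is_derive1_continuous Hu.
  have [c] := @MVT_segment _ u du s t st (fun x _ => Hu x) cu.
  rewrite in_itv/= => /andP[? ?] ->; rewrite normrM ler_wpM2r//.
  by apply: HM; rewrite ler_norml; apply/andP; split; lra.
move=> s t sp tp; have [st|/ltW ts] := leP s t; first exact: H.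
by rewrite distrC [`|t - s|]distrC; exact: H.
Qed.

Lemma c2_c11 p u du : c2 u du -> exists M, c11 p u du M.
Proof.
move=> [ddu [u1 u2 cddu]].
have [M0 M00 H0] := continuous_bounded p (is_derive1_continuous u1).
have [M1 M10 H1] := continuous_bounded p (is_derive1_continuous u2).
have [M2 M20 H2] := continuous_bounded p cddu.
exists (M0 + M1 + M2) => s t sp tp.
have Hu := MVT_le u1 H1; have Hdu := MVT_le u2 H2.
have st0 := normr_ge0 (t - s).
split.
- by rewrite (le_trans (H0 _ sp)); lra.
- by rewrite (le_trans (H1 _ sp)); lra.
- by rewrite (le_trans (Hu _ _ sp tp))// ler_wpM2r//; lra.
- by rewrite (le_trans (Hdu _ _ sp tp))// ler_wpM2r//; lra.
(* Subtracting the tangent at [s] leaves a function whose derivative is at most [M2 * |t - s|]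
   between [s] and [t], so the mean value theorem makes the remainder quadratic. *)
pose w x := u x - du s * x.
have w1 x : is_derive x (1 : R) w (du x - du s).
  apply: is_deriveB; have := is_deriveZ (du s) (@is_derive_id _ _ x (1 : R)).
  by rewrite /GRing.scale/= mulr1.
have Hw x y : `|x - p| <= 1 -> `|y - p| <= 1 -> x <= y ->
    (forall c, x <= c <= y -> `|c - s| <= `|t - s|) ->
    `|w y - w x| <= M2 * `|t - s| * `|y - x|.
  move=> xp yp xy cs.
  have cw : {within `[x, y], continuous w}.
    by apply: continuous_subspaceT; exact: is_derive1_continuous w1.
  have [c] := @MVT_segment _ w _ x y xy (fun x _ => w1 x) cw.
  rewrite in_itv/= => xcy ->; rewrite normrM ler_wpM2r//.
  have cp : `|c - p| <= 1.
    by move: xcy xp yp; rewrite !ler_norml => /andP[? ?] /andP[? ?] /andP[? ?]; lra.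
  by rewrite (le_trans (Hdu _ _ sp cp))// ler_wpM2l//; apply: cs.
have -> : u t - u s - du s * (t - s) = w t - w s by rewrite /w; ring.
have : `|w t - w s| <= M2 * `|t - s| * `|t - s|.
  have [st|/ltW ts] := leP s t.
    by apply: Hw => // c /andP[? ?]; rewrite !ger0_norm; lra.
  rewrite distrC [X in _ <= _ * X]distrC; apply: Hw => // c /andP[? ?].
  by rewrite !ler0_norm; lra.
move=> /le_trans; apply; rewrite -mulrA -expr2 real_normK ?num_real//.
by rewrite ler_wpM2r ?sqr_ge0//; lra.
Qed.

End c11.

(** * Verification estimate for a quadratic Hamiltonian *)

Section hamiltonian.
Variable R : realType.
Implicit Types (f A B C : R -> R -> R) (p q x y M : R).

Definition c11_2 p q f f1 f2 M := forall x y x' y',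
  `|x - p| <= 1 -> `|y - q| <= 1 -> `|x' - p| <= 1 -> `|y' - q| <= 1 ->
  let d := `|x' - x| + `|y' - y| in
  [/\ `|f x y| <= M, `|f1 x y| <= M, `|f2 x y| <= M &
   [/\ `|f x' y' - f x y| <= M * d, `|f1 x' y' - f1 x y| <= M * d,
       `|f2 x' y' - f2 x y| <= M * d &
       `|f x' y' - f x y - f1 x y * (x' - x) - f2 x y * (y' - y)| <= M * d ^+ 2]].

Lemma ler_normM (a b c d : R) : `|a| <= c -> `|b| <= d -> `|a * b| <= c * d.
Proof. by move=> ac bd; rewrite normrM ler_pM. Qed.

(** Every coefficient of the Hamiltonian is a function of [x] times a function of [y], which reduces
    the two-variable bounds to one-variable ones. *)
Lemma c11_prod p q (u du v dv : R -> R) M : 0 <= M -> c11 p u du M -> c11 q v dv M ->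
  c11_2 p q (fun x y => u x * v y) (fun x y => du x * v y) (fun x y => u x * dv y)
    (M ^+ 2).
Proof.
move=> M0 Hu Hv x y x' y' xp yq x'p y'q d; rewrite expr2.
have [u0 u1 u2 u3 u4] := Hu _ _ xp x'p; have [u0' u1' _ _ _] := Hu _ _ x'p xp.
have [v0 v1 v2 v3 v4] := Hv _ _ yq y'q; have [v0' v1' _ _ _] := Hv _ _ y'q yq.
have E (f1 f2 k1 k2 : R) : `|f1 - f2| <= M * `|x' - x| -> `|k1 - k2| <= M * `|y' - y| ->
    `|k1| <= M -> `|f2| <= M -> `|f1 * k1 - f2 * k2| <= M * M * d.
  move=> H1 H2 H3 H4.
  rewrite (_ : f1 * k1 - f2 * k2 = (f1 - f2) * k1 + f2 * (k1 - k2)); last by ring.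
  rewrite (le_trans (ler_normD _ _))//.
  have := ler_normM H1 H3; have := ler_normM H4 H2; rewrite /d; lra.
split; [exact: ler_normM..|split; [exact: E..|]].
rewrite (_ : _ - _ = (u x' - u x - du x * (x' - x)) * v y' +
  u x * (v y' - v y - dv y * (y' - y)) + du x * (x' - x) * (v y' - v y)); last by ring.
rewrite (le_trans (ler_normD _ _))// (le_trans (lerD (ler_normD _ _) (lexx _)))//.
have := ler_normM u4 v0'; have := ler_normM u0 v4.
have : `|du x * (x' - x) * (v y' - v y)| <= M * `|x' - x| * (M * `|y' - y|).
  by apply: ler_normM => //; apply: ler_normM.
have -> : d ^+ 2 = (x' - x) ^+ 2 + 2 * (`|x' - x| * `|y' - y|) + (y' - y) ^+ 2.
  by rewrite /d sqrrD !real_normK ?num_real// mulr_natl.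
have : 0 <= M * M * (`|x' - x| * `|y' - y|) by rewrite !mulr_ge0.
lra.
Qed.

(** Budget of the verification, in units of [c = 1 / M]. The terms with [s] or [tau] are tiny
    multiples of [c * d ^+ 2] thanks to the factor 640, the one with [k ^+ 2] is at most
    [c / 32 * d ^+ 2], and [2 * r * d] is split by Young's inequality. Together they consume less
    than [7 / 64 * c * S], so that [c / 64 * S] remains from [c / 8 * S]. *)
Lemma calibration_scalar (M c tau k s d r S : R) : 1 <= M -> 0 < c -> M * c = 1 ->
  0 <= tau -> 640 * M ^+ 4 * tau <= 1 -> 0 <= k <= c / 4 -> 0 <= s <= 2 * M * tau ->
  d ^+ 2 <= 2 * S ->
  M * d ^+ 2 * (s * s) / 2 + k * (M * d * (s * d)) + k ^+ 2 * (M * (d * d)) / 2 +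
    tau * (M * d ^+ 2) + 2 * r * d - c / 8 * S <= - (c / 64) * S + 128 * M * r ^+ 2.
Proof.
move=> M1 c0 Mc tau0 tauM /andP[k0 kc] /andP[s0 sM] dS.
have M0 : 0 < M by exact: lt_le_trans ltr01 M1.
have t7 : 2 * r * d <= c / 128 * d ^+ 2 + 128 * M * r ^+ 2.
  have : 0 <= c / 128 * (d - 128 * M * r) ^+ 2.
    by rewrite mulr_ge0 ?sqr_ge0//; lra.
  rewrite (_ : c / 128 * (d - 128 * M * r) ^+ 2 = c / 128 * d ^+ 2
    - 2 * (M * c) * r * d + 128 * M * (M * c) * r ^+ 2); last by field.
  rewrite Mc; lra.
have M3tau : 640 * M ^+ 3 * tau <= c.
  have : c * (640 * M ^+ 4 * tau) <= c * 1 by rewrite ler_pM2l.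
  rewrite (_ : c * (640 * M ^+ 4 * tau) = M * c * (640 * M ^+ 3 * tau)); last by ring.
  by rewrite Mc mul1r mulr1.
have Mtau : M * tau <= M ^+ 3 * tau.
  rewrite ler_wpM2r// exprS ler_peMr//; first lra.
  by rewrite expr_ge1//; lra.
have tau1 : tau <= 1.
  have : 1 * tau <= 640 * M ^+ 4 * tau.
    rewrite ler_wpM2r//; have : 1 <= M ^+ 4 by rewrite expr_ge1//; lra.
    lra.
  lra.
have b1 : M * d ^+ 2 * (s * s) <= 4 * (M ^+ 3 * tau) * d ^+ 2.
  have : s * s <= 2 * M * tau * (2 * M * 1).
    by apply: ler_pM => //; rewrite (le_trans sM)// ler_pM2l//; lra.
  move=> /(ler_wpM2l (mulr_ge0 (ltW M0) (sqr_ge0 d))).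
  move=> /le_trans; apply; rewrite le_eqVlt; apply/orP; left; apply/eqP; ring.
have b2 : k * (M * d * (s * d)) <= M * tau * d ^+ 2.
  have : k * M * s <= 4^-1 * (2 * M * tau).
    apply: ler_pM => //; first by rewrite mulr_ge0// ltW.
    have : k * M <= c / 4 * M by rewrite ler_wpM2r// ltW.
    lra.
  move=> /(ler_wpM2r (sqr_ge0 d)) H.
  have := mulr_ge0 (mulr_ge0 (ltW M0) tau0) (sqr_ge0 d).
  rewrite (_ : k * (M * d * (s * d)) = k * M * s * d ^+ 2); last by ring.
  lra.
have b3 : k ^+ 2 * (M * (d * d)) <= c / 16 * d ^+ 2.
  have : k * k <= c / 4 * (c / 4) by apply: ler_pM.
  move=> /(ler_wpM2r (mulr_ge0 (ltW M0) (sqr_ge0 d))).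
  rewrite (_ : c / 4 * (c / 4) * (M * d ^+ 2) = M * c * (c / 16 * d ^+ 2)); last by field.
  by rewrite Mc mul1r expr2 (_ : d * d = d ^+ 2).
have d20 := sqr_ge0 d.
have M3d : 640 * M ^+ 3 * tau * d ^+ 2 <= c * d ^+ 2 by rewrite ler_wpM2r.
have Md : M * tau * d ^+ 2 <= M ^+ 3 * tau * d ^+ 2 by rewrite ler_wpM2r.
have cS : c * d ^+ 2 <= c * (2 * S) by rewrite ler_wpM2l// ltW.
have S0 : 0 <= c * S by rewrite mulr_ge0 ?(ltW c0)//; lra.
move: b1 b2 b3 t7 M3d Md cS S0; clear.
lra.
Qed.

Section quadratic.
Variables A A1 A2 B B1 B2 C C1 C2 : R -> R -> R.

Definition ham x y p q :=
  (A x y * p ^+ 2 + 2 * B x y * p * q + C x y * q ^+ 2) / 2.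

(** The formula of [ham] with the coefficients as arguments: applied to partial derivatives of the
    coefficients it gives the position derivatives of the Hamiltonian. *)
Definition dham (A B C : R -> R -> R) x y p q :=
  (A x y * p ^+ 2 + 2 * B x y * p * q + C x y * q ^+ 2) / 2.

(** The bilinear version also covers increments of the quadratic form, which are bilinear in the sum
    and the difference of the two momenta. *)
Lemma bilinear_bound (a b c p1 p2 q1 q2 N : R) :
  `|a| <= N -> `|b| <= N -> `|c| <= N ->
  `|a * p1 * q1 + b * (p1 * q2 + p2 * q1) + c * p2 * q2| <=
    N * ((`|p1| + `|p2|) * (`|q1| + `|q2|)).
Proof.
move=> aN bN cN.
have := ler_normM (ler_normM aN (lexx `|p1|)) (lexx `|q1|).
have := ler_normM bN (lexx `|p1 * q2 + p2 * q1|).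
have := ler_normM (ler_normM cN (lexx `|p2|)) (lexx `|q2|).
have N0 : 0 <= N by exact: le_trans aN.
have : N * `|p1 * q2 + p2 * q1| <= N * (`|p1| * `|q2| + `|p2| * `|q1|).
  by rewrite ler_wpM2l// (le_trans (ler_normD _ _))// !normrM.
set a' := a * p1 * q1; set b' := b * _; set c' := c * p2 * q2.
have := ler_normD (a' + b') c'; have := ler_normD a' b'.
lra.
Qed.

Variables (g0 h0 M : R).
Hypothesis M1 : 1 <= M.
Hypothesis HA : c11_2 g0 h0 A A1 A2 M.
Hypothesis HB : c11_2 g0 h0 B B1 B2 M.
Hypothesis HC : c11_2 g0 h0 C C1 C2 M.

(** Second-order error of the calibration at a competitor [(x', y')] with momentum [p + k * d]. Here
    [e1], [e2] are the defects of the reference in the velocity equations and [f1], [f2] those in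
    the momentum equations. The term with [(8 * M)^-1] is half the slope of the weight
    [(4 * M)^-1 * (1 - t)]; it outweighs the [k ^+ 2] term because [k <= (4 * M)^-1]. *)
Lemma calibration_pointwise (tau lam r k x y x' y' d1 d2 p1 p2 e1 e2 f1 f2 : R) :
  `|x - g0| <= 1 -> `|y - h0| <= 1 -> `|x' - g0| <= 1 -> `|y' - h0| <= 1 ->
  0 <= tau -> 640 * M ^+ 4 * tau <= 1 ->
  `|p1| <= M * tau -> `|p2| <= M * tau -> `|lam| <= tau ->
  0 <= k <= (4 * M)^-1 -> `|e1| <= r -> `|e2| <= r -> `|f1| <= r -> `|f2| <= r ->
  d1 = x' - x -> d2 = y' - y ->
  ham x' y' (p1 + k * d1) (p2 + k * d2) - ham x y p1 p2
  - dham A1 B1 C1 x y p1 p2 * d1 - dham A2 B2 C2 x y p1 p2 * d2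
  - k * ((A x y * p1 + B x y * p2) * d1 + (B x y * p1 + C x y * p2) * d2)
  + lam * (A x' y' - A x y - A1 x y * d1 - A2 x y * d2)
  + (f1 - k * e1) * d1 + (f2 - k * e2) * d2 - (8 * M)^-1 * (d1 ^+ 2 + d2 ^+ 2)
  <= - (64 * M)^-1 * (d1 ^+ 2 + d2 ^+ 2) + 128 * M * r ^+ 2.
Proof.
move=> xb yb xb' yb' tau0 tauM p1M p2M lamtau /andP[k0 kM] e1r e2r f1r f2r.
move=> d1E d2E; set d := `|d1| + `|d2|; set S := d1 ^+ 2 + d2 ^+ 2.
have M0 : 0 < M by exact: lt_le_trans ltr01 M1.
have [c [c0 Mc cE]] : exists c, [/\ 0 < c, M * c = 1 & M^-1 = c].
  by exists M^-1; rewrite invr_gt0 mulfV ?gt_eqF.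
have {kM} kc : 0 <= k <= c / 4 by rewrite k0 mulrC -cE -invfM.
set s := `|p1| + `|p2|.
have sM : 0 <= s <= 2 * M * tau.
  by rewrite addr_ge0//= -mulrA mulr_natl mulr2n lerD.
have dS : d ^+ 2 <= 2 * S.
  rewrite /S -(real_normK (num_real d1)) -(real_normK (num_real d2)) /d.
  rewrite -subr_ge0 (_ : _ - _ = (`|d1| - `|d2|) ^+ 2) ?sqr_ge0//; ring.
have key := calibration_scalar r M1 c0 Mc tau0 tauM kc sM dS.
have k1 : k <= 1.
  have /andP[_ /le_trans] := kc; apply.
  have : c <= 1 by rewrite -Mc ler_peMl// ltW.
  by rewrite ler_pdivrMr// mul1r => /le_trans; apply; rewrite ler1n.
have t5 (f e : R) : `|f| <= r -> `|e| <= r -> `|f - k * e| <= 2 * r.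
  move=> fr er; rewrite (le_trans (ler_normB _ _))// normrM (ger0_norm k0).
  rewrite mulr_natl mulr2n lerD//; apply: le_trans er.
  by rewrite ler_piMl.
have t6 : (f1 - k * e1) * d1 + (f2 - k * e2) * d2 <= 2 * r * d.
  rewrite mulrDr; apply: lerD; (apply: le_trans (ler_norm _) _);
    by apply: ler_normM => //; exact: t5.
have [_ _ _ [A'd _ _ RA]] := HA xb yb xb' yb'.
have [_ _ _ [B'd _ _ RB]] := HB xb yb xb' yb'.
have [_ _ _ [C'd _ _ RC]] := HC xb yb xb' yb'.
have [A'M _ _ _] := HA xb' yb' xb yb.
have [B'M _ _ _] := HB xb' yb' xb yb.
have [C'M _ _ _] := HC xb' yb' xb yb.
move: RA RB RC A'd B'd C'd; rewrite /= -d1E -d2E -/d.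
set RA := A x' y' - _ - _ - _; set RB := B x' y' - _ - _ - _.
set RC := C x' y' - _ - _ - _ => RAd RBd RCd DAd DBd DCd.
have t1 : `|RA * p1 * p1 + RB * (p1 * p2 + p2 * p1) + RC * p2 * p2| <=
  M * d ^+ 2 * (s * s) by exact: bilinear_bound.
have t2 : `|(A x' y' - A x y) * p1 * d1 + (B x' y' - B x y) * (p1 * d2 + p2 * d1)
   + (C x' y' - C x y) * p2 * d2| <= M * d * (s * d) by exact: bilinear_bound.
have t3 : `|A x' y' * d1 * d1 + B x' y' * (d1 * d2 + d2 * d1) + C x' y' * d2 * d2| <=
  M * (d * d) by exact: bilinear_bound.
have t4 : `|lam * RA| <= tau * (M * d ^+ 2) by exact: ler_normM.
rewrite !invfM cE.
(* Expansion in powers of [k]: order 0 contains only Taylor remainders of the coefficients, order 1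
   only their increments, order 2 the full form at the competitor. *)
rewrite (_ : ham x' y' _ _ - _ - _ - _ - _ =
  (RA * p1 * p1 + RB * (p1 * p2 + p2 * p1) + RC * p2 * p2) / 2
  + k * ((A x' y' - A x y) * p1 * d1 + (B x' y' - B x y) * (p1 * d2 + p2 * d1)
   + (C x' y' - C x y) * p2 * d2)
  + k ^+ 2 * (A x' y' * d1 * d1 + B x' y' * (d1 * d2 + d2 * d1) + C x' y' * d2 * d2) / 2);
  last by rewrite /ham /dham /RA /RB /RC; field.
have T1 := le_trans (ler_norm _) t1.
have T2 := ler_wpM2l k0 (le_trans (ler_norm _) t2).
have T3 := ler_wpM2l (sqr_ge0 k) (le_trans (ler_norm _) t3).
have T4 := le_trans (ler_norm _) t4.
move: T1 T2 T3 T4 t6 key; clear.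
set X1 := RA * p1 * p1 + _ + _; set X2 := _ * p1 * d1 + _ + _.
set X3 := _ * d1 * d1 + _ + _.
lra.
Qed.

End quadratic.
End hamiltonian.

Section ac_closure.
Variable R : realType.
Implicit Types (f g : R -> R).

Lemma ac_lipschitz L f : (forall s t : R, 0 <= s -> s <= t -> t <= 1 ->
    `|f t - f s| <= L * (t - s)) -> absolutely_continuous_on 0 1 f.
Proof.
move=> Lf; have acid : absolutely_continuous_on (0 : R) 1 id.
  move=> e e0; exists e => // n u v uv _.
  by congr (_ < _); apply: eq_bigr => i _; have [_ ? _] := uv i; rewrite ger0_norm ?subr_ge0.
apply: (@ac_dominated _ 0 1 id id f `|L|) => // s t s0 st t1.
rewrite (le_trans (Lf _ _ s0 st t1))// (le_trans (ler_wpM2r _ (ler_norm L)))//.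
  by rewrite subr_ge0.
by rewrite ler_wpM2l//= lerDr addr_ge0.
Qed.

Lemma cont01_bounded f : cont01 f ->
  exists2 K, 0 <= K & forall t, 0 <= t <= 1 -> `|f t| <= K.
Proof.
move=> cf.
have cF : {within `[0 : R, 1], continuous (fun s => `|f (clip 0 1 s)|)}.
  apply: continuous_subspaceT => s; apply: continuous_comp; first exact: cf.
  exact: norm_continuous.
have [c _ Hc] := EVT_max ler01 cF.
exists `|f (clip 0 1 c)| => // t t01; have := Hc t.
by rewrite in_itv/= => /(_ t01); have /andP[? ?] := t01; rewrite clip_id.
Qed.

Lemma ac_cst (k : R) : absolutely_continuous_on 0 1 (fun=> k).
Proof. by apply: (@ac_lipschitz 0) => s t _ _ _; rewrite subrr normr0 mul0r. Qed.

Lemma acD f g : absolutely_continuous_on 0 1 f -> absolutely_continuous_on 0 1 g ->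
  absolutely_continuous_on 0 1 (fun t => f t + g t).
Proof.
move=> acf acg; apply: (ac_dominated ler01 acf acg) => s t s0 st t1.
rewrite mul1r opprD addrACA (le_trans (ler_normD _ _))// lerDl; lra.
Qed.

Lemma acM f g : absolutely_continuous_on 0 1 f -> absolutely_continuous_on 0 1 g ->
  absolutely_continuous_on 0 1 (fun t => f t * g t).
Proof.
move=> acf acg; have [K K0 HK] := cont01_bounded (ac_cont01 acf).
have [L L0 HL] := cont01_bounded (ac_cont01 acg).
apply: (ac_dominated (addr_ge0 K0 L0) acf acg) => s t s0 st t1.
rewrite (_ : f t * g t - f s * g s = (f t - f s) * g t + f s * (g t - g s)); last by ring.
have fs : `|f s| <= K by apply: HK; rewrite s0 (le_trans st).
have gt : `|g t| <= L by apply: HL; rewrite t1 (le_trans s0).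
rewrite (le_trans (ler_normD _ _))//.
have := ler_normM (lexx `|f t - f s|) gt; have := ler_normM fs (lexx `|g t - g s|).
have ? : 0 <= K * `|f t - f s| by rewrite mulr_ge0.
have ? : 0 <= L * `|g t - g s| by rewrite mulr_ge0.
have ? : 0 <= (K + L) * (t - s).
  by apply: mulr_ge0; [exact: addr_ge0|rewrite subr_ge0].
lra.
Qed.

Lemma acN f : absolutely_continuous_on 0 1 f ->
  absolutely_continuous_on 0 1 (fun t => - f t).
Proof.
move=> acf; apply: (ac_dominated ler01 acf acf) => s t s0 st t1.
rewrite mul1r -opprD normrN; have := normr_ge0 (f t - f s); lra.
Qed.

Lemma acB f g : absolutely_continuous_on 0 1 f -> absolutely_continuous_on 0 1 g ->
  absolutely_continuous_on 0 1 (fun t => f t - g t).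
Proof. by move=> acf acg; apply: acD => //; exact: acN. Qed.

End ac_closure.

(** * Critical paths by Picard iteration *)

Section picard.
Variable R : realType.
Let mu := @lebesgue_measure R.
Implicit Types (f g : R -> R) (s t : R).

(** The primitive vanishing at 0 of the extension by end values. Starting the integrals at -1 makes
    every point of [[0, 1]] interior, so the derivative is two-sided even at 0 and 1. *)
Definition prim f t : R :=
  \int[mu]_(x in `[-1, t]) f (clip 0 1 x) - \int[mu]_(x in `[-1, 0]) f (clip 0 1 x).

Lemma is_derive_prim f t : cont01 f -> 0 <= t <= 1 ->
  is_derive t (1 : R) (prim f) (f t).
Proof.
move=> cf /andP[t0 t1].
have iF : mu.-integrable `[-1, 2] (EFin \o (fun x => f (clip 0 1 x))).
  apply: continuous_compact_integrable; first exact: segment_compact.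
  by apply: continuous_subspaceT => x; exact: cf.
have t2 : t < 2 by lra.
have t1' : -1 < t by lra.
have [dF F'] := continuous_FTC1_closed t2 iF t1' (cf t).
have {}dF : is_derive t (1 : R) (fun y => \int[mu]_(x in `[-1, y]) f (clip 0 1 x)) (f t).
  apply: DeriveDef; first exact: dF.
  by rewrite -derive1E F' clip_id.
by have := is_deriveB1 dF (is_derive_cst (\int[mu]_(x in `[-1, 0]) f (clip 0 1 x)) t 1);
  rewrite subr0.
Qed.

(** Mean value theorem for the difference between the primitive and a comparison function; the later
    bounds on [prim] come from particular choices of [F]. *)
Lemma prim_mean f F k N s t : cont01 f ->
  (forall x : R, 0 <= x <= 1 -> is_derive x (1 : R) F (k x)) ->
  (forall x, 0 <= x <= 1 -> `|f x - k x| <= N) -> 0 <= s -> s <= t -> t <= 1 ->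
  `|(prim f t - prim f s) - (F t - F s)| <= N * (t - s).
Proof.
move=> cf HF fk s0 st t1.
pose G x := prim f x - F x.
have dG (x : R) : 0 <= x <= 1 -> is_derive x (1 : R) G (f x - k x).
  by move=> x01; apply: is_deriveB1; [exact: is_derive_prim|exact: HF].
have st01 (x : R) : x \in `]s, t[%R -> 0 <= x <= 1.
  by rewrite in_itv/= => /andP[? ?]; apply/andP; split; lra.
have cG : {within `[s, t], continuous G}.
  apply: derivable_within_continuous => x; rewrite in_itv/= => /andP[? ?].
  have x01 : 0 <= x <= 1 by lra.
  by have := dG x x01; case.
have [c] := @MVT_segment _ G _ s t st (fun x xst => dG x (st01 x xst)) cG.
rewrite in_itv/= => /andP[? ?].
rewrite (_ : G t - G s = prim f t - prim f s - (F t - F s)); last by rewrite /G; ring.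
move=> ->; rewrite normrM (ger0_norm (x := t - s)) ?subr_ge0//.
by rewrite ler_wpM2r ?subr_ge0// fk//; lra.
Qed.

Lemma prim_dist f g N s t : cont01 f -> cont01 g ->
  (forall x, 0 <= x <= 1 -> `|f x - g x| <= N) -> 0 <= s -> s <= t -> t <= 1 ->
  `|(prim f t - prim f s) - (prim g t - prim g s)| <= N.
Proof.
move=> cf cg fg s0 st t1.
have N0 : 0 <= N by apply: le_trans (fg 0 _); rewrite ?lexx ?ler01.
apply: le_trans (prim_mean cf _ fg s0 st t1) _; first by move=> x; exact: is_derive_prim.
by rewrite ler_piMr//; lra.
Qed.

Lemma prim_lipschitz f N s t : cont01 f ->
  (forall x, 0 <= x <= 1 -> `|f x| <= N) -> 0 <= s -> s <= t -> t <= 1 ->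
  `|prim f t - prim f s| <= N * (t - s).
Proof.
move=> cf fN s0 st t1.
have := @prim_mean f (fun=> 0) (fun=> 0) N s t cf.
by rewrite subrr subr0; apply => // x x01; rewrite subr0; exact: fN.
Qed.

Lemma prim_bound f N s t : cont01 f ->
  (forall x, 0 <= x <= 1 -> `|f x| <= N) -> 0 <= s -> s <= t -> t <= 1 ->
  `|prim f t - prim f s| <= N.
Proof.
move=> cf fN s0 st t1; rewrite (le_trans (prim_lipschitz cf fN s0 st t1))//.
have N0 : 0 <= N by apply: le_trans (fN 0 _); rewrite ?lexx ?ler01.
by rewrite ler_piMr//; lra.
Qed.

Lemma ac_prim f : cont01 f -> absolutely_continuous_on 0 1 (prim f).
Proof.
move=> cf; have [K K0 fK] := cont01_bounded cf.
apply: (@ac_lipschitz _ K) => s t s0 st t1.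
exact: (prim_lipschitz cf fK).
Qed.

Lemma cont01_prim f : cont01 f -> cont01 (prim f).
Proof. by move=> cf; exact/ac_cont01/ac_prim. Qed.

Lemma geometric_small (K e : R) : 0 <= K -> 0 < e -> exists n, K / 2 ^+ n < e.
Proof.
move=> K0 e0; exists (Num.bound (K / e)).
set n := Num.bound _.
have Kn : K / e < n%:R by apply: archi_boundP; rewrite divr_ge0// ltW.
have n2 : (n%:R : R) < 2 ^+ n by rewrite -natrX ltr_nat ltn_expl.
by rewrite ltr_pdivrMr ?exprn_gt0// mulrC -ltr_pdivrMr// (lt_trans Kn).
Qed.

(** The limit is the supremum of the lower bounds [u n - K / 2 ^+ n]. *)
Lemma geometric_cauchy_limit (u : nat -> R) (K : R) : 0 <= K ->
  (forall n m, (n <= m)%N -> `|u m - u n| <= K / 2 ^+ n) ->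
  exists l, forall n, `|l - u n| <= K / 2 ^+ n.
Proof.
move=> K0 Hu; pose a n := u n - K / 2 ^+ n.
have e0 n : 0 <= K / 2 ^+ n by rewrite divr_ge0// exprn_ge0.
have ab n m : a n <= u m + K / 2 ^+ m.
  have := e0 n; have := e0 m; rewrite /a.
  by have [/Hu|/ltnW/Hu] := leqP n m; rewrite ler_norml => /andP[]; lra.
have sa : has_sup (range a).
  by split; [exists (a 0%N), 0%N|exists (u 0%N + K / 2 ^+ 0) => _ [n _ <-]; exact: ab].
exists (sup (range a)) => n; rewrite ler_norml; apply/andP; split.
  have : a n <= sup (range a) by apply: ub_le_sup; [exact: sa.2|exists n].
  rewrite /a; lra.
have : sup (range a) <= u n + K / 2 ^+ n.
  by apply: ge_sup; [exact: sa.1|move=> _ [m _ <-]; exact: ab].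
lra.
Qed.

Lemma cont01_limit f (u : nat -> R -> R) (K : R) : 0 <= K ->
  (forall n, cont01 (u n)) ->
  (forall n t, 0 <= t <= 1 -> `|f t - u n t| <= K / 2 ^+ n) -> cont01 f.
Proof.
move=> K0 cu fu t; apply/(@cvgrPdist_lt _ R^o) => e e0.
have e3 : 0 < e / 3 by lra.
have [n ne] := geometric_small K0 e3.
have Hn x : `|f (clip 0 1 x) - u n (clip 0 1 x)| < e / 3.
  by apply: le_lt_trans ne; apply: fu; exact: clip_in.
near=> s.
have us : `|u n (clip 0 1 t) - u n (clip 0 1 s)| < e / 3.
  by near: s; move: (cu n t) => /(@cvgrPdist_lt _ R^o); exact.
rewrite (_ : f (clip 0 1 t) - f (clip 0 1 s) = (f (clip 0 1 t) - u n (clip 0 1 t)) +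
  ((u n (clip 0 1 t) - u n (clip 0 1 s)) - (f (clip 0 1 s) - u n (clip 0 1 s)))); last by ring.
have := ler_normD (f (clip 0 1 t) - u n (clip 0 1 t))
  ((u n (clip 0 1 t) - u n (clip 0 1 s)) - (f (clip 0 1 s) - u n (clip 0 1 s))).
have := ler_normB (u n (clip 0 1 t) - u n (clip 0 1 s)) (f (clip 0 1 s) - u n (clip 0 1 s)).
have := Hn t; have := Hn s; lra.
Unshelve. all: by end_near. Qed.

Definition in_ball01 (I : Type) (K : R) (z : I -> R -> R) :=
  (forall i, cont01 (z i)) /\ forall i t, 0 <= t <= 1 -> `|z i t| <= K.

Definition dist01_le (I : Type) (N : R) (z z' : I -> R -> R) :=
  forall i t, 0 <= t <= 1 -> `|z i t - z' i t| <= N.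

(** Contraction principle in the sup norm over [[0, 1]]. Iterates of 0 stay in the ball, hence at
    mutual distance at most [2 * K], and each application of [T] halves the distance; the limit is
    chosen pointwise. *)
Lemma picard (I : Type) (T : (I -> R -> R) -> (I -> R -> R)) (K : R) : 0 <= K ->
  (forall z, in_ball01 K z -> in_ball01 K (T z)) ->
  (forall z z' N, in_ball01 K z -> in_ball01 K z' -> dist01_le N z z' ->
    dist01_le (N / 2) (T z) (T z')) ->
  exists2 z, in_ball01 K z & forall i t, 0 <= t <= 1 -> T z i t = z i t.
Proof.
move=> K0 invT conT.
pose u n := iter n T (fun _ _ => 0).
have uK n : in_ball01 K (u n).
  elim: n => [|n IH]; last exact: invT.
  by split=> [i|i t _]; [exact: cont01_cst|rewrite /u/= normr0].
have cauchy n k : dist01_le (2 * K / 2 ^+ n) (u (n + k)%N) (u n).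
  elim: n => [|n IH].
    move=> i t t01; rewrite expr0 divr1.
    by have := ler_normB (u (0 + k)%N i t) (u 0%N i t);
      have := (uK (0 + k)%N).2 i t t01; have := (uK 0%N).2 i t t01; lra.
  rewrite exprSr invfM mulrA; apply: (conT (u (n + k)%N) (u n)) => //.
have lim (x : I * R) : exists l, 0 <= x.2 <= 1 ->
    forall n, `|l - u n x.1 x.2| <= 2 * K / 2 ^+ n.
  have [t01|] := boolP (0 <= x.2 <= 1); last by exists 0.
  have [] := @geometric_cauchy_limit (fun n => u n x.1 x.2) (2 * K).
  - by rewrite mulr_ge0.
  - by move=> n m nm; rewrite -(subnKC nm); exact: cauchy.
  by move=> l Hl; exists l.
have /choice[l Hl] := lim; pose z i t := l (i, t).
have zu n : dist01_le (2 * K / 2 ^+ n) z (u n).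
  by move=> i t t01; exact: (Hl (i, t) t01).
have K20 : 0 <= 2 * K by rewrite mulr_ge0.
have small (a b c : R) : (forall n, a <= b + c / 2 ^+ n) -> 0 <= c -> a <= b.
  move=> H c0; rewrite leNgt; apply/negP => ba.
  have e0 : 0 < a - b by lra.
  by have [n nc] := geometric_small c0 e0; have := H n; lra.
have zK : in_ball01 K z.
  split=> [i|i t t01]; first exact: (cont01_limit K20 (fun n => (uK n).1 i)
    (fun n t => zu n i t)).
  apply: (small _ _ (2 * K)) => // n.
  have := zu n i t t01; have := (uK n).2 i t t01.
  have := ler_normD (z i t - u n i t) (u n i t); rewrite subrK; lra.
exists z => // i t t01; apply/eqP; rewrite -subr_eq0 -normr_le0.
apply: (small _ _ (2 * (2 * K))) => [n|]; last by rewrite mulr_ge0.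
have := conT _ _ _ zK (uK n) (zu n) i t t01.
have := zu n.+1 i t t01; rewrite -/(u n.+1) exprSr invfM mulrA.
have := ler_normB (T z i t - T (u n) i t) (z i t - T (u n) i t).
rewrite (_ : T z i t - T (u n) i t - (z i t - T (u n) i t) = T z i t - z i t); last by ring.
have : 0 <= 2 * K / 2 ^+ n by rewrite divr_ge0// exprn_ge0.
rewrite add0r -mulrA /u/=; lra.
Qed.

End picard.

(** * The rescaled Hamiltonian system as a contraction *)

Section hamiltonian_system.
Variable R : realType.
Variables A A1 A2 B B1 B2 C C1 C2 : R -> R -> R.
Variables (g0 h0 M : R).
Hypothesis M1 : 1 <= M.
Hypothesis HA : c11_2 g0 h0 A A1 A2 M.
Hypothesis HB : c11_2 g0 h0 B B1 B2 M.
Hypothesis HC : c11_2 g0 h0 C C1 C2 M.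
Local Notation H1 := (dham A1 B1 C1).
Local Notation H2 := (dham A2 B2 C2).

(** Two coefficients bounded by [M] times two momenta bounded by [2 * M] give velocities bounded by
    [K]. The 192 in [l0] yields [M ^+ 2 * (l0 * K) = 1 / 48], which keeps the paths in the unit box
    and makes the Picard map contract by the factor 1/2. *)
Let K := 4 * M ^+ 2.
Let l0 := (192 * M ^+ 4)^-1.

Definition in_box (y1 y2 : R -> R) :=
  forall t, 0 <= t <= 1 -> `|y1 t - g0| <= 1 /\ `|y2 t - h0| <= 1.

(** The coefficients are controlled in the box only, so continuity along a path is drawn from their
    Lipschitz bound there. *)
Lemma cont01_lip2 (f : R -> R -> R) (y1 y2 : R -> R) : cont01 y1 -> cont01 y2 ->
  in_box y1 y2 ->
  (forall x y x' y', `|x - g0| <= 1 -> `|y - h0| <= 1 -> `|x' - g0| <= 1 ->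
    `|y' - h0| <= 1 -> `|f x' y' - f x y| <= M * (`|x' - x| + `|y' - y|)) ->
  cont01 (fun t => f (y1 t) (y2 t)).
Proof.
move=> c1 c2 yb Lf t; apply/(@cvgrPdist_lt _ R^o) => e e0.
have M0 : 0 < M by exact: lt_le_trans ltr01 M1.
have e2 : 0 < e / (2 * M) by rewrite divr_gt0// mulr_gt0.
near=> s.
have d1 : `|y1 (clip 0 1 t) - y1 (clip 0 1 s)| < e / (2 * M).
  by near: s; move: (c1 t) => /(@cvgrPdist_lt _ R^o); exact.
have d2 : `|y2 (clip 0 1 t) - y2 (clip 0 1 s)| < e / (2 * M).
  by near: s; move: (c2 t) => /(@cvgrPdist_lt _ R^o); exact.
have [b1 b2] := yb _ (clip_in t ler01); have [b3 b4] := yb _ (clip_in s ler01).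
apply: le_lt_trans (Lf _ _ _ _ b3 b4 b1 b2) _.
have -> : e = M * (e / (2 * M) + e / (2 * M)) by field; rewrite gt_eqF.
by rewrite ltr_pM2l// ltrD.
Unshelve. all: by end_near. Qed.

Lemma cont01_dham (a b c : R -> R -> R) (y1 y2 p1 p2 : R -> R) :
  cont01 (fun t => a (y1 t) (y2 t)) -> cont01 (fun t => b (y1 t) (y2 t)) ->
  cont01 (fun t => c (y1 t) (y2 t)) -> cont01 p1 -> cont01 p2 ->
  cont01 (fun t => dham a b c (y1 t) (y2 t) (p1 t) (p2 t)).
Proof.
move=> ca cb cc cp1 cp2; apply: cont01M; last exact: cont01_cst.
apply: cont01D; first apply: cont01D.
- by apply: cont01M => //; exact: cont01X.
- do 2!apply: cont01M => //.
  by apply: cont01M => //; exact: cont01_cst.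
- by apply: cont01M => //; exact: cont01X.
Qed.

Lemma quadratic_bound (a b c p q N : R) : `|a| <= M -> `|b| <= M -> `|c| <= M ->
  `|p| <= N -> `|q| <= N ->
  `|(a * p ^+ 2 + 2 * b * p * q + c * q ^+ 2) / 2| <= 2 * M * N ^+ 2.
Proof.
move=> aM bM cM pN qN; have N0 : 0 <= N by exact: le_trans pN.
have M0 : 0 <= M by exact: le_trans ler01 M1.
rewrite (_ : (_ + _ + _) / 2 = (a * p * p + b * (p * q + q * p) + c * q * q) / 2);
  last by field.
rewrite normrM (ger0_norm (x := 2^-1))//.
have := bilinear_bound p q p q aM bM cM.
have pq : `|p| + `|q| <= 2 * N by lra.
have : M * ((`|p| + `|q|) * (`|p| + `|q|)) <= M * (2 * N * (2 * N)).
  by rewrite ler_wpM2l// ler_pM// addr_ge0.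
lra.
Qed.

Lemma quadratic_lip (a b c a' b' c' p q p' q' K0 N d : R) : 0 <= d ->
  `|a| <= M -> `|b| <= M -> `|c| <= M ->
  `|a' - a| <= M * d -> `|b' - b| <= M * d -> `|c' - c| <= M * d ->
  `|p| <= K0 -> `|q| <= K0 -> `|p'| <= K0 -> `|q'| <= K0 ->
  `|p' - p| <= N -> `|q' - q| <= N ->
  `|(a' * p' ^+ 2 + 2 * b' * p' * q' + c' * q' ^+ 2) / 2 -
    (a * p ^+ 2 + 2 * b * p * q + c * q ^+ 2) / 2| <=
  2 * M * K0 ^+ 2 * d + 4 * M * K0 * N.
Proof.
move=> d0 aM bM cM ad bd cd pK qK p'K q'K pN qN.
have K00 : 0 <= K0 by exact: le_trans pK.
have M0 : 0 <= M by exact: le_trans ler01 M1.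
have Md0 : 0 <= M * d by rewrite mulr_ge0.
have t1 := bilinear_bound p' q' p' q' ad bd cd.
have t2 := bilinear_bound (p' + p) (q' + q) (p' - p) (q' - q) aM bM cM.
rewrite (_ : _ - _ =
  ((a' - a) * p' * p' + (b' - b) * (p' * q' + q' * p') + (c' - c) * q' * q') / 2 +
  (a * (p' + p) * (p' - p) + b * ((p' + p) * (q' - q) + (q' + q) * (p' - p)) +
    c * (q' + q) * (q' - q)) / 2); last by field.
have pq' : `|p'| + `|q'| <= 2 * K0 by lra.
have s1 : M * d * ((`|p'| + `|q'|) * (`|p'| + `|q'|)) <= M * d * (2 * K0 * (2 * K0)).
  by rewrite ler_wpM2l// ler_pM// addr_ge0.
have s2 : M * ((`|p' + p| + `|q' + q|) * (`|p' - p| + `|q' - q|)) <=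
    M * (4 * K0 * (2 * N)).
  rewrite ler_wpM2l// ler_pM ?addr_ge0//; last lra.
  have := ler_normD p' p; have := ler_normD q' q; lra.
rewrite (le_trans (ler_normD _ _))// !normrM (ger0_norm (x := 2^-1))//.
lra.
Qed.

Let M0 : 0 < M. Proof. exact: lt_le_trans ltr01 M1. Qed.
Let K1 : 1 <= K.
Proof.
have : 1 <= M ^+ 2 by rewrite expr_ge1// ltW.
rewrite /K; lra.
Qed.
Let l00 : 0 < l0. Proof. by rewrite invr_gt0 mulr_gt0// exprn_gt0. Qed.
Let MKl : M ^+ 2 * (l0 * K) = 1 / 48.
Proof. by rewrite /l0 /K; field; rewrite gt_eqF. Qed.
Let lK : l0 * K <= 1 / 48.
Proof.
rewrite -MKl ler_peMl//; first by rewrite mulr_ge0 ?(ltW l00)// (le_trans ler01 K1).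
by rewrite expr_ge1// ltW.
Qed.

(* Index [(false, i)] is the [i]-th coordinate of the path, measured from the
   base point, and [(true, i)] that of the momentum, both divided by [lam]. *)
Local Notation I := (bool * bool)%type.

Definition pathof (lam : R) (z : I -> R -> R) t :=
  (g0 + lam * z (false, false) t, h0 + lam * z (false, true) t).

(** The momentum equation after division by [lam]: the position derivatives of the Hamiltonian are
    quadratic in the momenta, so one factor [lam] survives in front of them. *)
Definition force1 lam z t := let: (x, y) := pathof lam z t in
  A1 x y + lam * H1 x y (z (true, false) t) (z (true, true) t).
Definition force2 lam z t := let: (x, y) := pathof lam z t in
  A2 x y + lam * H2 x y (z (true, false) t) (z (true, true) t).
(** Integration backwards from 1 builds in the zero momentum at the free right end. *)
Definition momentum1 lam z t := prim (force1 lam z) 1 - prim (force1 lam z) t.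
Definition momentum2 lam z t := prim (force2 lam z) 1 - prim (force2 lam z) t.
Definition velocity1 lam z t := let: (x, y) := pathof lam z t in
  A x y * momentum1 lam z t + B x y * momentum2 lam z t.
Definition velocity2 lam z t := let: (x, y) := pathof lam z t in
  B x y * momentum1 lam z t + C x y * momentum2 lam z t.

Definition picard_map (lam : R) (z : I -> R -> R) (i : I) (t : R) : R :=
  match i with
  | (false, false) => prim (velocity1 lam z) t - prim (velocity1 lam z) 0
  | (false, true) => prim (velocity2 lam z) t - prim (velocity2 lam z) 0
  | (true, false) => momentum1 lam z t
  | (true, true) => momentum2 lam z t
  end.

Section bounds.
Variables (lam : R) (z : I -> R -> R).
Hypothesis laml : `|lam| <= l0.
Hypothesis zK : in_ball01 K z.

Let y1 t := g0 + lam * z (false, false) t.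
Let y2 t := h0 + lam * z (false, true) t.

Lemma path_in_box : in_box y1 y2.
Proof.
move=> t t01; have := lK; rewrite /y1 /y2 ![_ + _ * _]addrC !addrK.
have := ler_normM laml (zK.2 (false, false) t t01).
have := ler_normM laml (zK.2 (false, true) t t01).
by split; lra.
Qed.

Lemma cont01_path1 : cont01 y1.
Proof.
by apply: cont01D; [exact: cont01_cst|apply: cont01M; [exact: cont01_cst|exact: zK.1]].
Qed.

Lemma cont01_path2 : cont01 y2.
Proof.
by apply: cont01D; [exact: cont01_cst|apply: cont01M; [exact: cont01_cst|exact: zK.1]].
Qed.

Lemma cont01_coef f f1 f2 : c11_2 g0 h0 f f1 f2 M ->
  [/\ cont01 (fun t => f (y1 t) (y2 t)), cont01 (fun t => f1 (y1 t) (y2 t)) &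
      cont01 (fun t => f2 (y1 t) (y2 t))].
Proof.
move=> Hf; have c1 := cont01_path1; have c2 := cont01_path2.
split; apply: cont01_lip2 => //; try exact: path_in_box;
  by move=> x y x' y' xb yb xb' yb'; have [_ _ _ []] := Hf x y x' y' xb yb xb' yb'.
Qed.

Lemma cont01_force1 : cont01 (force1 lam z).
Proof.
have [_ cA _] := cont01_coef HA; have [_ cB _] := cont01_coef HB.
have [_ cC _] := cont01_coef HC.
apply: cont01D => //; apply: cont01M; first exact: cont01_cst.
by apply: cont01_dham => //; exact: zK.1.
Qed.

Lemma cont01_force2 : cont01 (force2 lam z).
Proof.
have [_ _ cA] := cont01_coef HA; have [_ _ cB] := cont01_coef HB.
have [_ _ cC] := cont01_coef HC.
apply: cont01D => //; apply: cont01M; first exact: cont01_cst.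
by apply: cont01_dham => //; exact: zK.1.
Qed.

Lemma cont01_momentum1 : cont01 (momentum1 lam z).
Proof.
by apply: cont01B; [exact: cont01_cst|apply: cont01_prim; exact: cont01_force1].
Qed.

Lemma cont01_momentum2 : cont01 (momentum2 lam z).
Proof.
by apply: cont01B; [exact: cont01_cst|apply: cont01_prim; exact: cont01_force2].
Qed.

Lemma cont01_velocity1 : cont01 (velocity1 lam z).
Proof.
have [cA _ _] := cont01_coef HA; have [cB _ _] := cont01_coef HB.
by apply: cont01D; apply: cont01M => //; [exact: cont01_momentum1|exact: cont01_momentum2].
Qed.

Lemma cont01_velocity2 : cont01 (velocity2 lam z).
Proof.
have [cB _ _] := cont01_coef HB; have [cC _ _] := cont01_coef HC.
by apply: cont01D; apply: cont01M => //; [exact: cont01_momentum1|exact: cont01_momentum2].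
Qed.

Lemma force_dev t : 0 <= t <= 1 ->
  `|lam * H1 (y1 t) (y2 t) (z (true, false) t) (z (true, true) t)| <= `|lam| * (2 * M * K ^+ 2) /\
  `|lam * H2 (y1 t) (y2 t) (z (true, false) t) (z (true, true) t)| <= `|lam| * (2 * M * K ^+ 2).
Proof.
move=> t01; have [b1 b2] := path_in_box t01.
have [_ ? ? _] := HA b1 b2 b1 b2; have [_ ? ? _] := HB b1 b2 b1 b2.
have [_ ? ? _] := HC b1 b2 b1 b2.
by split; apply: ler_normM => //; apply: quadratic_bound => //; exact: zK.2.
Qed.

(** The quadratic correction does not exceed the bound on the gradient of [A]; hence the constant
    [2 * M] for forces and momenta. *)
Let lamK : `|lam| * (2 * M * K ^+ 2) <= M.
Proof.
have : `|lam| * (2 * M * K ^+ 2) <= l0 * (2 * M * K ^+ 2).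
  by rewrite ler_wpM2r// !mulr_ge0 ?exprn_ge0 ?(ltW M0)// (le_trans ler01 K1).
have -> : l0 * (2 * M * K ^+ 2) = M / 6 by rewrite /l0 /K; field; rewrite gt_eqF.
have := M0; lra.
Qed.

Lemma force_bound t : 0 <= t <= 1 ->
  `|force1 lam z t| <= 2 * M /\ `|force2 lam z t| <= 2 * M.
Proof.
move=> t01; have [b1 b2] := path_in_box t01.
have [_ A1b A2b _] := HA b1 b2 b1 b2; have [d1 d2] := force_dev t01.
have := lamK; rewrite /force1 /force2 /= -/(y1 t) -/(y2 t).
by split; rewrite (le_trans (ler_normD _ _))//; lra.
Qed.

Lemma momentum_bound t : 0 <= t <= 1 ->
  `|momentum1 lam z t| <= 2 * M /\ `|momentum2 lam z t| <= 2 * M.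
Proof.
move=> /andP[t0 t1]; split; apply: prim_bound => //.
- exact: cont01_force1.
- by move=> x /force_bound[].
- exact: cont01_force2.
- by move=> x /force_bound[].
Qed.

Lemma velocity_bound t : 0 <= t <= 1 ->
  `|velocity1 lam z t| <= K /\ `|velocity2 lam z t| <= K.
Proof.
move=> t01; have [b1 b2] := path_in_box t01; have [m1 m2] := momentum_bound t01.
have [Ab _ _ _] := HA b1 b2 b1 b2; have [Bb _ _ _] := HB b1 b2 b1 b2.
have [Cb _ _ _] := HC b1 b2 b1 b2.
have := (ler_normM Ab m1, ler_normM Bb m2, ler_normM Bb m1, ler_normM Cb m2).
move=> [[[? ?] ?] ?]; rewrite /velocity1 /velocity2 /= -/(y1 t) -/(y2 t) /K expr2.
by split; rewrite (le_trans (ler_normD _ _))//; lra.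
Qed.

Lemma picard_map_ball : in_ball01 K (picard_map lam z).
Proof.
have MK : 2 * M <= K.
  rewrite /K expr2; have : 1 * M <= M * M by rewrite ler_pM2r.
  have := M0; lra.
split => [[[|] [|]]|[[|] [|]] t /[dup] t01 /andP[t0 t1]] /=.
- exact: cont01_momentum2.
- exact: cont01_momentum1.
- by apply: cont01B; [apply: cont01_prim; exact: cont01_velocity2|exact: cont01_cst].
- by apply: cont01B; [apply: cont01_prim; exact: cont01_velocity1|exact: cont01_cst].
- by have [] := momentum_bound t01; lra.
- by have [] := momentum_bound t01; lra.
- apply: prim_bound => //; first exact: cont01_velocity2.
  by move=> x /velocity_bound[].
- apply: prim_bound => //; first exact: cont01_velocity1.
  by move=> x /velocity_bound[].
Qed.

End bounds.

(** One estimate with two uses: equal multipliers give the contraction, and two fixed points give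
    the Lipschitz dependence on the multiplier. *)
Lemma picard_step lam lam' z z' N : `|lam| <= l0 -> `|lam'| <= l0 ->
  in_ball01 K z -> in_ball01 K z' -> 0 <= N -> dist01_le N z z' ->
  dist01_le (20 * M ^+ 2 * K ^+ 2 * `|lam - lam'| + N / 2)
    (picard_map lam z) (picard_map lam' z').
Proof.
move=> laml laml' zK zK' N0 zN; set de := `|lam - lam'|.
have de0 : 0 <= de by exact: normr_ge0.
have K0 : 0 < K by exact: lt_le_trans ltr01 K1.
pose d := 2 * (K * de + l0 * N).
have MK0 : 0 <= M * K by apply: mulr_ge0; exact: ltW.
have l0N0 : 0 <= l0 * N by rewrite mulr_ge0// ltW.
have Kde0 : 0 <= K * de by rewrite mulr_ge0// ltW.
have d0 : 0 <= d by rewrite /d; lra.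
have force_comb (a a' k k' : R) : `|a - a'| <= M * d -> `|k| <= 2 * M * K ^+ 2 ->
    `|k - k'| <= 2 * M * K ^+ 2 * d + 4 * M * K * N ->
    `|a + lam * k - (a' + lam' * k')| <= 8 * M * K ^+ 2 * de + 10 * M * K * (l0 * N).
  move=> ad kb kd.
  rewrite (_ : _ - _ = (a - a') + ((lam - lam') * k + lam' * (k - k'))); last by ring.
  rewrite (le_trans (ler_normD _ _))//.
  rewrite (le_trans (lerD (lexx _) (ler_normD _ _)))//.
  have := ler_normM (lexx de) kb; have := ler_normM laml' kd.
  have h2 : l0 * K * (2 * M * K * d) <= 1 * (2 * M * K * d).
    apply: ler_wpM2r; last by have := lK; lra.
    by apply: mulr_ge0 => //; rewrite -mulrA; apply: mulr_ge0.
  have h3 : M * K * de * 1 <= M * K * de * K.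
    by apply: ler_wpM2l => //; apply: mulr_ge0.
  have h4 : M * (l0 * N) * 1 <= M * (l0 * N) * K.
    by apply: ler_wpM2l => //; apply: mulr_ge0 => //; exact: ltW.
  move: (ad) h2 h3 h4; rewrite /d; lra.
have yd i t : 0 <= t <= 1 -> `|lam * z i t - lam' * z' i t| <= K * de + l0 * N.
  move=> t01; rewrite (_ : _ - _ = (lam - lam') * z i t + lam' * (z i t - z' i t));
    last by ring.
  rewrite (le_trans (ler_normD _ _))// [K * _]mulrC lerD// ler_normM//; first exact: zK.2.
  exact: zN.
have ydist t : 0 <= t <= 1 ->
    `|(pathof lam z t).1 - (pathof lam' z' t).1| +
    `|(pathof lam z t).2 - (pathof lam' z' t).2| <= d.
  move=> t01; rewrite /pathof /d /=.
  rewrite (_ : g0 + _ - _ = lam * z (false, false) t - lam' * z' (false, false) t);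
    last by ring.
  rewrite (_ : h0 + _ - _ = lam * z (false, true) t - lam' * z' (false, true) t);
    last by ring.
  by have := yd (false, false) t t01; have := yd (false, true) t t01; lra.
have lip f f1 f2 t : c11_2 g0 h0 f f1 f2 M -> 0 <= t <= 1 ->
    let: (x, y) := pathof lam z t in let: (x', y') := pathof lam' z' t in
    [/\ [/\ `|f x y| <= M, `|f x' y'| <= M & `|f x y - f x' y'| <= M * d],
        [/\ `|f1 x y| <= M, `|f1 x' y'| <= M & `|f1 x y - f1 x' y'| <= M * d] &
        [/\ `|f2 x y| <= M, `|f2 x' y'| <= M & `|f2 x y - f2 x' y'| <= M * d]].
  move=> Hf t01; rewrite /pathof.
  have [b1 b2] := path_in_box laml zK t01; have [b1' b2'] := path_in_box laml' zK' t01.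
  have := ler_wpM2l (ltW M0) (ydist t t01); rewrite /pathof /= => Md.
  have [f0' f1' f2' [l0' l1' l2' _]] := Hf _ _ _ _ b1' b2' b1 b2.
  have [? ? ? _] := Hf _ _ _ _ b1 b2 b1' b2'.
  by split; split => //; apply: le_trans Md.
have force_lip t : 0 <= t <= 1 ->
   `|force1 lam z t - force1 lam' z' t| <= 8 * M * K ^+ 2 * de + 10 * M * K * (l0 * N) /\
   `|force2 lam z t - force2 lam' z' t| <= 8 * M * K ^+ 2 * de + 10 * M * K * (l0 * N).
  move=> t01; have := lip _ _ _ t HA t01; have := lip _ _ _ t HB t01.
  have := lip _ _ _ t HC t01; rewrite /force1 /force2 /pathof.
  set x := g0 + _; set y := h0 + _; set x' := g0 + _; set y' := h0 + _.
  move=> [_ [C1x C1x' C1d] [C2x C2x' C2d]] [_ [B1x B1x' B1d] [B2x B2x' B2d]].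
  move=> [_ [A1x A1x' A1d] [A2x A2x' A2d]].
  have [w1 w2] := (zK.2 (true, false) t t01, zK.2 (true, true) t t01).
  have [w1' w2'] := (zK'.2 (true, false) t t01, zK'.2 (true, true) t t01).
  have [wd1 wd2] := (zN (true, false) t t01, zN (true, true) t t01).
  have q1 := quadratic_lip d0 A1x' B1x' C1x' A1d B1d C1d w1' w2' w1 w2 wd1 wd2.
  have q2 := quadratic_lip d0 A2x' B2x' C2x' A2d B2d C2d w1' w2' w1 w2 wd1 wd2.
  have b1 := quadratic_bound A1x B1x C1x w1 w2.
  have b2 := quadratic_bound A2x B2x C2x w1 w2.
  by split; apply: force_comb.
pose E := 8 * M * K ^+ 2 * de + 10 * M * K * (l0 * N).
have mom_lip t : 0 <= t <= 1 ->
   `|momentum1 lam z t - momentum1 lam' z' t| <= E /\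
   `|momentum2 lam z t - momentum2 lam' z' t| <= E.
  move=> /andP[t0 t1]; split; apply: prim_dist => //.
  - exact: cont01_force1.
  - exact: cont01_force1.
  - by move=> x /force_lip[].
  - exact: cont01_force2.
  - exact: cont01_force2.
  - by move=> x /force_lip[].
have MM : M * K ^+ 2 * de <= M ^+ 2 * K ^+ 2 * de.
  by rewrite ler_wpM2r// ler_wpM2r ?exprn_ge0 ?(ltW K0)// expr2 ler_peMl// ltW.
have MM' : M * K * (l0 * N) <= M ^+ 2 * K * (l0 * N).
  by rewrite ler_wpM2r// ler_wpM2r ?(ltW K0)// expr2 ler_peMl// ltW.
have MKlN : M ^+ 2 * K * (l0 * N) = N / 48.
  rewrite (_ : _ * (l0 * N) = M ^+ 2 * (l0 * K) * N); last by ring.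
  by rewrite MKl; field.
have MKd0 : 0 <= M ^+ 2 * K ^+ 2 * de by rewrite !mulr_ge0 ?exprn_ge0// ltW.
have E_le : E <= 20 * M ^+ 2 * K ^+ 2 * de + N / 2 by rewrite /E; lra.
(* The increments of the coefficients contribute [4 / 48 * N] and those of the momenta
   [20 / 48 * N], together exactly [N / 2]. *)
have velocity_comb (a a' b b' m n m' n' : R) : `|a - a'| <= M * d -> `|b - b'| <= M * d ->
    `|a'| <= M -> `|b'| <= M -> `|m| <= K -> `|n| <= K ->
    `|m - m'| <= E -> `|n - n'| <= E ->
    `|a * m + b * n - (a' * m' + b' * n')| <= 20 * M ^+ 2 * K ^+ 2 * de + N / 2.
  move=> ad bd aM bM mK nK mE nE.
  rewrite (_ : _ - _ = ((a - a') * m + a' * (m - m')) + ((b - b') * n + b' * (n - n')));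
    last by ring.
  rewrite (le_trans (ler_normD _ _))// (le_trans (lerD (ler_normD _ _) (ler_normD _ _)))//.
  have := (ler_normM ad mK, ler_normM bd nK, ler_normM aM mE, ler_normM bM nE).
  move=> [[[]]]; rewrite /d /E.
  lra.
have vel_lip t : 0 <= t <= 1 ->
   `|velocity1 lam z t - velocity1 lam' z' t| <= 20 * M ^+ 2 * K ^+ 2 * de + N / 2 /\
   `|velocity2 lam z t - velocity2 lam' z' t| <= 20 * M ^+ 2 * K ^+ 2 * de + N / 2.
  move=> t01; have := lip _ _ _ t HA t01; have := lip _ _ _ t HB t01.
  have := lip _ _ _ t HC t01; rewrite /velocity1 /velocity2 /pathof.
  set x := g0 + _; set y := h0 + _; set x' := g0 + _; set y' := h0 + _.
  move=> [[Cx Cx' Cd] _ _] [[Bx Bx' Bd] _ _] [[Ax Ax' Ad] _ _].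
  have [m1 m2] := ((picard_map_ball laml zK).2 (true, false) t t01,
    (picard_map_ball laml zK).2 (true, true) t t01).
  have [md1 md2] := mom_lip t t01.
  by split; apply: velocity_comb.
move=> [[|] [|]] t /[dup] t01 /andP[t0 t1] /=.
- by have [_ /le_trans] := mom_lip t t01; apply.
- by have [/le_trans + _] := mom_lip t t01; apply.
- apply: prim_dist => //; [exact: cont01_velocity2..|].
  by move=> x /vel_lip[].
- apply: prim_dist => //; [exact: cont01_velocity1..|].
  by move=> x /vel_lip[].
Qed.

End hamiltonian_system.

(** * Dependence of the critical path on the multiplier *)

Section fixed_points.
Variable R : realType.
Variables A A1 A2 B B1 B2 C C1 C2 : R -> R -> R.
Variables (g0 h0 M : R).
Hypothesis M1 : 1 <= M.
Hypothesis HA : c11_2 g0 h0 A A1 A2 M.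
Hypothesis HB : c11_2 g0 h0 B B1 B2 M.
Hypothesis HC : c11_2 g0 h0 C C1 C2 M.
Local Notation K := (4 * M ^+ 2).
Local Notation l0 := ((192 * M ^+ 4)^-1).
Local Notation T := (picard_map A A1 A2 B B1 B2 C C1 C2 g0 h0).

Definition is_fixed_point lam (z : bool * bool -> R -> R) :=
  in_ball01 K z /\ forall i t, 0 <= t <= 1 -> T lam z i t = z i t.

Let M0 : 0 < M. Proof. exact: lt_le_trans ltr01 M1. Qed.
Let K0 : 0 <= K. Proof. by rewrite mulr_ge0// exprn_ge0// ltW. Qed.

Lemma dist01_le_ge0 (I : Type) (i : I) (N : R) (z z' : I -> R -> R) :
  dist01_le N z z' -> 0 <= N.
Proof. by move=> /(_ i 0); rewrite lexx ler01 => /(_ isT); exact: le_trans. Qed.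

Lemma fixed_point_ex lam : `|lam| <= l0 -> exists z, is_fixed_point lam z.
Proof.
move=> laml; have [z zK Tz] : exists2 z, in_ball01 K z &
    forall i t, 0 <= t <= 1 -> T lam z i t = z i t.
  apply: picard => //; first by move=> z; exact: picard_map_ball.
  move=> z z' N zK zK' zN; have N0 := dist01_le_ge0 (true, true) zN.
  have := picard_step M1 HA HB HC laml laml zK zK' N0 zN.
  by rewrite subrr normr0 mulr0 add0r.
by exists z.
Qed.

(** For fixed points [picard_step] improves a distance bound [N] to [c + N / 2]; iteration drives
    the bound down to [2 * c]. *)
Lemma fixed_point_lip lam lam' z z' : `|lam| <= l0 -> `|lam'| <= l0 ->
  is_fixed_point lam z -> is_fixed_point lam' z' ->
  dist01_le (40 * M ^+ 2 * K ^+ 2 * `|lam - lam'|) z z'.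
Proof.
move=> laml laml' [zK Tz] [zK' Tz']; set c := 20 * M ^+ 2 * K ^+ 2 * `|lam - lam'|.
have c0 : 0 <= c.
  apply: mulr_ge0 => //; apply: mulr_ge0; last exact: sqr_ge0.
  apply: mulr_ge0 => //; exact: sqr_ge0.
have H n : dist01_le (2 * c + 2 * K / 2 ^+ n) z z'.
  elim: n => [|n IH].
    move=> i t t01; rewrite expr0 divr1.
    have := zK.2 i t t01; have := zK'.2 i t t01; have := ler_normB (z i t) (z' i t).
    lra.
  move=> i t t01; have N0 := dist01_le_ge0 (true, true) IH.
  have := picard_step M1 HA HB HC laml laml' zK zK' N0 IH i t01.
  rewrite Tz// Tz'// -/c => /le_trans; apply.
  by rewrite [2 ^+ n.+1]exprSr invfM; lra.
move=> i t t01; rewrite (_ : 40 * _ * _ * _ = 2 * c); last by rewrite /c; ring.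
rewrite leNgt; apply/negP => lt_c.
have e0 : 0 < `|z i t - z' i t| - 2 * c by lra.
have K20 : 0 <= 2 * K by rewrite mulr_ge0.
by have [n] := geometric_small K20 e0; have := H n i t t01; lra.
Qed.

(** With the coefficients frozen at the base point and the [lam] term dropped, the momenta are
    constants times [1 - t], hence so are the velocities, with primitive [t - t ^+ 2 / 2]. Freezing
    costs O(lam) because the path stays within O(lam) of the base point. *)
Lemma fixed_point_first_order lam z t : `|lam| <= l0 -> is_fixed_point lam z ->
  0 <= t <= 1 ->
  [/\ `|z (false, false) t - (A g0 h0 * A1 g0 h0 + B g0 h0 * A2 g0 h0) * (t - t ^+ 2 / 2)|
      <= 12 * M ^+ 2 * K ^+ 2 * `|lam| &
      `|z (false, true) t - (B g0 h0 * A1 g0 h0 + C g0 h0 * A2 g0 h0) * (t - t ^+ 2 / 2)|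
      <= 12 * M ^+ 2 * K ^+ 2 * `|lam|].
Proof.
move=> laml [zK Tz].
have [bg bh] : `|g0 - g0| <= 1 /\ `|h0 - h0| <= 1 by rewrite !subrr normr0.
have K1 : 1 <= K.
  have : 1 <= M ^+ 2 by rewrite expr_ge1// ltW.
  lra.
pose y1 t := g0 + lam * z (false, false) t; pose y2 t := h0 + lam * z (false, true) t.
have yd s : 0 <= s <= 1 -> `|y1 s - g0| + `|y2 s - h0| <= 2 * (`|lam| * K).
  move=> s01; rewrite /y1 /y2 ![_ + _ * _]addrC !addrK.
  have := ler_normM (lexx `|lam|) (zK.2 (false, false) s s01).
  have := ler_normM (lexx `|lam|) (zK.2 (false, true) s s01); lra.
have coef f f1 f2 s : c11_2 g0 h0 f f1 f2 M -> 0 <= s <= 1 ->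
  [/\ `|f g0 h0| <= M, `|f (y1 s) (y2 s) - f g0 h0| <= 2 * (M * (`|lam| * K)),
     `|f1 (y1 s) (y2 s) - f1 g0 h0| <= 2 * (M * (`|lam| * K)) &
     `|f2 (y1 s) (y2 s) - f2 g0 h0| <= 2 * (M * (`|lam| * K))].
  move=> Hf s01; have [b1 b2] := path_in_box g0 h0 M1 laml zK s01.
  have := ler_wpM2l (ltW M0) (yd s s01); rewrite mulrCA => Md.
  have [f0 _ _ [? ? ? _]] := Hf _ _ _ _ bg bh b1 b2.
  by split => //; apply: le_trans Md.
set c := 4 * M * K ^+ 2 * `|lam|.
have MKl : M * (`|lam| * K) <= M * K ^+ 2 * `|lam|.
  have : M * `|lam| * K * 1 <= M * `|lam| * K * K.
    by apply: ler_wpM2l => //; apply: mulr_ge0 => //; apply: mulr_ge0 => //; exact: ltW.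
  lra.
have force s : 0 <= s <= 1 ->
    `|force1 A1 B1 C1 g0 h0 lam z s - A1 g0 h0| <= c /\
    `|force2 A2 B2 C2 g0 h0 lam z s - A2 g0 h0| <= c.
  move=> s01; have [_ _ a1 a2] := coef _ _ _ s HA s01.
  have [d1 d2] := force_dev M1 HA HB HC laml zK s01.
  rewrite /force1 /force2 /= -/(y1 s) -/(y2 s).
  split; rewrite addrAC (le_trans (ler_normD _ _))//; rewrite /c; lra.
have lin (a x : R) : is_derive x (1 : R) (fun x => a * x) a.
  have := is_deriveZ a (@is_derive_id _ _ x (1 : R)).
  by rewrite /GRing.scale/= mulr1.
have c0 : 0 <= c.
  apply: mulr_ge0 => //; apply: mulr_ge0; last exact: sqr_ge0.
  apply: mulr_ge0 => //; exact: ltW.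
have mom s : 0 <= s <= 1 ->
    `|z (true, false) s - A1 g0 h0 * (1 - s)| <= c /\
    `|z (true, true) s - A2 g0 h0 * (1 - s)| <= c.
  move=> /[dup] s01 /andP[s0 s1]; rewrite -!Tz//= /momentum1 /momentum2.
  have c1 := cont01_force1 M1 HA HB HC laml zK.
  have c2 := cont01_force2 M1 HA HB HC laml zK.
  have := prim_mean c1 (fun x _ => lin (A1 g0 h0) x) (fun x x01 => (force x x01).1)
    s0 s1 (lexx 1).
  have := prim_mean c2 (fun x _ => lin (A2 g0 h0) x) (fun x x01 => (force x x01).2)
    s0 s1 (lexx 1).
  have : c * (1 - s) <= c by rewrite ler_piMr//; lra.
  by rewrite -!mulrBr => ? ? ?; split; lra.
have bound (a b a0 b0 m n m0 n0 s : R) : 0 <= s <= 1 ->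
    `|a - a0| <= 2 * (M * (`|lam| * K)) ->
    `|b - b0| <= 2 * (M * (`|lam| * K)) -> `|a0| <= M -> `|b0| <= M ->
    `|m| <= K -> `|n| <= K -> `|m - m0 * (1 - s)| <= c -> `|n - n0 * (1 - s)| <= c ->
    `|a * m + b * n - (a0 * m0 + b0 * n0) * (1 - s)| <= 12 * M ^+ 2 * K ^+ 2 * `|lam|.
  move=> s01 ad bd aM bM mK nK mc nc.
  rewrite (_ : _ - _ = ((a - a0) * m + a0 * (m - m0 * (1 - s))) +
    ((b - b0) * n + b0 * (n - n0 * (1 - s)))); last by ring.
  rewrite (le_trans (ler_normD _ _))// (le_trans (lerD (ler_normD _ _) (ler_normD _ _)))//.
  have := (ler_normM ad mK, ler_normM bd nK, ler_normM aM mc, ler_normM bM nc).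
  move=> [[[]]]; rewrite /c.
  have : M * (K ^+ 2 * `|lam|) <= M ^+ 2 * (K ^+ 2 * `|lam|).
    by rewrite ler_wpM2r ?expr2 ?ler_peMl ?mulr_ge0// ltW.
  lra.
have vel s : 0 <= s <= 1 ->
    `|velocity1 A A1 A2 B B1 B2 C1 C2 g0 h0 lam z s -
      (A g0 h0 * A1 g0 h0 + B g0 h0 * A2 g0 h0) * (1 - s)| <= 12 * M ^+ 2 * K ^+ 2 * `|lam| /\
    `|velocity2 A1 A2 B B1 B2 C C1 C2 g0 h0 lam z s -
      (B g0 h0 * A1 g0 h0 + C g0 h0 * A2 g0 h0) * (1 - s)| <= 12 * M ^+ 2 * K ^+ 2 * `|lam|.
  move=> s01; have [a0 ad _ _] := coef _ _ _ s HA s01.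
  have [b1 bd _ _] := coef _ _ _ s HB s01; have [cc0 cd _ _] := coef _ _ _ s HC s01.
  have [m1 m2] := mom s s01.
  have [w1 w2] := (zK.2 (true, false) s s01, zK.2 (true, true) s s01).
  rewrite /velocity1 /velocity2 /= -/(y1 s) -/(y2 s).
  move: m1 m2 w1 w2; rewrite -!Tz//= => m1 m2 w1 w2.
  by split; apply: bound.
have quad (a x : R) : is_derive x (1 : R) (fun x => a * (x - x ^+ 2 / 2)) (a * (1 - x)).
  have id1 := @is_derive_id _ _ x (1 : R).
  have := is_deriveM1 (is_derive_cst a x 1) (is_deriveB1 id1
    (is_deriveM1 (is_deriveM1 id1 id1) (is_derive_cst (2^-1 : R) x 1))).
  rewrite (_ : 0 * _ + _ = a * (1 - x)); last by rewrite /cst /=; field.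
  by [].
move=> /[dup] t01 /andP[t0 t1]; rewrite -!Tz//=.
have c1 := cont01_velocity1 M1 HA HB HC laml zK.
have c2 := cont01_velocity2 M1 HA HB HC laml zK.
have := prim_mean c1 (fun x _ => quad _ x) (fun x x01 => (vel x x01).1) (lexx 0) t0 t1.
have := prim_mean c2 (fun x _ => quad _ x) (fun x x01 => (vel x x01).2) (lexx 0) t0 t1.
set e := 12 * M ^+ 2 * K ^+ 2 * `|lam|.
have e0 : 0 <= e.
  apply: mulr_ge0 => //; apply: mulr_ge0; last exact: sqr_ge0.
  apply: mulr_ge0 => //; exact: sqr_ge0.
have : e * (t - 0) <= e by rewrite ler_piMr//; lra.
rewrite /= expr0n/= mul0r !subr0 !mulr0 !subr0 => ? H2 H1.
by split; [apply: le_trans H1 _|apply: le_trans H2 _].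
Qed.

End fixed_points.

(** * Scalar estimates and expansions *)

Section selection.
Variable R : realType.
Implicit Types (c F : R -> R) (a b x e lam k : R).

Lemma lipschitz_continuous F L : 0 <= L ->
  (forall x y, x <= y -> `|F y - F x| <= L * (y - x)) -> continuous F.
Proof.
move=> L0 HF x; apply/(@cvgrPdist_lt _ R^o) => e e0.
have HF' y : `|F x - F y| <= L * `|x - y|.
  have [xy|/ltW yx] := leP x y.
    by rewrite distrC (distrC x y) (ger0_norm (x := y - x)) ?subr_ge0//; exact: HF.
  by rewrite (ger0_norm (x := x - y)) ?subr_ge0//; exact: HF.
have L1 : 0 < L + 1 by lra.
have e1 : 0 < e / (L + 1) by rewrite divr_gt0.
near=> y; apply: le_lt_trans (HF' y) _.
have xy : `|x - y| < e / (L + 1) by near: y; exact: (@nbhsx_ballx _ R^o).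
have xy0 := normr_ge0 (x - y).
rewrite ltr_pdivlMr// in xy; lra.
Unshelve. all: by end_near. Qed.

(** Intermediate value theorem on the interval of radius [N2 * x ^+ 2] around [a / kappa * x]. The
    product [kappa * N2] is the sum of the two quadratic error constants, so the values of [c] at
    the ends enclose [k]; the choice of [e] keeps the interval inside [[- l1, l1]]. *)
Lemma perturbed_linear_solve c (l1 L N A0 kappa a Ck : R) : 0 < l1 -> 0 <= L ->
  0 <= N -> 0 <= Ck -> 0 < kappa ->
  (forall lam lam', `|lam| <= l1 -> `|lam'| <= l1 ->
    `|c lam - c lam'| <= L * `|lam - lam'|) ->
  (forall lam, `|lam| <= l1 -> `|c lam - (A0 + kappa * lam)| <= N * lam ^+ 2) ->
  exists e N2, [/\ 0 < e, 0 <= N2 & forall x k, `|x| <= e ->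
    `|k - (A0 + a * x)| <= Ck * x ^+ 2 ->
    exists lam, [/\ `|lam| <= l1, `|lam - a / kappa * x| <= N2 * x ^+ 2 & c lam = k]].
Proof.
move=> l10 L0 N0 Ck0 kappa0 lipc expc.
set al := a / kappa; pose N3 := N * (`|al| + 1) ^+ 2; pose N2 := (N3 + Ck) / kappa.
have al0 := normr_ge0 al.
have N30 : 0 <= N3 by rewrite mulr_ge0// sqr_ge0.
have N20 : 0 <= N2 by rewrite divr_ge0// ?addr_ge0// ltW.
pose e := Num.min (1 / (N2 + 1)) (l1 / (`|al| + 1)).
have N21 : 0 < N2 + 1 by lra.
have al1 : 0 < `|al| + 1 by lra.
have e0 : 0 < e by rewrite lt_min !divr_gt0.
exists e, N2; split => // x k; rewrite le_min => /andP[].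
rewrite !ler_pdivlMr// => xN2 xal kx.
have x0 := normr_ge0 x.
have xx : x ^+ 2 = `|x| * `|x| by rewrite -expr2 real_normK ?num_real.
pose d := N2 * x ^+ 2.
have d0 : 0 <= d by rewrite mulr_ge0// sqr_ge0.
have dx : d <= `|x|.
  rewrite /d xx mulrA ler_piMl//; lra.
have ax : `|al * x| <= `|al| * `|x| by rewrite normrM.
have inl lam : al * x - d <= lam -> lam <= al * x + d -> `|lam| <= (`|al| + 1) * `|x|.
  by move: ax; rewrite !ler_norml => /andP[? ?] ? ?; apply/andP; split; lra.
have inl1 lam : al * x - d <= lam -> lam <= al * x + d -> `|lam| <= l1.
  by move=> H1 H2; apply: le_trans (inl _ H1 H2) _; lra.
have sq lam : al * x - d <= lam -> lam <= al * x + d -> N * lam ^+ 2 <= N3 * x ^+ 2.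
  move=> H1 H2; rewrite /N3 -mulrA ler_wpM2l// -(real_normK (num_real lam)) xx.
  rewrite (_ : (`|al| + 1) ^+ 2 * (`|x| * `|x|) = ((`|al| + 1) * `|x|) ^+ 2); last by ring.
  by rewrite ler_sqr ?nnegrE ?mulr_ge0 ?(ltW al1)//; exact: inl.
have kd : kappa * d = N3 * x ^+ 2 + Ck * x ^+ 2.
  by rewrite /d /N2; field; rewrite gt_eqF.
have kax : kappa * (al * x) = a * x by rewrite /al; field; rewrite gt_eqF.
(* The Lipschitz bound on [c] holds on [[- l1, l1]] only; the clipped function is continuous
   everywhere. *)
pose F y := c (clip (- l1) l1 y).
have cF : continuous F.
  apply: (lipschitz_continuous L0) => y y' yy'.
  have ll : - l1 <= l1 by lra.
  have [/andP[? ?] /andP[? ?]] := (clip_in y ll, clip_in y' ll).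
  rewrite (le_trans (lipc _ _ _ _)) ?ler_norml ?(clip_in _ ll)//.
  rewrite ler_wpM2l// ger0_norm; first exact: clip_dist.
  by rewrite subr_ge0; exact: clip_nondecreasing.
have FE y : al * x - d <= y -> y <= al * x + d -> F y = c y.
  move=> H1 H2; have := inl1 _ H1 H2; rewrite ler_norml => /andP[? ?].
  by rewrite /F clip_id.
have le1 : al * x - d <= al * x + d by lra.
have lo : c (al * x - d) <= k.
  have := expc _ (inl1 _ (lexx _) le1); have := sq _ (lexx _) le1.
  by move: kx; rewrite !ler_norml => /andP[? ?] ? /andP[? ?]; lra.
have hi : k <= c (al * x + d).
  have := expc _ (inl1 _ le1 (lexx _)); have := sq _ le1 (lexx _).
  by move: kx; rewrite !ler_norml => /andP[? ?] ? /andP[? ?]; lra.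
have cF' : {within `[al * x - d, al * x + d], continuous F}.
  by apply: continuous_subspaceT => y; exact: cF.
have := IVT le1 cF' (v := k); rewrite !FE//.
rewrite (min_idPl (le_trans lo hi)) (max_idPr (le_trans lo hi)).
rewrite lo hi => /(_ isT)[lam]; rewrite in_itv/= => /andP[H1 H2].
rewrite FE// => cl; exists lam; split => //; first exact: inl1.
by rewrite -/d ler_norml; apply/andP; split; lra.
Qed.

Lemma first_exit (f : R -> R) (t1 : R) : continuous f -> f 0 < 1 -> 0 <= t1 ->
  1 <= f t1 -> exists tau, [/\ 0 < tau, tau <= t1, 1 <= f tau &
    forall t, 0 <= t -> t < tau -> f t < 1].
Proof.
move=> cf f0 t10 ft1; pose S := [set t | 0 <= t /\ 1 <= f t].
have St1 : S t1 by [].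
have lS : lbound S 0 by move=> t [].
have hlS : has_lbound S by exists 0.
have iS : has_inf S by split; [exists t1|exists 0].
have tau0 : 0 <= inf S by apply: lb_le_inf => //; exists t1.
have ftau : 1 <= f (inf S).
  rewrite leNgt; apply/negP => ftau.
  have e0 : 0 < 1 - f (inf S) by lra.
  have /(@cvgrPdist_lt _ R^o)/(_ _ e0) := cf (inf S).
  move=> /nbhs_ballP[d /= d0 Hd].
  have [t [t0 ft] td] := inf_adherent d0 iS.
  have tS : inf S <= t by exact: (ge_inf hlS (conj t0 ft)).
  have := Hd t; rewrite /ball/= ler0_norm ?subr_le0//.
  have tin : - (inf S - t) < d by lra.
  move=> /(_ tin); rewrite ltr_norml => /andP[]; lra.
exists (inf S); split => //.
- rewrite lt_neqAle tau0 andbT; apply/eqP => E; move: ftau; rewrite -E; lra.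
- exact: (ge_inf hlS St1).
- move=> t t0 tS; rewrite ltNge; apply/negP => ft.
  have : inf S <= t by exact: (ge_inf hlS (conj t0 ft)).
  lra.
Qed.

End selection.

(** * Moments of polynomials and of the profile [t - t ^+ 2 / 2] *)

Section polynomials01.
Variable R : realType.

Lemma is_deriveX1 (n : nat) (t : R) :
  is_derive t (1 : R) (fun s => s ^+ n.+1 / n.+1%:R) (t ^+ n).
Proof.
have H k : is_derive t (1 : R) (fun s : R => s ^+ k.+1) (k.+1%:R * t ^+ k).
  elim: k => [|k IH].
    rewrite expr0 mulr1; have := @is_derive_id _ _ t (1 : R).
    by rewrite (_ : (fun s : R => s ^+ 1) = id)//; apply/funext => s; rewrite expr1.
  have := is_deriveM1 (@is_derive_id _ _ t (1 : R)) IH.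
  rewrite (_ : 1 * t ^+ k.+1 + _ = k.+2%:R * t ^+ k.+1); last first.
    by rewrite mulrCA -exprS -mulrDl -natr1 addrC -natr1 -natr1.
  by rewrite (_ : (fun s : R => id s * s ^+ k.+1) = fun s => s ^+ k.+2)//;
    apply/funext => s; rewrite exprS.
have := is_deriveM1 (H n) (is_derive_cst (n.+1%:R^-1 : R) t 1).
by rewrite mulr0 addr0 /cst /= mulrAC mulfV ?mul1r// pnatr_eq0.
Qed.

Lemma cont01_id : cont01 (fun t : R => t).
Proof. by apply: continuous_cont01 => t; exact: cvg_id. Qed.

Lemma integral01_monomial (n : nat) :
  integral01 (fun t : R => t ^+ n) = (n.+1%:R)^-1.
Proof.
have cX : continuous (fun t : R => t ^+ n) by move=> t; exact: exprn_continuous.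
rewrite (integral01_deriv cX (is_deriveX1 n)).
by rewrite expr1n expr0n/= mul0r subr0 mul1r.
Qed.

Lemma cont01_poly4 (a b c d e : R) :
  cont01 (fun t => a + b * t ^+ 1 + c * t ^+ 2 + d * t ^+ 3 + e * t ^+ 4).
Proof.
have X n (k : R) : cont01 (fun t : R => k * t ^+ n).
  by apply: cont01M; [exact: cont01_cst|exact: cont01X cont01_id].
do 4!(apply: cont01D; last exact: X); exact: cont01_cst.
Qed.

Lemma integral01_poly4 (a b c d e : R) :
  integral01 (fun t => a + b * t ^+ 1 + c * t ^+ 2 + d * t ^+ 3 + e * t ^+ 4) =
  a + b / 2 + c / 3 + d / 4 + e / 5.
Proof.
have X n : cont01 (fun t : R => t ^+ n) by exact: cont01X cont01_id.
have kX n (k : R) : cont01 (fun t : R => k * t ^+ n).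
  by apply: cont01M; [exact: cont01_cst|exact: X].
have ca := @cont01_cst R a.
have c1 := cont01D ca (kX 1%N b); have c2 := cont01D c1 (kX 2%N c).
have c3 := cont01D c2 (kX 3%N d).
rewrite (integral01D c3 (kX 4%N e)) (integral01D c2 (kX 3%N d)).
rewrite (integral01D c1 (kX 2%N c)) (integral01D ca (kX 1%N b)).
by rewrite !integral01Z// integral01_cst !integral01_monomial.
Qed.

Lemma theta_bound (t : R) : 0 <= t <= 1 -> 0 <= t - t ^+ 2 / 2 <= 1.
Proof.
move=> /andP[t0 t1]; have : t * t <= 1 * t by rewrite ler_wpM2r.
by have := sqr_ge0 t; rewrite expr2; lra.
Qed.

Lemma integral01_theta (a b : R) :
  integral01 (fun t => a + b * (t - t ^+ 2 / 2)) = a + b / 3.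
Proof.
rewrite (@eq_integral01 _ _ (fun t => a + b * t ^+ 1 + (- b / 2) * t ^+ 2 +
  0 * t ^+ 3 + 0 * t ^+ 4)); last by move=> t _; field.
by rewrite integral01_poly4; field.
Qed.

Lemma cont01_theta (a b : R) : cont01 (fun t => a + b * (t - t ^+ 2 / 2)).
Proof.
apply: cont01D; first exact: cont01_cst.
apply: cont01M; first exact: cont01_cst.
apply: cont01B; first exact: cont01_id.
by apply: cont01M; [exact: cont01X cont01_id|exact: cont01_cst].
Qed.

End polynomials01.

(** * Second-order expansions with cubic remainder *)

Section second_order_expansions.
Variable R : realType.
Implicit Types (f g : R -> R) (a b c s x : R).

(** A radius of at most 1 lets powers above the third be absorbed into the remainder of a
    product. *)
Definition taylor2 f a b c := exists r C, [/\ 0 < r <= 1, 0 <= C &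
  forall s, `|s| <= r -> `|f s - (a + b * s + c * s ^+ 2)| <= C * `|s| ^+ 3].

Lemma taylor2_ext f a b c a' b' c' : a = a' -> b = b' -> c = c' ->
  taylor2 f a b c -> taylor2 f a' b' c'.
Proof. by move=> -> -> ->. Qed.

Lemma taylor2_scale f a b c k : taylor2 f a b c ->
  taylor2 (fun s => f (k * s)) a (k * b) (k ^+ 2 * c).
Proof.
move=> [r [C [/andP[r0 r1] C0 H]]]; have k0 := normr_ge0 k.
have k1 : 0 < `|k| + 1 by exact: ltr_wpDl.
exists (r / (`|k| + 1)), (C * `|k| ^+ 3); split.
- by rewrite divr_gt0//= ler_pdivrMr// mul1r (le_trans r1)// lerDr.
- by rewrite mulr_ge0// exprn_ge0.
move=> s; rewrite (ler_pdivlMr _ _ k1) => sr.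
have ksr : `|k * s| <= r.
  by rewrite normrM; apply: le_trans sr; rewrite mulrC ler_wpM2l// lerDl.
have := H _ ksr; rewrite normrM [(_ * _) ^+ 3]exprMn [leRHS]mulrA.
by rewrite (_ : a + b * (k * s) + c * (k * s) ^+ 2 = a + k * b * s + k ^+ 2 * c * s ^+ 2);
  last by ring.
Qed.

Lemma taylor2M f g a b c a' b' c' : taylor2 f a b c -> taylor2 g a' b' c' ->
  taylor2 (fun s => f s * g s) (a * a') (a * b' + b * a') (a * c' + b * b' + c * a').
Proof.
move=> [r [C [/andP[r0 r1] C0 Hf]]] [r' [C' [/andP[r'0 r'1] C'0 Hg]]].
pose U := `|a| + `|b| + `|c|; pose U' := `|a'| + `|b'| + `|c'|.
have U0 : 0 <= U by rewrite !addr_ge0.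
have U'0 : 0 <= U' by rewrite !addr_ge0.
have Ub u v w s : `|s| <= 1 -> `|u + v * s + w * s ^+ 2| <= `|u| + `|v| + `|w|.
  move=> s1; apply: le_trans (ler_normD _ _) _; apply: lerD.
    apply: le_trans (ler_normD _ _) _; apply: lerD => //.
    by rewrite normrM ler_piMr.
  by rewrite normrM ler_piMr// normrX exprn_ile1.
exists (Num.min r r'), (U * C' + C * U' + C * C' + (`|b * c' + c * b'| + `|c * c'|)); split.
- by rewrite lt_min r0 r'0/= ge_min r1.
- by rewrite !addr_ge0// mulr_ge0.
move=> s; rewrite le_min => /andP[sr sr'].
have s1 := le_trans sr r1; have s0 := normr_ge0 s.
have Ef := Hf s sr; have Eg := Hg s sr'.
set F := a + _ + _ in Ef; set G := a' + _ + _ in Eg.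
have FU : `|F| <= U by exact: Ub.
have GU : `|G| <= U' by exact: Ub.
have n3 : `|s ^+ 3| = `|s| ^+ 3 by rewrite normrX.
have s31 : `|s| ^+ 3 <= 1 by rewrite exprn_ile1.
have s30 : 0 <= `|s| ^+ 3 by rewrite exprn_ge0.
rewrite (_ : _ - _ = F * (g s - G) + (f s - F) * G + (f s - F) * (g s - G) +
  (b * c' + c * b' + c * c' * s) * s ^+ 3); last by rewrite /F /G; ring.
have t1 := ler_normM FU Eg; have t2 := ler_normM Ef GU; have t3 := ler_normM Ef Eg.
have t4 : `|(b * c' + c * b' + c * c' * s) * s ^+ 3| <=
    (`|b * c' + c * b'| + `|c * c'|) * `|s| ^+ 3.
  rewrite normrM n3 ler_wpM2r//; apply: le_trans (ler_normD _ _) _; apply: lerD => //.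
  by rewrite [leLHS]normrM ler_piMr.
have t3' : C * `|s| ^+ 3 * (C' * `|s| ^+ 3) <= C * C' * `|s| ^+ 3.
  rewrite mulrACA mulrA ler_piMr//; apply: mulr_ge0 => //; exact: mulr_ge0.
have := ler_normD (F * (g s - G) + (f s - F) * G + (f s - F) * (g s - G))
  ((b * c' + c * b' + c * c' * s) * s ^+ 3).
have := ler_normD (F * (g s - G) + (f s - F) * G) ((f s - F) * (g s - G)).
have := ler_normD (F * (g s - G)) ((f s - F) * G).
move: t1 t2 t3 t4 t3'; clear.
by move: (`|s| ^+ 3) => z; lra.
Qed.

Lemma expR_taylor1 : exists2 C, 0 <= C & forall x, `|x| <= 1 ->
  `|expR x - (1 + x)| <= C * x ^+ 2.
Proof.
have [M H] := c2_c11 0 (@c2_expR R).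
have n0 : `|0 - 0 : R| <= 1 by rewrite subrr normr0.
exists M => [|x x1].
  by have [/(le_trans (normr_ge0 _))] := H 0 0 n0 n0.
have x1' : `|x - 0| <= 1 by rewrite subr0.
have [_ _ _ _] := H 0 x n0 x1'.
by rewrite expR0 !subr0 mul1r opprD addrA.
Qed.

Lemma taylor2_expR : taylor2 (@expR R) 1 1 2^-1.
Proof.
have [C C0 H] := expR_taylor1.
exists 1, C; split; rewrite ?ltr01 ?lexx// => x x1.
(* Along the segment from 0 to [x] the derivative of the remainder is [x] times the first-order
   remainder, so the mean value theorem raises the order by one. *)
pose u s := expR (x * s) - (1 + x * s + (x * s) ^+ 2 / 2).
have du s : is_derive s (1 : R) u (x * (expR (x * s) - (1 + x * s))).
  have id1 := @is_derive_id _ _ s (1 : R).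
  have lin := is_deriveM1 (is_derive_cst x s 1) id1.
  have cst1 k := is_derive_cst (k : R) s (1 : R).
  have e1 : is_derive s (1 : R) (fun s => expR (x * s)) (x * expR (x * s)).
    have lin' : is_derive s (1 : R) (fun s => x * s) x by move: lin; rewrite mul0r add0r mulr1.
    have := is_derive1_comp (f := expR) (g := fun s : R => x * s) (x := s).
    by move=> /(_ _ _ (is_derive_expR _) lin'); rewrite /GRing.scale/= mulrC.
  have := is_deriveB1 e1 (is_deriveD1 (is_deriveD1 (cst1 1) lin)
    (is_deriveM1 (is_deriveM1 lin lin) (cst1 2^-1))).
  rewrite /cst /=.
  rewrite (_ : _ - _ = x * (expR (x * s) - (1 + x * s)))//; last by field.
have bd s : `|s - 0| <= 1 -> `|x * (expR (x * s) - (1 + x * s))| <= C * `|x| ^+ 3.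
  rewrite subr0 => s1; have xs : `|x * s| <= `|x| by rewrite normrM ler_piMr.
  have := ler_normM (lexx `|x|) (H _ (le_trans xs x1)).
  move=> /le_trans; apply; rewrite mulrCA ler_wpM2l// [leRHS]exprS ler_wpM2l//.
  by rewrite -(real_normK (num_real (x * s))) lerXn2r ?nnegrE.
have n0 : `|0 - 0 : R| <= 1 by rewrite subrr normr0.
have n1 : `|1 - 0 : R| <= 1 by rewrite subr0 normr1.
have := MVT_le du bd n0 n1.
rewrite /u !mulr0 mulr1 expR0 expr0n/= mul0r !addr0 subrr !subr0 normr1 mulr1.
by rewrite mul1r [x ^+ 2 / 2]mulrC.
Qed.

(** The substitution [s = expR (g0 + u)] turns [ln (s / expR g0)] into [u], and the asymptotic
    hypothesis into an explicit radius and constant. *)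
Lemma taylor2_comp_expR (eta : R -> R) (g0 : R) a b c :
  (fun s => eta s - (a + b * ln (s / expR g0) + c * ln (s / expR g0) ^+ 2))
    =O_ (expR g0) (fun s => ln (s / expR g0) ^+ 3) ->
  taylor2 (fun u => eta (expR (g0 + u))) a b c.
Proof.
move/eqO_exP => [k /= k0 H].
have cg : (fun u : R => expR (g0 + u)) @ (0 : R) --> expR g0.
  have : {for 0, continuous (fun u : R => expR (g0 + u))}.
    apply: (@continuous_comp _ _ _ (fun u : R => g0 + u) expR).
      by apply: continuousD; [exact: cvg_cst|exact: cvg_id].
    exact: continuous_expR.
  by rewrite /prop_for /continuous_at /= addr0.
have := cg _ H => /nbhs_ballP[r /= r0 Hr].
exists (Num.min (r / 2) 1), k; split.
- by rewrite lt_min divr_gt0//= ltr01 ge_min lexx orbT.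
- exact: ltW.
move=> s; rewrite le_min => /andP[sr s1].
have : ball 0 r s.
  by rewrite -ball_normE /= sub0r normrN (le_lt_trans sr)// ltr_pdivrMr// ltr_pMr// ltr1n.
move=> /Hr /=.
have -> : expR (g0 + s) / expR g0 = expR s by rewrite expRD mulrAC divff ?mul1r// gt_eqF ?expR_gt0.
by rewrite expRK normrX.
Qed.

End second_order_expansions.

Section linear_estimates.
Variable R : realType.

Lemma ler_three_terms (k L1 L2 d a b : R) : 0 <= L1 * d -> a <= d * k -> b <= 1 * (L2 * d) ->
  a + b <= (L1 + k + L2) * d.
Proof. lra. Qed.

Lemma ler_of_dual (v a b c d e : R) : 0 <= c -> v - a + b + c <= d + e ->
  v <= d + (a - b) + e.
Proof. lra. Qed.

Lemma expansion_sandwich (a g1 g2 m n v e1 w1 nh ng nq : R) : a + g1 - m <= v ->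
  v <= a + g2 + n -> 0 <= m -> 0 <= n -> g1 - nq <= g2 <= g1 + nq ->
  e1 - ng <= g1 <= e1 + ng -> w1 - nh <= a <= w1 + nh ->
  w1 + e1 - (nh + (m + n) + ng + nq) <= v <= w1 + e1 + (nh + (m + n) + ng + nq).
Proof. by move=> ? ? ? ? /andP[? ?] /andP[? ?] /andP[? ?]; apply/andP; split; lra. Qed.

End linear_estimates.

(** * The model *)

Section model.
Variable R : realType.
Variables (rho : R) (eta sigma : R -> R).
Hypothesis rho_lt1 : -1 < rho < 1.
Hypothesis eta_gt0 : forall s : R, 0 < s -> 0 < eta s.
Hypothesis sigma_gt0 : forall s : R, 0 < s -> 0 < sigma s.
Hypothesis eta_C2 : twice_continuously_differentiable_pos eta.
Hypothesis sigma_C2 : twice_continuously_differentiable_pos sigma.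
Local Notation lag := (lagrangian rho eta sigma).

(* The inverse of the metric [lag], in logarithmic coordinates: [coefA] is also
   the integrand of the constraint.  The trivial factors in [coefC] and its
   derivatives put all three coefficients in the form required by [c11_prod]. *)
Definition coefA (x y : R) := eta (expR x) * eta (expR x) * expR y.
Definition coefB (x y : R) := rho * eta (expR x) * (sigma (expR y) * expR (y / 2)).
Definition coefC (x y : R) := 1 * (sigma (expR y) * sigma (expR y)).

Definition deta (x : R) := expR x * derive1 eta (expR x).
Definition dsigma (y : R) := expR y * derive1 sigma (expR y).
Definition coefA1 (x y : R) :=
  (deta x * eta (expR x) + eta (expR x) * deta x) * expR y.
Definition coefA2 (x y : R) := eta (expR x) * eta (expR x) * expR y.
Definition coefB1 (x y : R) := rho * deta x * (sigma (expR y) * expR (y / 2)).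
Definition coefB2 (x y : R) := rho * eta (expR x) *
  (dsigma y * expR (y / 2) + sigma (expR y) * (expR (y / 2) / 2)).
Definition coefC1 (x y : R) := 0 * (sigma (expR y) * sigma (expR y)).
Definition coefC2 (x y : R) :=
  1 * (dsigma y * sigma (expR y) + sigma (expR y) * dsigma y).

Local Notation A := coefA.
Local Notation A1 := coefA1.
Local Notation A2 := coefA2.
Local Notation B := coefB.
Local Notation B1 := coefB1.
Local Notation B2 := coefB2.
Local Notation C := coefC.
Local Notation C1 := coefC1.
Local Notation C2 := coefC2.
Local Notation H := (ham A B C).
Local Notation H1 := (dham A1 B1 C1).
Local Notation H2 := (dham A2 B2 C2).

(** Completing the square: the gap in Fenchel's inequality is the Lagrangian of the velocity defect.
    Its sign gives lower bounds, its vanishing gives equality along exact solutions, and its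
    quadratic growth makes a defect [r] cost only O(r^2). *)
Lemma lagrangian_dual x y v w p q :
  lag x y v w = p * v + q * w - H x y p q +
    lag x y (v - (coefA x y * p + coefB x y * q))
            (w - (coefB x y * p + coefC x y * q)).
Proof.
have ex : expR y = expR (y / 2) ^+ 2 by rewrite -expRM_natl; congr expR; field.
have sx : Num.sqrt (expR y) = expR (y / 2).
  by rewrite ex sqrtr_sqr ger0_norm// expR_ge0.
have cA : coefA x y = eta (expR x) ^+ 2 * expR (y / 2) ^+ 2.
  by rewrite /coefA -ex expr2.
rewrite /lagrangian /ham cA /coefB /coefC sx.
have := one_rho2_gt0 rho_lt1; have := expR_gt0 (y / 2).
have := eta_gt0 (expR_gt0 x); have := sigma_gt0 (expR_gt0 y).
move: (eta _) (sigma _) (expR (y / 2)) => a b E b0 a0 E0 r0.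
field.
by rewrite !gt_eqF.
Qed.

Lemma cst1_c2 : c2 (fun=> 1 : R) (fun=> 0).
Proof.
exists (fun=> 0); split => s; [exact: is_derive_cst..|exact: cvg_cst].
Qed.

Lemma coef_c11 x0 y0 : exists M, [/\ 1 <= M, c11_2 x0 y0 coefA coefA1 coefA2 M,
  c11_2 x0 y0 coefB coefB1 coefB2 M & c11_2 x0 y0 coefC coefC1 coefC2 M].
Proof.
have ce := c2_comp_expR eta_C2; have cs := c2_comp_expR sigma_C2.
have [M1 H1] := c2_c11 x0 (c2M ce ce).
have [M2 H2] := c2_c11 y0 (c2_expR R).
have [M3 H3] := c2_c11 x0 (c2Z rho ce).
have [M4 H4] := c2_c11 y0 (c2M cs (c2_expR_half R)).
have [M5 H5] := c2_c11 x0 cst1_c2.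
have [M6 H6] := c2_c11 y0 (c2M cs cs).
pose M := 1 + `|M1| + `|M2| + `|M3| + `|M4| + `|M5| + `|M6|.
have M_ge N : N = M1 \/ N = M2 \/ N = M3 \/ N = M4 \/ N = M5 \/ N = M6 -> N <= M.
  have := (ler_norm M1, ler_norm M2, ler_norm M3, ler_norm M4, ler_norm M5, ler_norm M6).
  move=> [[[[[? ?] ?] ?] ?] ?].
  have := (normr_ge0 M1, normr_ge0 M2, normr_ge0 M3, normr_ge0 M4, normr_ge0 M5, normr_ge0 M6).
  move=> [[[[[? ?] ?] ?] ?] ?].
  by rewrite /M; (do 5?[case=> [->|]]) => [|||||->]; lra.
have M1' : 1 <= M by rewrite /M -!addrA lerDl !addr_ge0.
have M0 : 0 <= M by exact: le_trans M1'.
exists (M ^+ 2); split; first by rewrite expr_ge1.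
- by apply: c11_prod => //; [apply: c11_le H1|apply: c11_le H2]; apply: M_ge; tauto.
- by apply: c11_prod => //; [apply: c11_le H3|apply: c11_le H4]; apply: M_ge; tauto.
- by apply: c11_prod => //; [apply: c11_le H5|apply: c11_le H6]; apply: M_ge; tauto.
Qed.

(** Along an exact solution this is the action minus [lam] times the integral of [A]. *)
Definition dual_value lam (y1 y2 p1 p2 v1 v2 : R -> R) :=
  integral01 (fun t => p1 t * v1 t + p2 t * v2 t -
    H (y1 t) (y2 t) (p1 t) (p2 t) - lam * A (y1 t) (y2 t)).

Lemma cont01_eta y : cont01 y -> cont01 (fun t => eta (expR (y t))).
Proof.
move=> cy; apply: (@cont01_comp _ y (fun s => eta (expR s))) => //.
by apply: (continuous_comp_expR (C2_pos_continuous eta_C2)) => s; exact: cvg_id.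
Qed.

Lemma cont01_sigma y : cont01 y -> cont01 (fun t => sigma (expR (y t))).
Proof.
move=> cy; apply: (@cont01_comp _ y (fun s => sigma (expR s))) => //.
by apply: (continuous_comp_expR (C2_pos_continuous sigma_C2)) => s; exact: cvg_id.
Qed.

Lemma cont01_expR (y : R -> R) : cont01 y -> cont01 (fun t => expR (y t)).
Proof. by apply: cont01_comp; exact: continuous_expR. Qed.

Lemma cont01_coefA y1 y2 : cont01 y1 -> cont01 y2 ->
  cont01 (fun t => A (y1 t) (y2 t)).
Proof.
move=> c1 c2; apply: cont01M; last exact: cont01_expR.
by apply: cont01M; exact: cont01_eta.
Qed.

Lemma cont01_coefB y1 y2 : cont01 y1 -> cont01 y2 ->
  cont01 (fun t => B (y1 t) (y2 t)).
Proof.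
move=> c1 c2; apply: cont01M.
  by apply: cont01M; [exact: cont01_cst|exact: cont01_eta].
apply: cont01M; first exact: cont01_sigma.
by apply: cont01_expR; apply: cont01M => //; exact: cont01_cst.
Qed.

Lemma cont01_coefC y1 y2 : cont01 y1 -> cont01 y2 ->
  cont01 (fun t => C (y1 t) (y2 t)).
Proof.
move=> c1 c2; apply: cont01M; first exact: cont01_cst.
by apply: cont01M; exact: cont01_sigma.
Qed.

Lemma cont01_ham y1 y2 p1 p2 : cont01 y1 -> cont01 y2 -> cont01 p1 -> cont01 p2 ->
  cont01 (fun t => H (y1 t) (y2 t) (p1 t) (p2 t)).
Proof.
move=> cy1 cy2 cp1 cp2; apply: cont01M; last exact: cont01_cst.
have cA := cont01_coefA cy1 cy2; have cB := cont01_coefB cy1 cy2.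
have cC := cont01_coefC cy1 cy2.
apply: cont01D; first apply: cont01D.
- by apply: cont01M => //; exact: cont01X.
- do 2!apply: cont01M => //.
  by apply: cont01M => //; exact: cont01_cst.
- by apply: cont01M => //; exact: cont01X.
Qed.

Let inv_eta_cont : continuous (fun x => (eta (expR x))^-1).
Proof.
move=> x; apply: cvgV; first by rewrite gt_eqF// eta_gt0 ?expR_gt0.
by apply: (continuous_comp_expR (C2_pos_continuous eta_C2)) => s; exact: cvg_id.
Qed.

Let inv_sigma_cont : continuous (fun x => (sigma (expR x))^-1).
Proof.
move=> x; apply: cvgV; first by rewrite gt_eqF// sigma_gt0 ?expR_gt0.
by apply: (continuous_comp_expR (C2_pos_continuous sigma_C2)) => s; exact: cvg_id.
Qed.

Let inv_sqrt_cont : continuous (fun x : R => (Num.sqrt (expR x))^-1).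
Proof.
move=> x; apply: cvgV; first by rewrite gt_eqF// sqrtr_gt0 ?expR_gt0.
apply: (@continuous_comp _ _ _ expR); first exact: continuous_expR.
exact: sqrt_continuous.
Qed.

Lemma cont01_lagrangian y1 y2 v1 v2 : cont01 y1 -> cont01 y2 -> cont01 v1 ->
  cont01 v2 -> cont01 (fun t => lag (y1 t) (y2 t) (v1 t) (v2 t)).
Proof.
move=> cy1 cy2 cv1 cv2.
have ie := cont01_comp inv_eta_cont cy1.
have is_ := cont01_comp inv_sigma_cont cy2.
have iq := cont01_comp inv_sqrt_cont cy2.
have -> : (fun t => lag (y1 t) (y2 t) (v1 t) (v2 t)) =
  (fun t => (2 * (1 - rho ^+ 2))^-1 * (v1 t * ((eta (expR (y1 t)))^-1 *
     (Num.sqrt (expR (y2 t)))^-1) - rho * v2 t * (sigma (expR (y2 t)))^-1) ^+ 2 +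
     2^-1 * (v2 t * (sigma (expR (y2 t)))^-1) ^+ 2).
  by apply/funext => t; rewrite /lagrangian [(eta _ * _)^-1]invfM.
apply: cont01D.
  apply: cont01M; first exact: cont01_cst.
  apply: cont01X; apply: cont01B.
    by apply: cont01M => //; exact: cont01M.
  by apply: cont01M => //; apply: cont01M => //; exact: cont01_cst.
apply: cont01M; first exact: cont01_cst.
by apply: cont01X; apply: cont01M.
Qed.

(** Bounds the gap term of [lagrangian_dual] from above, as required when the explicit path acts as
    competitor. *)
Lemma lagrangian_bound (g0 h0 : R) : exists2 N, 0 <= N &
  forall x y e1 e2 r, `|x - g0| <= 1 -> `|y - h0| <= 1 -> `|e1| <= r -> `|e2| <= r ->
  lag x y e1 e2 <= N * r ^+ 2.
Proof.
have [U U0 HU] := continuous_bounded g0 inv_eta_cont.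
have [S S0 HS] := continuous_bounded h0 inv_sigma_cont.
have [Q Q0 HQ] := continuous_bounded h0 inv_sqrt_cont.
have k0 : 0 <= (2 * (1 - rho ^+ 2))^-1.
  by rewrite invr_ge0; have := one_rho2_gt0 rho_lt1; lra.
exists ((2 * (1 - rho ^+ 2))^-1 * (U * Q + `|rho| * S) ^+ 2 + 2^-1 * S ^+ 2).
  by rewrite addr_ge0// mulr_ge0 ?sqr_ge0// invr_ge0.
move=> x y e1 e2 r xb yb e1r e2r.
have r0 : 0 <= r by exact: le_trans e1r.
have sq (a b : R) : `|a| <= b -> a ^+ 2 <= b ^+ 2.
  move=> ab; rewrite -(real_normK (num_real a)) ler_sqr ?nnegrE//.
  exact: le_trans ab.
rewrite /lagrangian [(eta _ * _)^-1]invfM.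
move: k0; set k := (2 * (1 - rho ^+ 2))^-1 => k0.
have -> : (k * (U * Q + `|rho| * S) ^+ 2 + 2^-1 * S ^+ 2) * r ^+ 2 =
  k * (r * (U * Q) + `|rho| * (r * S)) ^+ 2 + 2^-1 * (r * S) ^+ 2 by ring.
have d1 : `|e1 * ((eta (expR x))^-1 * (Num.sqrt (expR y))^-1)| <= r * (U * Q).
  by apply: ler_normM => //; apply: ler_normM; [exact: HU|exact: HQ].
have d2 : `|e2 * (sigma (expR y))^-1| <= r * S by apply: ler_normM => //; exact: HS.
apply: lerD; (apply: ler_wpM2l; first by rewrite ?k0 ?invr_ge0); apply: sq; last exact: d2.
apply: le_trans (ler_normB _ _) _; apply: lerD => //.
by rewrite -mulrA; exact: ler_normM.
Qed.

(** * Verification and critical paths near the base point *)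

Section neighbourhood.
Variables (g0 h0 M : R).
Hypothesis M1 : 1 <= M.
Hypothesis HA : c11_2 g0 h0 A A1 A2 M.
Hypothesis HB : c11_2 g0 h0 B B1 B2 M.
Hypothesis HC : c11_2 g0 h0 C C1 C2 M.

Let M0 : 0 < M. Proof. exact: lt_le_trans ltr01 M1. Qed.

(* A path [(y1, y2)] with momentum [(p1, p2)] solving, up to an error [r], the
   Hamiltonian equations of [H + lam * A] with free right end. *)
Record reference (lam tau r : R) (y1 y2 p1 p2 v1 v2 w1 w2 : R -> R) : Prop := {
  ref_ac : [/\ absolutely_continuous_on 0 1 y1, absolutely_continuous_on 0 1 y2,
    absolutely_continuous_on 0 1 p1 & absolutely_continuous_on 0 1 p2];
  ref_cont : cont01 v1 /\ cont01 v2;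
  ref_start : y1 0 = g0 /\ y2 0 = h0;
  ref_end : p1 1 = 0 /\ p2 1 = 0;
  ref_box : forall t, 0 <= t <= 1 -> [/\ `|y1 t - g0| <= 1, `|y2 t - h0| <= 1,
    `|p1 t| <= M * tau & `|p2 t| <= M * tau];
  ref_derive : forall t : R, 0 < t < 1 -> [/\ is_derive t (1 : R) y1 (v1 t),
    is_derive t (1 : R) y2 (v2 t), is_derive t (1 : R) p1 (w1 t) &
    is_derive t (1 : R) p2 (w2 t)];
  ref_eq : forall t, 0 < t < 1 ->
    [/\ `|v1 t - (A (y1 t) (y2 t) * p1 t + B (y1 t) (y2 t) * p2 t)| <= r,
        `|v2 t - (B (y1 t) (y2 t) * p1 t + C (y1 t) (y2 t) * p2 t)| <= r,
        `|w1 t + H1 (y1 t) (y2 t) (p1 t) (p2 t) + lam * A1 (y1 t) (y2 t)| <= r &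
        `|w2 t + H2 (y1 t) (y2 t) (p1 t) (p2 t) + lam * A2 (y1 t) (y2 t)| <= r] }.

(** The calibrating function [W] has position gradient [p + k * d]; Fenchel's inequality with this
    momentum bounds its derivative by the Lagrangian plus the error treated in
    [calibration_pointwise]. The competitor's integral of [A] is left free: a deviation is charged
    at the rate [lam]. *)
Lemma calibration lam tau r y1 y2 p1 p2 v1 v2 w1 w2 g h :
  reference lam tau r y1 y2 p1 p2 v1 v2 w1 w2 ->
  0 <= tau -> 640 * M ^+ 4 * tau <= 1 -> `|lam| <= tau ->
  absolutely_continuous_on 0 1 g -> absolutely_continuous_on 0 1 h ->
  g 0 = g0 -> h 0 = h0 ->
  (forall t, 0 <= t <= 1 -> `|g t - g0| <= 1 /\ `|h t - h0| <= 1) ->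
  ((dual_value lam y1 y2 p1 p2 v1 v2 + lam * integral01 (fun t => A (g t) (h t))
    + (64 * M)^-1 * integral01 (fun t => (g t - y1 t) ^+ 2 + (h t - y2 t) ^+ 2)
    - 128 * M * r ^+ 2)%:E <= action rho eta sigma g h)%E.
Proof.
move=> [[acy1 acy2 acp1 acp2] [cv1 cv2] [y10 y20] [p11 p21] ybox yder yeq].
move=> tau0 tauM lamtau acg ach gg0 hh0 gbox.
have [cy1 cy2 cp1 cp2] := And4 (ac_cont01 acy1) (ac_cont01 acy2) (ac_cont01 acp1)
  (ac_cont01 acp2).
have [cg ch] := (ac_cont01 acg, ac_cont01 ach).
pose ell t := p1 t * v1 t + p2 t * v2 t -
    H (y1 t) (y2 t) (p1 t) (p2 t) - lam * A (y1 t) (y2 t).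
pose q t := (g t - y1 t) ^+ 2 + (h t - y2 t) ^+ 2.
pose a t := A (g t) (h t).
have cell : cont01 ell.
  apply: cont01B; first apply: cont01B.
  - by apply: cont01D; apply: cont01M.
  - exact: cont01_ham.
  - by apply: cont01M; [exact: cont01_cst|exact: cont01_coefA].
have cq : cont01 q by apply: cont01D; apply: cont01X; exact: cont01B.
have ca : cont01 a by exact: cont01_coefA.
pose m t := 128 * M * r ^+ 2 - (ell t + lam * a t + (64 * M)^-1 * q t).
have cla : cont01 (fun t => lam * a t) by apply: cont01M => //; exact: cont01_cst.
have ccq : cont01 (fun t => (64 * M)^-1 * q t) by apply: cont01M => //; exact: cont01_cst.
have csum : cont01 (fun t => ell t + lam * a t + (64 * M)^-1 * q t).
  by apply: cont01D => //; exact: cont01D.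
have cm : cont01 m by apply: cont01B => //; exact: cont01_cst.
have Em : integral01 m = 128 * M * r ^+ 2 - (integral01 ell + lam * integral01 a
    + (64 * M)^-1 * integral01 q).
  rewrite integral01B//; last exact: cont01_cst.
  rewrite integral01_cst integral01D//; last exact: cont01D.
  by rewrite integral01D// !integral01Z.
(* The term [k * |(g, h) - (y1, y2)|^2 / 2] vanishes at both ends; the negative
   derivative of [k] dominates the second-order errors of the verification. *)
pose k t := (4 * M)^-1 * (1 - t).
pose W t := p1 t * (g t - y1 t) + p2 t * (h t - y2 t) +
  k t * ((g t - y1 t) * (g t - y1 t) + (h t - y2 t) * (h t - y2 t)) / 2.
have ack : absolutely_continuous_on 0 1 k.
  apply: (@ac_lipschitz _ (4 * M)^-1) => s t s0 st t1.
  have M40 : 0 <= (4 * M)^-1 by rewrite invr_ge0 mulr_ge0// ltW.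
  by rewrite /k -mulrBr normrM (ger0_norm M40) opprB addrC subrKA distrC ger0_norm// subr_ge0.
have acc (c : R) : absolutely_continuous_on 0 1 (fun=> c).
  by apply: (@ac_lipschitz _ 0) => s t _ _ _; rewrite subrr normr0 mul0r.
have acW : absolutely_continuous_on 0 1 W.
  apply: acD; first by apply: acD; apply: acM => //; exact: acB.
  apply: acM => //; apply: acM => //.
  by apply: acD; apply: acM; exact: acB.
have W1 : W 1 = 0 by rewrite /W /k p11 p21; field; rewrite gt_eqF.
have W0 : W 0 = 0 by rewrite /W gg0 hh0 y10 y20; ring.
have im : (@lebesgue_measure R).-integrable `]0, 1] (EFin \o m).
  by apply: integrableS (cont01_integrable cm) => //; exact: subset_itv_oc_cc.
have := @action_ge _ rho eta sigma rho_lt1 eta_gt0 sigma_gt0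
  (C2_pos_continuous eta_C2) (C2_pos_continuous sigma_C2) g h acg ach 1 1 W m.
rewrite ltr01 lexx mul1e W1 W0 (_ : 0 - 0 = 0 :> R) ?subrr// sub0r.
rewrite Rintegral_itv_obnd_cbnd//.
rewrite -/(integral01 m) Em opprB => HH.
apply: le_trans (HH isT isT acW im _).
  by rewrite lee_fin /dual_value -/ell -/q -/a; lra.
move=> t dg dh t01 gdg hdh; have [? ?] := andP t01.
have t01' : 0 <= t <= 1 by lra.
have [y1b y2b p1b p2b] := ybox t t01'.
have [y1d y2d p1d p2d] := yder t t01.
have [e1b e2b f1b f2b] := yeq t t01.
have [gb hb] := gbox t t01'.
have gy := is_deriveB1 gdg y1d; have hy := is_deriveB1 hdh y2d.
have dk : is_derive t (1 : R) k (- (4 * M)^-1) by exact: is_derive_lin.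
have := is_deriveD1 (is_deriveD1 (is_deriveM1 p1d gy) (is_deriveM1 p2d hy))
  (is_deriveM1 (is_deriveM1 dk (is_deriveD1 (is_deriveM1 gy gy) (is_deriveM1 hy hy)))
    (is_derive_cst (2^-1 : R) _ _)).
set dW := (X in is_derive _ _ _ X) => HdW.
exists dW; first exact: HdW.
have kb : 0 <= k t <= (4 * M)^-1.
  have M40 : 0 <= (4 * M)^-1 by rewrite invr_ge0 mulr_ge0// ltW.
  have /andP[tge0 tle1] := t01'.
  by rewrite /k mulr_ge0 ?subr_ge0//= ler_piMr// gerBl.
have := calibration_pointwise M1 HA HB HC y1b y2b gb hb tau0 tauM p1b p2b lamtau kb
  e1b e2b f1b f2b erefl erefl.
have := lagrangian_dual (g t) (h t) dg dh
  (p1 t + k t * (g t - y1 t)) (p2 t + k t * (h t - y2 t)).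
set l := lag _ _ dg dh.
set l0 := lag _ _ _ _; have : 0 <= l0 by exact: lagrangian_ge0.
rewrite /m /ell /a /q /dW /cst; rewrite (_ : (8 * M)^-1 = (4 * M)^-1 / 2); last first.
  by field; rewrite gt_eqF.
rewrite -/(A (g t) (h t)).
move: (H (g t) _ _ _) (H (y1 t) _ _ _) (H1 _ _ _ _) (H2 _ _ _ _).
move: (A (g t) _) (A (y1 t) _) (B (y1 t) _) (C (y1 t) _) (A1 _ _) (A2 _ _).
move: (4 * M)^-1 (64 * M)^-1 (128 * M * r ^+ 2) (k t) l l0.
move=> M4 M64 r2 kt l l0 Ag Ay By Cy A1y A2y Hg Hy H1y H2y.
move: (p1 t) (p2 t) (v1 t) (v2 t) (w1 t) (w2 t) (g t) (h t) (y1 t) (y2 t).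
move=> p1t p2t v1t v2t w1t w2t gt ht y1t y2t.
lra.
Qed.

(** Fenchel's inequality with a momentum of size [1 / M] along one axis, multiplied by [M]; the
    Hamiltonian of this momentum then contributes at most [1 / 2]. *)
Lemma speed_bound (x y v w : R) : `|x - g0| <= 1 -> `|y - h0| <= 1 ->
  [/\ v <= M * lag x y v w + 1 / 2, - v <= M * lag x y v w + 1 / 2,
    w <= M * lag x y v w + 1 / 2 & - w <= M * lag x y v w + 1 / 2].
Proof.
move=> xb yb.
have [c [c0 Mc]] : exists c, [/\ 0 < c & M * c = 1].
  by exists M^-1; rewrite invr_gt0 mulfV ?gt_eqF.
have E p q : p * v + q * w - ham A B C x y p q <= lag x y v w.
  rewrite (lagrangian_dual x y v w p q) lerDl.
  exact: lagrangian_ge0.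
have bnd a s : a <= M -> (s = 1 \/ s = - 1) -> M * (a * (s * c) ^+ 2 / 2) <= 1 / 2.
  move=> aM s1; rewrite exprMn (_ : s ^+ 2 = 1); last by case: s1 => ->; ring.
  have : a * c ^+ 2 <= M * c ^+ 2 by rewrite ler_wpM2r// sqr_ge0.
  rewrite (_ : M * c ^+ 2 = M * c * c); last by ring.
  rewrite Mc mul1r mul1r => H; have : M * (a * c ^+ 2) <= M * c by rewrite ler_pM2l.
  rewrite Mc; lra.
have [Ab _ _ _] := HA xb yb xb yb; have [Cb _ _ _] := HC xb yb xb yb.
have AM := le_trans (ler_norm _) Ab; have CM := le_trans (ler_norm _) Cb.
have g s : s = 1 \/ s = - 1 -> s * v <= M * lag x y v w + 1 / 2.
  move=> s1; have := E (s * c) 0; rewrite /ham => /(ler_wpM2l (ltW M0)).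
  have := bnd _ _ AM s1.
  rewrite (_ : M * (s * c * v + _ - _) = M * c * (s * v) - M * (A x y * (s * c) ^+ 2 / 2));
    last by field.
  by rewrite Mc; lra.
have h s : s = 1 \/ s = - 1 -> s * w <= M * lag x y v w + 1 / 2.
  move=> s1; have := E 0 (s * c); rewrite /ham => /(ler_wpM2l (ltW M0)).
  have := bnd _ _ CM s1.
  rewrite (_ : M * (_ + s * c * w - _) = M * c * (s * w) - M * (C x y * (s * c) ^+ 2 / 2));
    last by field.
  by rewrite Mc; lra.
have := (g 1 (or_introl erefl), g (-1) (or_intror erefl),
  h 1 (or_introl erefl), h (-1) (or_intror erefl)).
by rewrite !mul1r !mulN1r => -[[[? ?] ?] ?].
Qed.

(** Until the first exit time [tau] each signed displacement grows at speed at most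
    [M * lag + 1 / 2], hence by less than [1 / 2 + tau / 2 <= 1], so that no exit can take place. *)
Lemma small_action_box g h :
  absolutely_continuous_on 0 1 g -> absolutely_continuous_on 0 1 h ->
  g 0 = g0 -> h 0 = h0 -> (action rho eta sigma g h < ((2 * M)^-1)%:E)%E ->
  forall t, 0 <= t <= 1 -> `|g t - g0| <= 1 /\ `|h t - h0| <= 1.
Proof.
move=> acg ach gg0 hh0 small t1 t101; apply: contrapT => nbox.
pose f t := Num.max `|g (clip 0 1 t) - g0| `|h (clip 0 1 t) - h0|.
have cf : continuous f.
  move=> t; apply: (@continuous_max _ _ (fun t => `|g (clip 0 1 t) - g0|)
    (fun t => `|h (clip 0 1 t) - h0|)).
    apply: continuous_comp; last exact: norm_continuous.
    by apply: cvgB; [exact: (ac_cont01 acg)|exact: cvg_cst].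
  apply: continuous_comp; last exact: norm_continuous.
  by apply: cvgB; [exact: (ac_cont01 ach)|exact: cvg_cst].
have fE t : 0 <= t -> t <= 1 -> f t = Num.max `|g t - g0| `|h t - h0|.
  by move=> ? ?; rewrite /f clip_id.
have /andP[t10 t11] := t101.
have f0 : f 0 < 1 by rewrite fE// gg0 hh0 !subrr normr0 maxxx.
have f1 : 1 <= f t1.
  rewrite leNgt; apply/negP; rewrite fE// gt_max => /andP[gt1 ht1]; apply: nbox.
  by split; exact: ltW.
have [tau [tau0 taut1 ftau ft]] := first_exit cf f0 t10 f1.
have tau1 : tau <= 1 by exact: le_trans t11.
have acc (c : R) : absolutely_continuous_on 0 1 (fun=> c).
  by apply: (@ac_lipschitz _ 0) => s t _ _ _; rewrite subrr normr0 mul0r.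
have key (W : R -> R) (s : R) : absolutely_continuous_on 0 1 W -> W 0 = 0 ->
  (forall t dg dh : R, 0 < t < tau -> is_derive t (1 : R) g dg ->
    is_derive t (1 : R) h dh -> exists2 dW, is_derive t (1 : R) W dW &
      dW <= M * lag (g t) (h t) dg dh + 1 / 2) -> W tau < 1.
  move=> acW W0 HW.
  have ic : (@lebesgue_measure R).-integrable `]0, tau] (EFin \o cst (1 / 2)).
    have icst := cont01_integrable (@cont01_cst R (1 / 2)).
    apply: (integrableS _ _ _ icst) => //.
    by apply: subset_itv; rewrite bnd_simp.
  have tau01 : 0 < tau <= 1 by rewrite tau0.
  have := @action_ge _ rho eta sigma rho_lt1 eta_gt0 sigma_gt0
    (C2_pos_continuous eta_C2) (C2_pos_continuous sigma_C2) g h acg ach tau M W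
    (cst (1 / 2)) tau01 M0 (ac_subitv (lexx 0) tau1 acW) ic HW.
  rewrite W0 subr0 Rintegral_cst//= lebesgue_measure_itv/= lte_fin tau0.
  rewrite oppr0 adde0 /= => H1.
  have : (M%:E * action rho eta sigma g h < (1 / 2)%:E)%E.
    have -> : 1 / 2 = M * (2 * M)^-1 :> R by field; rewrite gt_eqF.
    by rewrite EFinM lte_pmul2l// lte_fin.
  move=> /(le_lt_trans H1); rewrite lte_fin => H2.
  lra.
have box t : 0 < t < tau -> `|g t - g0| <= 1 /\ `|h t - h0| <= 1.
  move=> /andP[t0 tt]; have := ft t (ltW t0) tt.
  rewrite fE; [|exact: ltW|by rewrite ltW// (lt_le_trans tt)].
  by rewrite gt_max => /andP[? ?]; split; exact: ltW.
have [gt1 ht1] : `|g tau - g0| < 1 /\ `|h tau - h0| < 1.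
  rewrite !ltr_norml; split; apply/andP; split.
  - have := key (fun t => g0 - g t) 0 (acB (acc _) acg); rewrite gg0 subrr.
    move=> /(_ erefl) H; suff : g0 - g tau < 1 by lra.
    apply: H => t dg dh tt gdg hdh.
    exists (0 - dg); first exact: is_deriveB1 (is_derive_cst _ _ _) gdg.
    have [gb hb] := box t tt; have [? ? ? ?] := speed_bound dg dh gb hb; lra.
  - have := key (fun t => g t - g0) 0 (acB acg (acc _)); rewrite gg0 subrr.
    move=> /(_ erefl); apply => t dg dh tt gdg hdh.
    exists (dg - 0); first exact: is_deriveB1 gdg (is_derive_cst _ _ _).
    have [gb hb] := box t tt; have [? ? ? ?] := speed_bound dg dh gb hb; lra.
  - have := key (fun t => h0 - h t) 0 (acB (acc _) ach); rewrite hh0 subrr.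
    move=> /(_ erefl) H; suff : h0 - h tau < 1 by lra.
    apply: H => t dg dh tt gdg hdh.
    exists (0 - dh); first exact: is_deriveB1 (is_derive_cst _ _ _) hdh.
    have [gb hb] := box t tt; have [? ? ? ?] := speed_bound dg dh gb hb; lra.
  - have := key (fun t => h t - h0) 0 (acB ach (acc _)); rewrite hh0 subrr.
    move=> /(_ erefl); apply => t dg dh tt gdg hdh.
    exists (dh - 0); first exact: is_deriveB1 hdh (is_derive_cst _ _ _).
    have [gb hb] := box t tt; have [? ? ? ?] := speed_bound dg dh gb hb; lra.
move: ftau; rewrite fE ?(ltW tau0)// leNgt => /negP; apply.
by rewrite gt_max gt1.
Qed.

Local Notation K := (4 * M ^+ 2).
Local Notation l0 := ((192 * M ^+ 4)^-1).
Local Notation fixed_point := (is_fixed_point A A1 A2 B B1 B2 C C1 C2 g0 h0 M).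
Local Notation T := (picard_map A A1 A2 B B1 B2 C C1 C2 g0 h0).

(** The initial velocity of the critical path to first order, divided by [lam]: the inverse metric
    applied to the gradient of [A]. *)
Definition drift1 := A g0 h0 * A1 g0 h0 + B g0 h0 * A2 g0 h0.
Definition drift2 := B g0 h0 * A1 g0 h0 + C g0 h0 * A2 g0 h0.

Record critical_family (l1 N : R) (y1 y2 p1 p2 v1 v2 w1 w2 : R -> R -> R) : Prop := {
  cf_l1 : 0 < l1 <= 1;
  cf_N : 0 <= N;
  cf_tau : 640 * M ^+ 4 * (2 * l1) <= 1;
  cf_ref : forall lam, `|lam| <= l1 -> reference lam (2 * `|lam|) 0 (y1 lam) (y2 lam)
    (p1 lam) (p2 lam) (v1 lam) (v2 lam) (w1 lam) (w2 lam);
  cf_small : forall lam, `|lam| <= l1 ->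
    (action rho eta sigma (y1 lam) (y2 lam) < ((2 * M)^-1)%:E)%E;
  cf_first : forall lam t, `|lam| <= l1 -> 0 <= t <= 1 ->
    `|y1 lam t - (g0 + lam * (drift1 * (t - t ^+ 2 / 2)))| <= N * lam ^+ 2 /\
    `|y2 lam t - (h0 + lam * (drift2 * (t - t ^+ 2 / 2)))| <= N * lam ^+ 2;
  cf_lip : forall lam lam' t, `|lam| <= l1 -> `|lam'| <= l1 -> 0 <= t <= 1 ->
    `|y1 lam t - y1 lam' t| <= N * `|lam - lam'| /\
    `|y2 lam t - y2 lam' t| <= N * `|lam - lam'| }.

Section fixed.
Variables (lam : R) (z : bool * bool -> R -> R).
Hypothesis laml : `|lam| <= l0.
Hypothesis fz : fixed_point lam z.

(** The path is read off [T lam z] instead of [z]: both agree on [[0, 1]], and the former is made of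
    primitives, so its absolute continuity and its derivatives are immediate. *)
Let y1 t := g0 + lam * T lam z (false, false) t.
Let y2 t := h0 + lam * T lam z (false, true) t.
Let p1 t := lam * T lam z (true, false) t.
Let p2 t := lam * T lam z (true, true) t.
Let v1 t := lam * velocity1 A A1 A2 B B1 B2 C1 C2 g0 h0 lam z t.
Let v2 t := lam * velocity2 A1 A2 B B1 B2 C C1 C2 g0 h0 lam z t.
Let w1 t := lam * - force1 A1 B1 C1 g0 h0 lam z t.
Let w2 t := lam * - force2 A2 B2 C2 g0 h0 lam z t.

Lemma reference_of_fixed_point :
  reference lam (2 * `|lam|) 0 y1 y2 p1 p2 v1 v2 w1 w2.
Proof.
have [zK Tz] := fz.
have cf1 := cont01_force1 M1 HA HB HC laml zK.
have cf2 := cont01_force2 M1 HA HB HC laml zK.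
have cv1 := cont01_velocity1 M1 HA HB HC laml zK.
have cv2 := cont01_velocity2 M1 HA HB HC laml zK.
have dlam (f : R -> R) (df t : R) : is_derive t (1 : R) f df ->
    is_derive t (1 : R) (fun s => lam * f s) (lam * df).
  by move=> Hf; have := is_deriveM1 (is_derive_cst lam t 1) Hf; rewrite mul0r add0r.
have dadd (c t df : R) (f : R -> R) : is_derive t (1 : R) f df ->
    is_derive t (1 : R) (fun s => c + f s) df.
  by move=> Hf; have := is_deriveD1 (is_derive_cst c t 1) Hf; rewrite add0r.
have dsub (c t df : R) (f : R -> R) : is_derive t (1 : R) f df ->
    is_derive t (1 : R) (fun s => f s - c) df.
  by move=> Hf; have := is_deriveB1 Hf (is_derive_cst c t 1); rewrite subr0.
have drsub (c t df : R) (f : R -> R) : is_derive t (1 : R) f df ->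
    is_derive t (1 : R) (fun s => c - f s) (- df).
  by move=> Hf; have := is_deriveB1 (is_derive_cst c t 1) Hf; rewrite sub0r.
split.
- split.
  + apply: acD; first exact: ac_cst.
    by apply: acM; [exact: ac_cst|apply: acB; [exact: ac_prim|exact: ac_cst]].
  + apply: acD; first exact: ac_cst.
    by apply: acM; [exact: ac_cst|apply: acB; [exact: ac_prim|exact: ac_cst]].
  + by apply: acM; [exact: ac_cst|apply: acB; [exact: ac_cst|exact: ac_prim]].
  + by apply: acM; [exact: ac_cst|apply: acB; [exact: ac_cst|exact: ac_prim]].
- by split; apply: cont01M => //; exact: cont01_cst.
- by rewrite /y1 /y2 /= !subrr mulr0 !addr0.
- by rewrite /p1 /p2 /= /momentum1 /momentum2 !subrr mulr0.
- move=> t t01; have [b1 b2] := path_in_box g0 h0 M1 laml zK t01.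
  have [m1 m2] := momentum_bound M1 HA HB HC laml zK t01.
  have -> : M * (2 * `|lam|) = `|lam| * (2 * M) by ring.
  by rewrite /y1 /y2 !Tz//; split => //; exact: ler_normM.
- move=> t /andP[/ltW t0 /ltW t1]; have t01 : 0 <= t <= 1 by apply/andP.
  split.
  + by apply: dadd; apply: dlam; apply: dsub; exact: is_derive_prim.
  + by apply: dadd; apply: dlam; apply: dsub; exact: is_derive_prim.
  + by apply: dlam; apply: drsub; exact: is_derive_prim.
  + by apply: dlam; apply: drsub; exact: is_derive_prim.
- move=> t /andP[/ltW t0 /ltW t1]; have t01 : 0 <= t <= 1 by apply/andP.
  have E1 : momentum1 A1 B1 C1 g0 h0 lam z t = z (true, false) t by rewrite -Tz.
  have E2 : momentum2 A2 B2 C2 g0 h0 lam z t = z (true, true) t by rewrite -Tz.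
  rewrite /y1 /y2 /p1 /p2 !Tz// /v1 /v2 /w1 /w2 /velocity1 /velocity2 /force1 /force2 /=.
  rewrite E1 E2; set x := g0 + _; set y := h0 + _.
  by split; rewrite normr_le0; apply/eqP; rewrite /dham; field.
Qed.

Lemma path_of_fixed_point t : 0 <= t <= 1 ->
  y1 t = g0 + lam * z (false, false) t /\ y2 t = h0 + lam * z (false, true) t.
Proof. by move=> t01; rewrite /y1 /y2 !fz.2. Qed.

End fixed.

Section reference_path.
Variables (lam tau r : R) (y1 y2 p1 p2 v1 v2 w1 w2 : R -> R).
Hypothesis yref : reference lam tau r y1 y2 p1 p2 v1 v2 w1 w2.

Lemma cont01_reference : [/\ cont01 y1, cont01 y2, cont01 p1 & cont01 p2].
Proof. by case: (ref_ac yref) => ? ? ? ?; split; exact: ac_cont01. Qed.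

Lemma cont01_dual_integrand :
  cont01 (fun t => p1 t * v1 t + p2 t * v2 t - H (y1 t) (y2 t) (p1 t) (p2 t)).
Proof.
have [c1 c2 c3 c4] := cont01_reference; have [cv1 cv2] := ref_cont yref.
apply: cont01B; first by apply: cont01D; apply: cont01M.
exact: cont01_ham.
Qed.

Lemma dual_valueE : dual_value lam y1 y2 p1 p2 v1 v2 =
  integral01 (fun t => p1 t * v1 t + p2 t * v2 t - H (y1 t) (y2 t) (p1 t) (p2 t))
  - lam * integral01 (fun t => A (y1 t) (y2 t)).
Proof.
have [c1 c2 c3 c4] := cont01_reference; have cA := cont01_coefA c1 c2.
rewrite /dual_value integral01B ?integral01Z//; first exact: cont01_dual_integrand.
by apply: cont01M => //; exact: cont01_cst.
Qed.

Lemma reference_action_smooth (L : R -> R) : cont01 L ->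
  (forall t, 0 < t < 1 -> lag (y1 t) (y2 t) (v1 t) (v2 t) = L t) ->
  action rho eta sigma y1 y2 = (integral01 L)%:E.
Proof.
move=> cL HL; have [acy1 acy2 _ _] := ref_ac yref.
rewrite (@action_smooth _ rho eta sigma rho_lt1 eta_gt0 sigma_gt0
  (C2_pos_continuous eta_C2) (C2_pos_continuous sigma_C2) y1 y2 acy1 acy2
  (fun t => L (clip 0 1 t)) cL); last first.
  move=> t t01; have [d1 d2 _ _] := ref_derive yref t01.
  exists (v1 t), (v2 t); split => //; rewrite HL// clip_id//; lra.
rewrite -integral01E//; apply: eq_integral => t /set_mem /=.
by rewrite in_itv/= => /andP[? ?]; rewrite clip_id.
Qed.

End reference_path.

Lemma lagrangian00 x y : lag x y 0 0 = 0.
Proof. by rewrite /lagrangian !(mul0r, mulr0, subrr, expr0n, addr0). Qed.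

(** The velocity defects vanish, so the gap term of [lagrangian_dual] is zero at every interior
    time. *)
Lemma exact_reference lam tau y1 y2 p1 p2 v1 v2 w1 w2 :
  reference lam tau 0 y1 y2 p1 p2 v1 v2 w1 w2 ->
  action rho eta sigma y1 y2 = (dual_value lam y1 y2 p1 p2 v1 v2 +
    lam * integral01 (fun t => A (y1 t) (y2 t)))%:E.
Proof.
move=> yref; have cI := cont01_dual_integrand yref.
rewrite (dual_valueE yref) subrK; apply: (reference_action_smooth yref) => // t t01.
have [] := ref_eq yref t01; rewrite !normr_le0 => /eqP E1 /eqP E2 _ _.
by rewrite (lagrangian_dual _ _ _ _ (p1 t) (p2 t)) E1 E2
  lagrangian00 addr0.
Qed.

(** A competitor with action at least [(2 * M)^-1] loses outright. Any other one stays in the box,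
    where the calibration with [r = 0] applies and its quadratic term forces uniqueness. *)
Lemma exact_reference_optimal lam tau y1 y2 p1 p2 v1 v2 w1 w2 g h :
  reference lam tau 0 y1 y2 p1 p2 v1 v2 w1 w2 ->
  0 <= tau -> 640 * M ^+ 4 * tau <= 1 -> `|lam| <= tau ->
  (action rho eta sigma y1 y2 < ((2 * M)^-1)%:E)%E ->
  absolutely_continuous_on 0 1 g -> absolutely_continuous_on 0 1 h ->
  g 0 = g0 -> h 0 = h0 ->
  integral01 (fun t => A (g t) (h t)) = integral01 (fun t => A (y1 t) (y2 t)) ->
  (action rho eta sigma y1 y2 <= action rho eta sigma g h)%E /\
  (action rho eta sigma g h = action rho eta sigma y1 y2 ->
    forall t, 0 <= t <= 1 -> g t = y1 t /\ h t = y2 t).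
Proof.
move=> yref tau0 tauM lamtau small acg ach gg0 hh0 gK.
have [big|lt_M] := leP ((2 * M)^-1)%:E (action rho eta sigma g h).
  split; first exact/ltW/(lt_le_trans small big).
  by move=> E; move: small; rewrite -E ltNge big.
have box := small_action_box acg ach gg0 hh0 lt_M.
have := calibration yref
  tau0 tauM lamtau acg ach gg0 hh0 box.
rewrite expr0n/= mulr0 subr0 gK (exact_reference yref).
have [cy1 cy2 _ _] := cont01_reference yref.
have cg := ac_cont01 acg; have ch := ac_cont01 ach.
set q := (fun t => (g t - y1 t) ^+ 2 + (h t - y2 t) ^+ 2).
have cq : cont01 q by apply: cont01D; apply: cont01X; exact: cont01B.
have q0 t : 0 <= q t by rewrite addr_ge0 ?sqr_ge0.
have M64 : 0 < (64 * M)^-1 by rewrite invr_gt0 mulr_gt0.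
have iq0 : 0 <= (64 * M)^-1 * integral01 q.
  by rewrite mulr_ge0 ?(ltW M64)//; apply: integral01_ge0.
move=> le_act; split.
  by apply: le_trans le_act; rewrite lee_fin lerDl.
move=> E t t01; move: le_act; rewrite E lee_fin gerDl => iq1.
have iq : integral01 q <= 0.
  rewrite leNgt; apply/negP => iqpos; have := mulr_gt0 M64 iqpos; lra.
have /eqP := integral01_eq0 cq (fun t _ => q0 t) iq t01.
rewrite paddr_eq0 ?sqr_ge0// !sqrf_eq0 !subr_eq0 => /andP[/eqP -> /eqP ->].
by [].
Qed.

Lemma critical_family_ex :
  exists l1 N y1 y2 p1 p2 v1 v2 w1 w2, critical_family l1 N y1 y2 p1 p2 v1 v2 w1 w2.
Proof.
have K0 : 0 <= K by rewrite mulr_ge0// sqr_ge0.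
(* The first summand bounds the pairing of momentum and velocity, the second one [ham], both in
   units of [lam ^+ 2]; since [|lam| <= 1], the action is at most [Cst * |lam|]. *)
pose Cst := 4 * M * K + 8 * M ^+ 3.
have Cst0 : 0 < Cst by rewrite addr_gt0// !mulr_gt0 ?exprn_gt0.
(* The four bounds serve the Picard iteration, the estimate [lam ^+ 2 <= |lam|], the smallness
   condition of the calibration with [tau = 2 * |lam|], and an action of at most [(4 * M)^-1]. *)
pose l1 := Num.min (Num.min l0 1) (Num.min (2 * (640 * M ^+ 4))^-1 (4 * M * Cst)^-1).
have M40 : 0 < M ^+ 4 by rewrite exprn_gt0.
have l00 : 0 < l0 by rewrite invr_gt0 mulr_gt0.
have M640 : 0 < 640 * M ^+ 4.
  by apply: mulr_gt0; [rewrite ltr0n|exact: M40].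
have lM0 : 0 < (2 * (640 * M ^+ 4))^-1.
  by rewrite invr_gt0; apply: mulr_gt0; [exact: ltr0n|exact: M640].
have lC0 : 0 < (4 * M * Cst)^-1 by rewrite invr_gt0; do 2!apply: mulr_gt0 => //.
have l10 : 0 < l1.
  by rewrite /l1 !lt_min; apply/andP; split; apply/andP; split.
have [l1l0 l11 l1M l1C] : [/\ l1 <= l0, l1 <= 1, l1 <= (2 * (640 * M ^+ 4))^-1 &
    l1 <= (4 * M * Cst)^-1].
  by have := lexx l1; rewrite {2}/l1 !le_min => /andP[/andP[? ?] /andP[? ?]].
have /choice[z Hz] : forall lam : R, exists z, `|lam| <= l1 ->
    is_fixed_point A A1 A2 B B1 B2 C C1 C2 g0 h0 M lam z.
  move=> lam; have [laml|] := boolP (`|lam| <= l1); last by exists (fun _ _ => 0).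
  by have [z Hz] := fixed_point_ex M1 HA HB HC (le_trans laml l1l0); exists z.
pose L1 := 12 * M ^+ 2 * K ^+ 2; pose L2 := 40 * M ^+ 2 * K ^+ 2.
pose T lam := picard_map A A1 A2 B B1 B2 C C1 C2 g0 h0 lam (z lam).
pose y1 lam t := g0 + lam * T lam (false, false) t.
pose y2 lam t := h0 + lam * T lam (false, true) t.
pose p1 lam t := lam * T lam (true, false) t.
pose p2 lam t := lam * T lam (true, true) t.
pose v1 lam t := lam * velocity1 A A1 A2 B B1 B2 C1 C2 g0 h0 lam (z lam) t.
pose v2 lam t := lam * velocity2 A1 A2 B B1 B2 C C1 C2 g0 h0 lam (z lam) t.
pose w1 lam t := lam * - force1 A1 B1 C1 g0 h0 lam (z lam) t.
pose w2 lam t := lam * - force2 A2 B2 C2 g0 h0 lam (z lam) t.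
exists l1, (L1 + K + L2), y1, y2, p1, p2, v1, v2, w1, w2.
have MK0 : 0 <= M ^+ 2 * K ^+ 2 by rewrite mulr_ge0// sqr_ge0.
have L10 : 0 <= L1 by rewrite /L1 -mulrA mulr_ge0.
have L20 : 0 <= L2 by rewrite /L2 -mulrA mulr_ge0.
have refl lam : `|lam| <= l1 -> reference lam (2 * `|lam|) 0 (y1 lam) (y2 lam)
    (p1 lam) (p2 lam) (v1 lam) (v2 lam) (w1 lam) (w2 lam).
  by move=> laml; apply: reference_of_fixed_point => //;
    [exact: le_trans laml l1l0|exact: Hz].
split.
- by rewrite l10.
- by rewrite !addr_ge0.
- have : 2 * (640 * M ^+ 4) * l1 <= 1.
    rewrite -ler_pdivlMl; first by rewrite mulr1.
    by rewrite -invr_gt0; exact: lM0.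
  lra.
- exact: refl.
- move=> lam laml; have lref := refl lam laml.
  rewrite (exact_reference lref) lte_fin.
  rewrite (dual_valueE lref) subrK.
  have lam0 := normr_ge0 lam; have lam1 : `|lam| <= 1 by exact: le_trans l11.
  apply: (@le_lt_trans _ _ (Cst * `|lam|)).
    rewrite -[leRHS](@integral01_cst R); apply: le_integral01.
    - exact: (cont01_dual_integrand lref).
    - exact: cont01_cst.
    move=> t t01; have [b1 b2 q1 q2] := ref_box lref t01.
    have [_ [A1b _ _] _] : [/\ True, [/\ `|A (y1 lam t) (y2 lam t)| <= M,
        `|B (y1 lam t) (y2 lam t)| <= M & `|C (y1 lam t) (y2 lam t)| <= M] & True].
      split => //; have [? _ _ _] := HA b1 b2 b1 b2; have [? _ _ _] := HB b1 b2 b1 b2.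
      by have [? _ _ _] := HC b1 b2 b1 b2.
    have [Bb _ _ _] := HB b1 b2 b1 b2; have [Cb _ _ _] := HC b1 b2 b1 b2.
    have := quadratic_bound M1 A1b Bb Cb q1 q2; rewrite ler_norml => /andP[Hlo _].
    have [vv1 vv2] := velocity_bound M1 HA HB HC (le_trans laml l1l0) (Hz _ laml).1 t01.
    have := ler_normM q1 (ler_normM (lexx `|lam|) vv1).
    have := ler_normM q2 (ler_normM (lexx `|lam|) vv2).
    rewrite -/(v1 lam t) -/(v2 lam t).
    rewrite !ler_norml => /andP[_ H2] /andP[_ H1].
    have ll : `|lam| * `|lam| <= `|lam| by rewrite ler_piMl.
    have : (4 * M * K + 8 * M ^+ 3) * (`|lam| * `|lam|) <= Cst * `|lam|.
      by rewrite ler_wpM2l// ltW.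
    rewrite /ham; lra.
  apply: (@le_lt_trans _ _ (Cst * l1)); first by rewrite ler_pM2l.
  apply: (@le_lt_trans _ _ (4 * M)^-1).
    have : Cst * l1 <= Cst * (4 * M * Cst)^-1 by rewrite ler_pM2l.
    move=> /le_trans; apply; rewrite le_eqVlt; apply/orP; left; apply/eqP; field.
    by rewrite !gt_eqF.
  rewrite ltf_pV2 ?posrE ?mulr_gt0// ltr_pM2r//; lra.
- move=> lam t laml t01; have [yE1 yE2] := path_of_fixed_point (Hz _ laml) t01.
  rewrite /y1 /y2 yE1 yE2 -/drift1 -/drift2.
  have [F1 F2] := fixed_point_first_order M1 HA HB HC (le_trans laml l1l0) (Hz _ laml) t01.
  have E c u w : c + lam * u - (c + lam * w) = lam * (u - w) by ring.
  rewrite !E !normrM.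
  have lam2 : lam ^+ 2 = `|lam| * `|lam| by rewrite -expr2 real_normK ?num_real.
  have lam0 := normr_ge0 lam.
  have := ler_wpM2l lam0 F1; have := ler_wpM2l lam0 F2; rewrite -/drift1 -/drift2.
  rewrite lam2 -/L1; have : 0 <= (K + L2) * (`|lam| * `|lam|) by rewrite !mulr_ge0// addr_ge0.
  by split; lra.
- move=> lam lam' t laml laml' t01.
  have [yE1 yE2] := path_of_fixed_point (Hz _ laml) t01.
  have [yE1' yE2'] := path_of_fixed_point (Hz _ laml') t01.
  have E1 : y1 lam t - y1 lam' t = lam * z lam (false, false) t - lam' * z lam' (false, false) t.
    rewrite (congr2 (fun u v : R => u - v) yE1 yE1' : y1 lam t - y1 lam' t = _) /=.
    by rewrite opprD addrACA subrr add0r.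
  have E2 : y2 lam t - y2 lam' t = lam * z lam (false, true) t - lam' * z lam' (false, true) t.
    rewrite (congr2 (fun u v : R => u - v) yE2 yE2' : y2 lam t - y2 lam' t = _) /=.
    by rewrite opprD addrACA subrr add0r.
  rewrite E1 E2.
  have D := fixed_point_lip M1 HA HB HC (le_trans laml l1l0) (le_trans laml' l1l0)
    (Hz _ laml) (Hz _ laml').
  have zK := (Hz _ laml).1.2.
  have key i : `|lam * z lam i t - lam' * z lam' i t| <= (L1 + K + L2) * `|lam - lam'|.
    rewrite (_ : _ - _ = (lam - lam') * z lam i t + lam' * (z lam i t - z lam' i t));
      last by ring.
    rewrite (le_trans (ler_normD _ _))//.
    apply: ler_three_terms (mulr_ge0 L10 (normr_ge0 (lam - lam'))) _ _.
      exact: ler_normM (lexx `|lam - lam'|) (zK i t t01).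
    exact: ler_normM (le_trans laml' l11) (D i t t01).
  by split; exact: key.
Qed.

(** * Expansion of the constraint and of the optimal action *)

Section family.
Variables (l1 N : R) (y1 y2 p1 p2 v1 v2 w1 w2 : R -> R -> R).
Hypothesis F : critical_family l1 N y1 y2 p1 p2 v1 v2 w1 w2.

Lemma family_tau (lam : R) : `|lam| <= l1 -> 640 * M ^+ 4 * (2 * `|lam|) <= 1.
Proof.
move=> laml; have M6 : 0 <= 640 * M ^+ 4.
  by apply: mulr_ge0; [exact: ler0n|exact: exprn_ge0 (ltW M0)].
exact: le_trans (ler_wpM2l M6 (ler_wpM2l (ler0n _ 2) laml)) (cf_tau F).
Qed.

Definition mass lam := integral01 (fun t => A (y1 lam t) (y2 lam t)).

(** Derivative of [mass] at [lam = 0]: the gradient of [A] paired with the drift, times the integral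
    [1 / 3] of the profile [t - t ^+ 2 / 2]. *)
Definition mass_slope :=
  (drift1 * A1 g0 h0 + drift2 * A2 g0 h0) / 3.

Lemma cont01_family lam : `|lam| <= l1 -> cont01 (fun t => A (y1 lam t) (y2 lam t)).
Proof.
move=> laml; have [c1 c2 _ _] := cont01_reference (cf_ref F laml).
exact: cont01_coefA.
Qed.

Lemma mass_lip lam lam' : `|lam| <= l1 -> `|lam'| <= l1 ->
  `|mass lam - mass lam'| <= 2 * M * N * `|lam - lam'|.
Proof.
move=> laml laml'; apply: integral01_dist; [exact: cont01_family..|].
move=> t t01; have [b1 b2 _ _] := ref_box (cf_ref F laml) t01.
have [b1' b2' _ _] := ref_box (cf_ref F laml') t01.
have [_ _ _ [Ad _ _ _]] := HA b1' b2' b1 b2.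
have [d1 d2] := cf_lip F laml laml' t01.
apply: le_trans Ad _.
rewrite (_ : 2 * M * N * `|lam - lam'| = M * (2 * (N * `|lam - lam'|))); last by ring.
by rewrite ler_pM2l//; lra.
Qed.

Lemma mass_expansion : exists2 N', 0 <= N' & forall lam, `|lam| <= l1 ->
  `|mass lam - (A g0 h0 + mass_slope * lam)| <= N' * lam ^+ 2.
Proof.
have [/andP[l10 l11] N0] := (cf_l1 F, cf_N F).
pose D := `|drift1| + `|drift2| + 2 * N.
have D0 : 0 <= D by rewrite /D; have := (normr_ge0 drift1, normr_ge0 drift2) => -[]; lra.
exists (M * D ^+ 2 + 2 * M * N).
  have := mulr_ge0 (ltW M0) (sqr_ge0 D); have := mulr_ge0 (ltW M0) N0; lra.
move=> lam laml; have lam0 := normr_ge0 lam; have lam1 := le_trans laml l11.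
have lam2 : lam ^+ 2 = `|lam| * `|lam| by rewrite -expr2 real_normK ?num_real.
have -> : A g0 h0 + mass_slope * lam = integral01 (fun t => A g0 h0 +
    lam * (drift1 * A1 g0 h0 + drift2 * A2 g0 h0) * (t - t ^+ 2 / 2)).
  by rewrite integral01_theta /mass_slope; field.
apply: integral01_dist; [exact: cont01_family|exact: cont01_theta|].
move=> t t01; have [b1 b2 _ _] := ref_box (cf_ref F laml) t01.
have [bg bh] : `|g0 - g0| <= 1 /\ `|h0 - h0| <= 1 by rewrite !subrr normr0.
have [_ A1b A2b [_ _ _ RA]] := HA bg bh b1 b2.
have [E1 E2] := cf_first F laml t01.
have /andP[th0 th1] := theta_bound t01; set th := t - t ^+ 2 / 2 in E1 E2 th0 th1 *.
set dy1 := y1 lam t - g0 in RA *; set dy2 := y2 lam t - h0 in RA *.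
have {}E1 : `|dy1 - lam * (drift1 * th)| <= N * lam ^+ 2.
  by rewrite (_ : _ - _ = y1 lam t - (g0 + lam * (drift1 * th)))// /dy1; ring.
have {}E2 : `|dy2 - lam * (drift2 * th)| <= N * lam ^+ 2.
  by rewrite (_ : _ - _ = y2 lam t - (h0 + lam * (drift2 * th)))// /dy2; ring.
have size dy c : `|dy - lam * (c * th)| <= N * lam ^+ 2 -> `|dy| <= `|lam| * (`|c| + N).
  move=> E; have := ler_normD (dy - lam * (c * th)) (lam * (c * th)).
  rewrite subrK => /le_trans; apply.
  have thn : `|th| <= 1 by rewrite ger0_norm.
  have := ler_normM (lexx `|lam|) (ler_normM (lexx `|c|) thn).
  have : N * (`|lam| * `|lam|) <= N * (`|lam| * 1) by rewrite ler_wpM2l// ler_wpM2l.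
  rewrite lam2 in E; lra.
have dd : `|dy1| + `|dy2| <= `|lam| * D.
  by have := size _ _ E1; have := size _ _ E2; rewrite /D; lra.
have dd2 : M * (`|dy1| + `|dy2|) ^+ 2 <= M * (D ^+ 2 * lam ^+ 2).
  rewrite ler_pM2l// -exprMn -[(D * lam) ^+ 2](real_normK (num_real _)).
  rewrite ler_sqr ?nnegrE ?addr_ge0// normrM (ger0_norm D0) mulrC //.
have t1 := ler_normM A1b E1; have t2 := ler_normM A2b E2.
rewrite (_ : _ - _ = (A (y1 lam t) (y2 lam t) - A g0 h0 - A1 g0 h0 * dy1 - A2 g0 h0 * dy2)
  + (A1 g0 h0 * (dy1 - lam * (drift1 * th)) + A2 g0 h0 * (dy2 - lam * (drift2 * th))));
  last by ring.
rewrite (le_trans (ler_normD _ _))// (le_trans (lerD (lexx _) (ler_normD _ _)))//.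
lra.
Qed.

Local Notation kappa := mass_slope.
Hypothesis kappa_gt0 : 0 < kappa.

Let a1 := A1 g0 h0.
Let a2 := A2 g0 h0.
Let A0 := A g0 h0.
(** Matching [A0 + kappa * lam] with the target [A0 * expR x] to first order gives
    [lam = lam1 * x]. *)
Let lam1 := A0 / kappa.
Let d1 := lam1 * drift1.
Let d2 := lam1 * drift2.
Let theta (t : R) := t - t ^+ 2 / 2.

(* First-order approximation of the optimal path and of its momentum. *)
Let Y1 x t := g0 + x * d1 * theta t.
Let Y2 x t := h0 + x * d2 * theta t.
Let P1 x t := x * lam1 * a1 * (1 - t).
Let P2 x t := x * lam1 * a2 * (1 - t).
Let V1 x t := x * d1 * (1 - t).
Let V2 x t := x * d2 * (1 - t).
Let W1 x (t : R) := - (x * lam1 * a1).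
Let W2 x (t : R) := - (x * lam1 * a2).
Let del := `|d1| + `|d2|.

Lemma base_box : `|g0 - g0| <= 1 /\ `|h0 - h0| <= 1.
Proof. by rewrite !subrr normr0. Qed.

Lemma base_bounds : [/\ `|A0| <= M, `|a1| <= M & `|a2| <= M].
Proof. by have [b1 b2] := base_box; have [] := HA b1 b2 b1 b2. Qed.

Lemma A0_gt0 : 0 < A0.
Proof. by rewrite !mulr_gt0 ?expR_gt0// eta_gt0 ?expR_gt0. Qed.

Lemma lam1_gt0 : 0 < lam1. Proof. by rewrite divr_gt0// A0_gt0. Qed.

Lemma del_ge0 : 0 <= del. Proof. by rewrite addr_ge0. Qed.

(** The normalisation behind [lam1]: the integral of [A] must grow like [A0 * x], and the profile
    [theta] has mean [1 / 3]. *)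
Lemma slope_lam1 : a1 * d1 + a2 * d2 = 3 * A0.
Proof.
rewrite /d1 /d2 /lam1 (_ : a1 * _ + _ = A0 / kappa * (drift1 * a1 + drift2 * a2));
  last by ring.
rewrite (_ : drift1 * a1 + drift2 * a2 = 3 * kappa); last first.
  by rewrite /mass_slope -/a1 -/a2; field.
by field; rewrite gt_eqF.
Qed.

Lemma approx_dist x t : 0 <= t <= 1 ->
  `|Y1 x t - g0| + `|Y2 x t - h0| <= `|x| * del.
Proof.
move=> /theta_bound /andP[th0 th1].
rewrite /Y1 /Y2 ![_ + _ * theta t]addrC !addrK /del.
have thn : `|theta t| <= 1 by rewrite ger0_norm.
have := ler_normM (ler_normM (lexx `|x|) (lexx `|d1|)) thn.
have := ler_normM (ler_normM (lexx `|x|) (lexx `|d2|)) thn.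
lra.
Qed.

Lemma approx_box x t : `|x| * del <= 1 -> 0 <= t <= 1 ->
  `|Y1 x t - g0| <= 1 /\ `|Y2 x t - h0| <= 1.
Proof.
move=> xd t01; have := approx_dist x t01.
have := normr_ge0 (Y1 x t - g0); have := normr_ge0 (Y2 x t - h0).
by split; lra.
Qed.

(** The three sources of defect: coefficients frozen in the velocity equations, the gradient of [A]
    frozen in the momentum equations, and the position derivatives of the Hamiltonian dropped from
    the latter. *)
Let R0 := 2 * M ^+ 2 * lam1 * del + lam1 * M * del + 2 * M ^+ 3 * lam1 ^+ 2.

Lemma sqr_norm (x : R) : x ^+ 2 = `|x| * `|x|.
Proof. by rewrite -expr2 real_normK ?num_real. Qed.

Lemma R0_parts : [/\ 0 <= 2 * M ^+ 2 * lam1 * del, 0 <= lam1 * M * del &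
  0 <= 2 * M ^+ 3 * lam1 ^+ 2].
Proof.
have l0 := ltW lam1_gt0; have dl := del_ge0; have m := ltW M0.
split.
- by apply: mulr_ge0 => //; apply: mulr_ge0 => //; apply: mulr_ge0 => //; exact: sqr_ge0.
- by apply: mulr_ge0 => //; exact: mulr_ge0.
- by apply: mulr_ge0; [apply: mulr_ge0 => //; exact: exprn_ge0|exact: sqr_ge0].
Qed.

Lemma approx_momentum x k t : `|k| <= M -> 0 <= t <= 1 ->
  `|x * lam1 * k * (1 - t)| <= M * (lam1 * `|x|).
Proof.
move=> kM /andP[t0 t1]; have t1' : `|1 - t| <= 1 by rewrite ger0_norm; lra.
have := ler_normM (ler_normM (lexx `|x * lam1|) kM) t1'.
by rewrite (normrM x) (gtr0_norm lam1_gt0); lra.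
Qed.

Lemma approx_system x t : `|x| <= 1 -> `|x| * del <= 1 -> 0 <= t <= 1 ->
  [/\ `|V1 x t - (A (Y1 x t) (Y2 x t) * P1 x t + B (Y1 x t) (Y2 x t) * P2 x t)| <=
        R0 * x ^+ 2,
      `|V2 x t - (B (Y1 x t) (Y2 x t) * P1 x t + C (Y1 x t) (Y2 x t) * P2 x t)| <=
        R0 * x ^+ 2,
      `|W1 x t + H1 (Y1 x t) (Y2 x t) (P1 x t) (P2 x t) + lam1 * x * A1 (Y1 x t) (Y2 x t)|
        <= R0 * x ^+ 2 &
      `|W2 x t + H2 (Y1 x t) (Y2 x t) (P1 x t) (P2 x t) + lam1 * x * A2 (Y1 x t) (Y2 x t)|
        <= R0 * x ^+ 2].
Proof.
move=> x1 xd t01; have /andP[t0 t1] := t01.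
have l0 := lam1_gt0; have [A0M a1M a2M] := base_bounds.
have x0 := normr_ge0 x; have [bg bh] := base_box; have pb := approx_momentum x.
have t1n : `|1 - t| <= 1 by rewrite ger0_norm; lra.
have [R1 R2 R3] := R0_parts.
have x2 := sqr_norm x; have x20 : 0 <= x ^+ 2 by exact: sqr_ge0.
have Rx1 := mulr_ge0 R1 x20; have Rx2 := mulr_ge0 R2 x20; have Rx3 := mulr_ge0 R3 x20.
have R0x : 2 * M ^+ 2 * lam1 * del * x ^+ 2 + (lam1 * M * del * x ^+ 2 +
    2 * M ^+ 3 * lam1 ^+ 2 * x ^+ 2) = R0 * x ^+ 2 by rewrite /R0; ring.
have nxl : `|x * lam1| = `|x| * lam1 by rewrite normrM (gtr0_norm l0).
have vel (u u0 w w0 : R) : `|u - u0| <= M * (`|x| * del) -> `|w - w0| <= M * (`|x| * del) ->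
    `|x * (lam1 * (u0 * a1 + w0 * a2)) * (1 - t) -
      (u * (x * lam1 * a1 * (1 - t)) + w * (x * lam1 * a2 * (1 - t)))| <= R0 * x ^+ 2.
  move=> ud wd.
  rewrite (_ : _ - _ = - (x * lam1 * ((u - u0) * a1 + (w - w0) * a2) * (1 - t)));
    last by ring.
  have s1 : `|(u - u0) * a1 + (w - w0) * a2| <= M * (`|x| * del) * M + M * (`|x| * del) * M.
    by apply: le_trans (ler_normD _ _) _; apply: lerD; exact: ler_normM.
  have := ler_normM (ler_normM (lexx `|x * lam1|) s1) t1n.
  rewrite normrN nxl => /le_trans; apply; rewrite mulr1.
  rewrite [leLHS](_ : _ = 2 * M ^+ 2 * lam1 * del * x ^+ 2); last by rewrite x2; ring.
  by rewrite -R0x lerDl addr_ge0.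
have frc (k k0 u v w : R) : `|k - k0| <= M * (`|x| * del) ->
    `|u| <= M -> `|v| <= M -> `|w| <= M ->
    `|- (x * lam1 * k0) + (u * (x * lam1 * a1 * (1 - t)) ^+ 2 +
       2 * v * (x * lam1 * a1 * (1 - t)) * (x * lam1 * a2 * (1 - t)) +
       w * (x * lam1 * a2 * (1 - t)) ^+ 2) / 2 + lam1 * x * k| <= R0 * x ^+ 2.
  move=> kd uM vM wM.
  have q := quadratic_bound M1 uM vM wM (pb _ _ a1M t01) (pb _ _ a2M t01).
  set Q := (_ + _ + _) / 2 in q *.
  rewrite (_ : _ + Q + _ = x * lam1 * (k - k0) + Q); last by ring.
  rewrite (le_trans (ler_normD _ _))//.
  have := ler_normM (lexx `|x * lam1|) kd; rewrite nxl => s1.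
  apply: le_trans (lerD s1 q) _.
  rewrite [leLHS](_ : _ = lam1 * M * del * x ^+ 2 + 2 * M ^+ 3 * lam1 ^+ 2 * x ^+ 2);
    last by rewrite x2; ring.
  by rewrite -R0x lerDr.
have [b1 b2] := approx_box xd t01.
have dist := approx_dist x t01; set dd := `|Y1 x t - g0| + _ in dist.
have le_del z : z <= M * dd -> z <= M * (`|x| * del).
  by move=> /le_trans; apply; rewrite ler_pM2l.
have [_ _ _ [Ad A1d A2d _]] := HA bg bh b1 b2.
have [_ _ _ [Bd _ _ _]] := HB bg bh b1 b2.
have [_ _ _ [Cd _ _ _]] := HC bg bh b1 b2.
have [_ A1b' A2b' _] := HA b1 b2 bg bh.
have [_ B1b' B2b' _] := HB b1 b2 bg bh.
have [_ C1b' C2b' _] := HC b1 b2 bg bh.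
split.
- apply: (vel _ A0 _ (B g0 h0)); exact: le_del.
- apply: (vel _ (B g0 h0) _ (C g0 h0)); exact: le_del.
- apply: frc => //; exact: le_del.
- apply: frc => //; exact: le_del.
Qed.

Lemma approx_reference x : `|x| <= 1 -> `|x| * del <= 1 ->
  reference (lam1 * x) (lam1 * `|x|) (R0 * x ^+ 2) (Y1 x) (Y2 x) (P1 x) (P2 x)
    (V1 x) (V2 x) (W1 x) (W2 x).
Proof.
move=> x1 xd; have l0 := lam1_gt0; have [A0M a1M a2M] := base_bounds.
have x0 := normr_ge0 x.
have lin (k : R) : cont01 (fun t : R => k * (1 - t)).
  refine (cont01M (@cont01_cst R k) (cont01B (@cont01_cst R 1) (@cont01_id R))).
have dlin (k t : R) : is_derive t (1 : R) (fun t => k * (1 - t)) (- k).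
  exact: is_derive_lin.
have dth (c k t : R) : is_derive t (1 : R) (fun t => c + k * theta t) (k * (1 - t)).
  have id1 := @is_derive_id _ _ t (1 : R).
  have := is_deriveD1 (is_derive_cst c t 1) (is_deriveM1 (is_derive_cst k t 1)
    (is_deriveB1 id1 (is_deriveM1 (is_deriveM1 id1 id1) (is_derive_cst (2^-1 : R) t 1)))).
  by rewrite (_ : 0 + _ = k * (1 - t)); last by rewrite /cst /=; field.
have aclin k : absolutely_continuous_on 0 1 (fun t => k * (1 - t)).
  apply: (@ac_lipschitz _ `|k|) => s t s0 st t1.
  by rewrite -mulrBr normrM opprB addrC subrKA distrC [`|t - s|]ger0_norm// subr_ge0.
have acth c k : absolutely_continuous_on 0 1 (fun t => c + k * theta t).
  have acid : absolutely_continuous_on 0 1 (fun t : R => t).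
    by apply: (@ac_lipschitz _ 1) => s t s0 st t1; rewrite mul1r ger0_norm// subr_ge0.
  apply: acD; first exact: ac_cst.
  apply: acM; first exact: ac_cst.
  by apply: acB => //; apply: acM; [exact: acM|exact: ac_cst].
have pb := approx_momentum x.
split.
- by split; [exact: acth|exact: acth|exact: aclin|exact: aclin].
- by split; exact: lin.
- by rewrite /Y1 /Y2 /theta !(expr0n, mul0r, subr0, mulr0, addr0).
- by rewrite /P1 /P2 subrr !mulr0.
- by move=> t t01; have [? ?] := approx_box xd t01; split => //; exact: pb.
- by move=> t t01; split; [exact: dth|exact: dth|exact: dlin|exact: dlin].
by move=> t /andP[/ltW t0 /ltW t1]; apply: approx_system => //; apply/andP.
Qed.

(** Derivative of the Hamiltonian in the position along [(d1, d2)], at the base point with momentum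
    [(a1, a2)]. *)
Let h1 := H1 g0 h0 a1 a2 * d1 + H2 g0 h0 a1 a2 * d2.

Lemma second_order_remainder x t f f1 f2 : c11_2 g0 h0 f f1 f2 M ->
  `|x| * del <= 1 -> 0 <= t <= 1 ->
  `|f (Y1 x t) (Y2 x t) - (f g0 h0 + x * theta t * (f1 g0 h0 * d1 + f2 g0 h0 * d2))| <=
  M * del ^+ 2 * x ^+ 2.
Proof.
move=> Hf xd t01; have [bg bh] := base_box; have [b1 b2] := approx_box xd t01.
have [_ _ _ [_ _ _ RA]] := Hf _ _ _ _ bg bh b1 b2.
have dist := approx_dist x t01.
rewrite (_ : _ - _ = f (Y1 x t) (Y2 x t) - f g0 h0 - f1 g0 h0 * (Y1 x t - g0) -
  f2 g0 h0 * (Y2 x t - h0)); last by rewrite /Y1 /Y2; ring.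
apply: le_trans RA _; rewrite -mulrA ler_pM2l// -(real_normK (num_real x)) mulrC -exprMn.
by rewrite ler_sqr ?nnegrE ?addr_ge0 ?mulr_ge0 ?del_ge0.
Qed.

(** The explicit path runs along the line of direction [(d1, d2)] with parameter [s = x * theta t],
    and [Q2] is the second-order coefficient of [A] on that line. The integrals of [theta] and its
    square are [1 / 3] and [2 / 15]; [slope_lam1] turns the linear coefficient into [A0]. *)
Lemma approx_mass Q2 C3 s0 : 0 <= C3 ->
  (forall s, `|s| <= s0 -> `|A (g0 + s * d1) (h0 + s * d2) -
    (A0 + s * (a1 * d1 + a2 * d2) + s ^+ 2 * Q2)| <= C3 * `|s| ^+ 3) ->
  forall x, `|x| <= s0 -> 
  `|integral01 (fun t => A (Y1 x t) (Y2 x t)) - (A0 + x * A0 + x ^+ 2 * (2 / 15 * Q2))|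
    <= C3 * `|x| ^+ 3.
Proof.
move=> C30 HQ x xs.
have -> : A0 + x * A0 + x ^+ 2 * (2 / 15 * Q2) = integral01 (fun t => A0 +
    x * (3 * A0) * t ^+ 1 + (- (x * (3 * A0)) / 2 + x ^+ 2 * Q2) * t ^+ 2 +
    (- (x ^+ 2 * Q2)) * t ^+ 3 + x ^+ 2 * Q2 / 4 * t ^+ 4).
  by rewrite integral01_poly4; field.
apply: integral01_dist; last first.
- move=> t t01; have /andP[th0 th1] := theta_bound t01.
  have xt : `|x * theta t| <= `|x|.
    by rewrite normrM (ger0_norm th0) ler_piMr.
  have := HQ _ (le_trans xt xs); rewrite slope_lam1.
  rewrite (_ : A0 + x * theta t * (3 * A0) + (x * theta t) ^+ 2 * Q2 =
    A0 + x * (3 * A0) * t ^+ 1 + (- (x * (3 * A0)) / 2 + x ^+ 2 * Q2) * t ^+ 2 +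
    (- (x ^+ 2 * Q2)) * t ^+ 3 + x ^+ 2 * Q2 / 4 * t ^+ 4); last by rewrite /theta; field.
  rewrite (_ : g0 + x * theta t * d1 = Y1 x t); last by rewrite /Y1; ring.
  rewrite (_ : h0 + x * theta t * d2 = Y2 x t); last by rewrite /Y2; ring.
  move/le_trans; apply; rewrite ler_wpM2l// lerXn2r ?nnegrE//.
- exact: cont01_poly4.
- by apply: cont01_coefA => //; exact: cont01_theta.
Qed.

(** The drift is the momentum derivative of the Hamiltonian at [(a1, a2)], so Euler's identity gives
    half of the pairing [3 * kappa]. *)
Lemma ham_base : H g0 h0 a1 a2 = 3 / 2 * kappa.
Proof. by rewrite /ham /mass_slope /drift1 /drift2 -/a1 -/a2; field. Qed.

Lemma approx_ham x t : `|x| * del <= 1 -> 0 <= t <= 1 ->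
  `|H (Y1 x t) (Y2 x t) a1 a2 - (3 / 2 * kappa + x * theta t * h1)| <=
  2 * M ^+ 3 * del ^+ 2 * x ^+ 2.
Proof.
move=> xd t01; have [_ a1M a2M] := base_bounds.
have RA := second_order_remainder HA xd t01.
have RB := second_order_remainder HB xd t01.
have RC := second_order_remainder HC xd t01.
rewrite -ham_base.
set e := M * del ^+ 2 * x ^+ 2 in RA RB RC.
pose rem (f f1 f2 : R -> R -> R) := f (Y1 x t) (Y2 x t) -
  (f g0 h0 + x * theta t * (f1 g0 h0 * d1 + f2 g0 h0 * d2)).
rewrite (_ : _ - _ = (rem A A1 A2 * (a1 * a1) + rem B B1 B2 * (2 * (a1 * a2)) +
    rem C C1 C2 * (a2 * a2)) / 2); last by rewrite /rem /h1 /ham /dham; field.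
have n2 : `|2 : R| <= 2 by rewrite ger0_norm.
have r1 := ler_normM RA (ler_normM a1M a1M).
have r2 := ler_normM RB (ler_normM n2 (ler_normM a1M a2M)).
have r3 := ler_normM RC (ler_normM a2M a2M).
have n3 : `|2^-1 : R| <= 2^-1 by rewrite ger0_norm// invr_ge0.
have := ler_normM (le_trans (ler_normD _ _) (lerD (le_trans (ler_normD _ _) (lerD r1 r2)) r3)) n3.
move=> /le_trans; apply.
rewrite [leRHS](_ : _ = (e * (M * M) + e * (2 * (M * M)) + e * (M * M)) / 2)//.
by rewrite /e; field.
Qed.

(** Up to fourth order the integrand is the square of [1 - t] times an affine function of [theta].
    That square has integral [1 / 3], and its product with [theta] has integral [1 / 15]. *)
Lemma approx_dual x : `|x| * del <= 1 ->
  `|integral01 (fun t => P1 x t * V1 x t + P2 x t * V2 x t -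
      H (Y1 x t) (Y2 x t) (P1 x t) (P2 x t)) -
    (lam1 * A0 / 2 * x ^+ 2 - lam1 ^+ 2 * h1 / 15 * x ^+ 3)| <=
  2 * M ^+ 3 * del ^+ 2 * lam1 ^+ 2 * x ^+ 4.
Proof.
(* The polynomial below is [(1 - t) ^+ 2 * (c + d * theta t)] multiplied out. *)
move=> xd; pose c := 3 / 2 * A0 * lam1 * x ^+ 2; pose d := - (lam1 ^+ 2 * h1 * x ^+ 3).
have lk : lam1 * kappa = A0 by rewrite /lam1; field; rewrite gt_eqF.
have -> : lam1 * A0 / 2 * x ^+ 2 - lam1 ^+ 2 * h1 / 15 * x ^+ 3 = integral01 (fun t =>
    c + (d - 2 * c) * t ^+ 1 + (c - 5 / 2 * d) * t ^+ 2 + 2 * d * t ^+ 3 + (- d / 2) * t ^+ 4).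
  by rewrite integral01_poly4 /c /d; field.
have ct := cont01_theta; have lin k := @cont01M R _ _ (@cont01_cst R k)
  (cont01B (@cont01_cst R 1) (@cont01_id R)).
apply: integral01_dist; last first.
- move=> t t01; have r := approx_ham xd t01.
  set p := (c + _ + _ + _ + _).
  rewrite (_ : _ - p = - (x ^+ 2 * lam1 ^+ 2 * (1 - t) ^+ 2 *
      (H (Y1 x t) (Y2 x t) a1 a2 - (3 / 2 * kappa + x * theta t * h1)))); last first.
    rewrite (_ : P1 x t * V1 x t + P2 x t * V2 x t =
      x ^+ 2 * lam1 * (1 - t) ^+ 2 * (a1 * d1 + a2 * d2)); last by rewrite /P1 /P2 /V1 /V2; ring.
    by rewrite slope_lam1 /p /c /d -lk /ham /P1 /P2 /theta; field.
  rewrite normrN.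
  have k0 : 0 <= x ^+ 2 * lam1 ^+ 2 by rewrite mulr_ge0// sqr_ge0.
  have t1n : `|(1 - t) ^+ 2| <= 1.
    by rewrite normrX exprn_ile1// ger0_norm; move: t01 => /andP[]; lra.
  have := ler_normM (ler_normM (lexx `|x ^+ 2 * lam1 ^+ 2|) t1n) r.
  rewrite (ger0_norm k0) => /le_trans; apply.
  by rewrite le_eqVlt; apply/orP; left; apply/eqP; ring.
- exact: cont01_poly4.
- apply: cont01B; first by apply: cont01D; apply: cont01M; exact: lin.
  by apply: cont01_ham => //; first [exact: lin|exact: ct].
Qed.

(** Each of the two paths serves once as reference and once as competitor. Both bounds equal the
    dual integral [Ih] of the explicit path plus the price of its deficit [G] in the constraint, up
    to O(x^4). *)
Lemma value_expansion Q2 C3 s0 N2 Ck : 0 < s0 -> 0 <= C3 -> 0 <= N2 -> 0 <= Ck ->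
  (forall s, `|s| <= s0 -> `|A (g0 + s * d1) (h0 + s * d2) -
    (A0 + s * (a1 * d1 + a2 * d2) + s ^+ 2 * Q2)| <= C3 * `|s| ^+ 3) ->
  exists e N', [/\ 0 < e, 0 <= N' & forall x lam k V : R, `|x| <= e -> `|lam| <= l1 ->
    `|lam - lam1 * x| <= N2 * x ^+ 2 -> mass lam = k ->
    `|k - A0 * (1 + x + x ^+ 2 / 2)| <= Ck * `|x| ^+ 3 ->
    action rho eta sigma (y1 lam) (y2 lam) = V%:E ->
    `|V - (lam1 * A0 / 2 * x ^+ 2 +
       (lam1 * A0 / 2 - lam1 ^+ 2 * h1 / 15 - 2 / 15 * lam1 * Q2) * x ^+ 3)| <=
    N' * x ^+ 4].
Proof.
move=> s00 C30 N20 Ck0 HQ.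
have [Nl Nl0 HNl] := lagrangian_bound g0 h0.
have l0 := lam1_gt0; have dl := del_ge0; have M40 : 0 < M ^+ 4 by rewrite exprn_gt0.
pose e := Num.min (Num.min 1 s0) (Num.min (del + 1)^-1 (640 * M ^+ 4 * lam1)^-1).
have e0 : 0 < e.
  have d0 : 0 < (del + 1)^-1 by rewrite invr_gt0; lra.
  have c0 : 0 < (640 * M ^+ 4 * lam1)^-1.
    rewrite invr_gt0; apply: mulr_gt0; last exact: l0.
    by apply: mulr_gt0; [exact: ltr0n|exact: M40].
  by rewrite !lt_min; apply/andP; split; apply/andP; split.
(* Leading coefficient of the deficit [G]: [A0 / 2] comes from the exponential, [2 / 15 * Q2] from
   the explicit path. *)
pose q := A0 / 2 - 2 / 15 * Q2; pose Ng := Ck + C3.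
pose Nh := 2 * M ^+ 3 * del ^+ 2 * lam1 ^+ 2.
pose Mr := 128 * M * R0 ^+ 2; pose Nr := Nl * R0 ^+ 2.
pose N' := Nh + (Mr + Nr) + lam1 * Ng + N2 * (`|q| + Ng).
have Nh0 : 0 <= Nh.
  by apply: mulr_ge0; [apply: mulr_ge0; [apply: mulr_ge0 => //; exact: exprn_ge0 (ltW M0)|
    exact: sqr_ge0]|exact: sqr_ge0].
have r10 : 0 <= Mr.
  by apply: mulr_ge0; [apply: mulr_ge0; [exact: ler0n|exact: ltW]|exact: sqr_ge0].
have r20 : 0 <= Nr by rewrite mulr_ge0// sqr_ge0.
have Ng0 : 0 <= Ng by exact: addr_ge0.
have lNg : 0 <= lam1 * Ng by rewrite mulr_ge0// ltW.
have NqN : 0 <= N2 * (`|q| + Ng) by rewrite mulr_ge0// addr_ge0.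
exists e, N'; split => //.
  by apply: addr_ge0 => //; apply: addr_ge0 => //; apply: addr_ge0 => //; exact: addr_ge0.
move=> x lam k V xe laml lamx massk kx actV.
have [x1 xs xd xM] : [/\ `|x| <= 1, `|x| <= s0, `|x| <= (del + 1)^-1 &
    `|x| <= (640 * M ^+ 4 * lam1)^-1].
  by move: xe; rewrite !le_min => /andP[/andP[? ?] /andP[? ?]].
have x0 := normr_ge0 x.
have {}xd : `|x| * del <= 1.
  have del1 : 0 < del + 1 by exact: ltr_wpDl.
  move: xd; rewrite -[X in _ <= X]div1r (ler_pdivlMr _ _ del1); apply: le_trans.
  by rewrite ler_wpM2l// lerDl.
have tauM : 640 * M ^+ 4 * (lam1 * `|x|) <= 1.
  have c0 : 0 < 640 * M ^+ 4 * lam1.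
    apply: mulr_gt0; last exact: l0.
    by apply: mulr_gt0; [exact: ltr0n|exact: M40].
  by move: xM; rewrite -[X in _ <= X]div1r (ler_pdivlMr _ _ c0) mulrC mulrA.
have x2 := sqr_norm x; have x20 : 0 <= x ^+ 2 by exact: sqr_ge0.
have x3 : `|x| ^+ 3 = `|x| * x ^+ 2 by rewrite x2 exprS expr2.
have x4 : x ^+ 4 = x ^+ 2 * x ^+ 2 by rewrite -exprD.
have x40 : 0 <= x ^+ 4 by rewrite x4 mulr_ge0.
have aref := approx_reference x1 xd.
pose Ia := integral01 (fun t => A (Y1 x t) (Y2 x t)).
pose Ih := integral01 (fun t => P1 x t * V1 x t + P2 x t * V2 x t -
      H (Y1 x t) (Y2 x t) (P1 x t) (P2 x t)).
have Ed := approx_dual xd; rewrite -/Ih -/Nh in Ed.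
have Em := approx_mass C30 HQ xs; rewrite -/Ia in Em.
pose G := k - Ia.
have EG : `|G - q * x ^+ 2| <= Ng * `|x| ^+ 3.
  rewrite (_ : _ - _ = (k - A0 * (1 + x + x ^+ 2 / 2)) -
    (Ia - (A0 + x * A0 + x ^+ 2 * (2 / 15 * Q2)))); last by rewrite /G /q; field.
  by rewrite (mulrDl Ck C3 (`|x| ^+ 3)); exact: le_trans (ler_normB _ _) (lerD kx Em).
have Gb : `|G| <= (`|q| + Ng) * x ^+ 2.
  rewrite -[G](subrK (q * x ^+ 2)); apply: le_trans (ler_normD _ _) _.
  rewrite [leRHS](_ : _ = Ng * x ^+ 2 + `|q| * x ^+ 2); last by ring.
  apply: lerD; last by rewrite normrM (ger0_norm x20).
  by apply: le_trans EG _; rewrite ler_wpM2l// x3 ler_piMl.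
have cr := cf_ref F laml; have lam0 := normr_ge0 lam.
have [acY1 acY2 _ _] := ref_ac aref; have [acy1 acy2 _ _] := ref_ac cr.
(* The explicit path is the reference here: its multiplier [lam1 * x] prices [G], and its squared
   defect gives the error. *)
have lo : Ih + lam1 * x * G - Mr * x ^+ 4 <= V.
  have [gs hs] := ref_start cr.
  have := calibration aref
    (mulr_ge0 (ltW l0) x0) tauM _ acy1 acy2 gs hs.
  rewrite normrM (gtr0_norm l0) => /(_ (lexx _)).
  rewrite actV lee_fin (dual_valueE aref) -/Ih -/Ia.
  rewrite -[integral01 (fun t => A (y1 lam t) (y2 lam t))]/(mass lam) massk.
  set I2 := integral01 (fun t => _ ^+ 2 + _ ^+ 2).
  have I20 : 0 <= (64 * M)^-1 * I2.
    apply: mulr_ge0; first by rewrite invr_ge0 mulr_ge0// ltW.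
    by apply: integral01_ge0 => t _; rewrite addr_ge0// sqr_ge0.
  have box t : 0 <= t <= 1 -> `|y1 lam t - g0| <= 1 /\ `|y2 lam t - h0| <= 1.
    by move=> t01; have [] := ref_box cr t01.
  move/(_ box); apply: le_trans.
  rewrite (_ : Mr * x ^+ 4 = 128 * M * (R0 * x ^+ 2) ^+ 2); last by rewrite /Mr; ring.
  rewrite lerB// -addrA [X in _ <= X]addrA -[X in X <= _]addr0 lerD// /G.
  by rewrite le_eqVlt; apply/orP; left; apply/eqP; ring.
(* The exact path is the reference here, without defect; the error is the gap between the action of
   the explicit path and [Ih]. *)
have hi : V <= Ih + lam * G + Nr * x ^+ 4.
  have [gs hs] := ref_start aref.
  have tau0 : 0 <= 2 * `|lam| by rewrite mulr_ge0.
  have tauM' := family_tau laml.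
  have lamt : `|lam| <= 2 * `|lam| by rewrite ler_peMl// ler1n.
  have := calibration cr
    tau0 tauM' lamt acY1 acY2 gs hs (fun t => approx_box xd).
  have := exact_reference cr.
  rewrite actV => -[VE].
  have [cY1 cY2 cP1 cP2] := cont01_reference aref; have [cV1 cV2] := ref_cont aref.
  have cL : cont01 (fun t => lag (Y1 x t) (Y2 x t) (V1 x t) (V2 x t)).
    exact: cont01_lagrangian.
  rewrite (reference_action_smooth aref cL)//.
  rewrite lee_fin; set I2 := integral01 (fun t => _ ^+ 2 + _ ^+ 2).
  have I20 : 0 <= (64 * M)^-1 * I2.
    apply: mulr_ge0; first by rewrite invr_ge0 mulr_ge0// ltW.
    by apply: integral01_ge0 => t _; rewrite addr_ge0// sqr_ge0.
  rewrite -/Ia => le_L.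
  have Le : integral01 (fun t => lag (Y1 x t) (Y2 x t) (V1 x t) (V2 x t)) <=
      Ih + Nl * (R0 * x ^+ 2) ^+ 2.
    rewrite -[Nl * _ in leRHS](@integral01_cst R).
    rewrite -integral01D; [|exact: cont01_dual_integrand aref|exact: cont01_cst].
    apply: le_integral01 => //.
      by apply: cont01D; [exact: cont01_dual_integrand aref|exact: cont01_cst].
    move=> t t01; have [E1 E2 _ _] := approx_system x1 xd t01.
    have [b1 b2] := approx_box xd t01.
    rewrite (lagrangian_dual _ _ _ _ (P1 x t) (P2 x t)).
    by apply: lerD => //; exact: HNl.
  have VE' : dual_value lam (y1 lam) (y2 lam) (p1 lam) (p2 lam) (v1 lam) (v2 lam) = V - lam * k.
    by rewrite VE -massk addrK.
  rewrite VE' in le_L.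
  rewrite (_ : Nr * x ^+ 4 = Nl * (R0 * x ^+ 2) ^+ 2); last by rewrite /Nr; ring.
  have := le_trans le_L Le.
  rewrite (_ : lam * G = lam * k - lam * Ia); last by rewrite /G; ring.
  rewrite expr0n/= mulr0 subr0.
  exact: ler_of_dual I20.
(* Both [lam - lam1 * x] and [G] are of order [x ^+ 2]. *)
have dG : `|lam * G - lam1 * x * G| <= N2 * (`|q| + Ng) * x ^+ 4.
  rewrite -mulrBl [leRHS](_ : _ = (N2 * x ^+ 2) * ((`|q| + Ng) * x ^+ 2)); last by ring.
  exact: ler_normM.
have dE : `|lam1 * x * G - lam1 * q * x ^+ 3| <= lam1 * Ng * x ^+ 4.
  rewrite (_ : _ - _ = (lam1 * x) * (G - q * x ^+ 2)); last by ring.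
  rewrite [leRHS](_ : _ = (lam1 * `|x|) * (Ng * `|x| ^+ 3)); last by rewrite x4 x3 x2; ring.
  by apply: ler_normM => //; rewrite normrM (gtr0_norm l0).
have -> : lam1 * A0 / 2 * x ^+ 2 +
    (lam1 * A0 / 2 - lam1 ^+ 2 * h1 / 15 - 2 / 15 * lam1 * Q2) * x ^+ 3 =
    (lam1 * A0 / 2 * x ^+ 2 - lam1 ^+ 2 * h1 / 15 * x ^+ 3) + lam1 * q * x ^+ 3.
  by rewrite /q; field.
have -> : N' * x ^+ 4 = Nh * x ^+ 4 + (Mr * x ^+ 4 + Nr * x ^+ 4) + lam1 * Ng * x ^+ 4 +
    N2 * (`|q| + Ng) * x ^+ 4 by rewrite /N'; ring.
have MM := mulr_ge0 r10 x40; have NN := mulr_ge0 r20 x40.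
move: lo hi MM NN dG dE Ed; rewrite !ler_distl.
exact: expansion_sandwich.
Qed.

End family.

End neighbourhood.

(** * Existence of the optimum and explicit coefficients *)

Section optimum.
Variables g0 h0 : R.
Local Notation admissible := (admissible eta (expR g0) (expR h0)).
Local Notation drift1 := (drift1 g0 h0).
Local Notation drift2 := (drift2 g0 h0).
Local Notation kappa := (mass_slope g0 h0).
Local Notation A0 := (A g0 h0).
Local Notation lam1 := (A0 / kappa).
Local Notation d1 := (lam1 * drift1).
Local Notation d2 := (lam1 * drift2).

Lemma admissibleE K g h : admissible K g h <->
  [/\ absolutely_continuous_on 0 1 g, absolutely_continuous_on 0 1 h,
      g 0 = g0, h 0 = h0 & integral01 (fun t => A (g t) (h t)) = K].
Proof.
have E : absolutely_continuous_on 0 1 g -> absolutely_continuous_on 0 1 h ->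
    (\int[lebesgue_measure]_(t in `[0%R, 1%R])
      (expR (h t) * eta (expR (g t)) ^+ 2)%:E)%E =
    (integral01 (fun t => A (g t) (h t)))%:E.
  move=> acg ach; rewrite -integral01E; last first.
    by apply: (cont01_coefA); exact: ac_cont01.
  by apply: eq_integral => t _; rewrite /coefA mulrC expr2.
split.
  by move=> [acg ach]; rewrite !expRK => ? ?; rewrite E// => -[].
by move=> [acg ach gg hh <-]; split; rewrite ?expRK ?E.
Qed.

(** On a line [A] is a product of two copies of [eta] and an exponential, so the products of their
    expansions give [Q2]; this is where [eta2] enters. *)
Lemma taylor2_coefA e0 e1 e2 k1 k2 :
  taylor2 (fun u => eta (expR (g0 + u))) e0 e1 e2 ->
  taylor2 (fun s => A (g0 + s * k1) (h0 + s * k2)) (e0 ^+ 2 * expR h0)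
    ((2 * e0 * e1 * k1 + e0 ^+ 2 * k2) * expR h0)
    (((e1 ^+ 2 + 2 * e0 * e2) * k1 ^+ 2 + 2 * e0 * e1 * k1 * k2 + e0 ^+ 2 * k2 ^+ 2 / 2)
      * expR h0).
Proof.
move=> te; have tk := taylor2_scale k1 te.
have tx := taylor2_scale k2 (@taylor2_expR R).
have tc : taylor2 (fun=> expR h0) (expR h0) 0 0.
  exists 1, 0; split; rewrite ?ltr01 ?lexx// => s _.
  by rewrite !mul0r !addr0 subrr normr0.
have := taylor2M (taylor2M tk tk) (taylor2M tc tx).
rewrite (_ : (fun s => _) = fun s => A (g0 + s * k1) (h0 + s * k2)); last first.
  by apply/funext => s; rewrite /coefA (expRD h0) (mulrC s k1) (mulrC s k2).
by apply: taylor2_ext; field.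
Qed.

Lemma optimum_expansion eta2 :
  taylor2 (fun u => eta (expR (g0 + u))) (eta (expR g0)) (deta g0) eta2 ->
  0 < kappa ->
  let A1 := coefA1 g0 h0 in let A2 := coefA2 g0 h0 in
  let Q := ((deta g0 ^+ 2 + 2 * eta (expR g0) * eta2) * d1 ^+ 2 +
    2 * eta (expR g0) * deta g0 * d1 * d2 + eta (expR g0) ^+ 2 * d2 ^+ 2 / 2)
    * expR h0 in
  let h1 :=
    dham coefA1 coefB1 coefC1 g0 h0 A1 A2 * d1 +
    dham coefA2 coefB2 coefC2 g0 h0 A1 A2 * d2 in
  exists e N, [/\ 0 < e, 0 <= N & forall x, `|x| <= e ->
    exists y1 y2 V, [/\ admissible (A0 * expR x) y1 y2,
      action rho eta sigma y1 y2 = V%:E,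
      forall g h, admissible (A0 * expR x) g h ->
        (V%:E <= action rho eta sigma g h)%E /\
        (action rho eta sigma g h = V%:E ->
          forall t, 0 <= t <= 1 -> g t = y1 t /\ h t = y2 t),
      `|V - (lam1 * A0 / 2 * x ^+ 2 +
        (lam1 * A0 / 2 - lam1 ^+ 2 * h1 / 15 - 2 / 15 * lam1 * Q) * x ^+ 3)| <= N * x ^+ 4 &
      forall t, 0 <= t <= 1 ->
        `|y1 t - (g0 + x * (d1 * (t - t ^+ 2 / 2)))| <= N * x ^+ 2 /\
        `|y2 t - (h0 + x * (d2 * (t - t ^+ 2 / 2)))| <= N * x ^+ 2]].
Proof.
move=> te kappa0 A1 A2 Q h1.
have [M [M1 HA HB HC]] := coef_c11 g0 h0.
have [l1 [N [y1 [y2 [p1 [p2 [v1 [v2 [w1 [w2 F]]]]]]]]]] :=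
  critical_family_ex M1 HA HB HC.
have [/andP[l10 l11] N0] := (cf_l1 F, cf_N F).
have M0 : 0 < M by exact: lt_le_trans ltr01 M1.
have [Nm Nm0 mexp] := mass_expansion M1 HA F.
have mlip := mass_lip M1 HA F.
have A00 : 0 < A0 by rewrite /coefA !mulr_gt0 ?expR_gt0// eta_gt0 ?expR_gt0.
have l0 : 0 < lam1 by rewrite divr_gt0.
have [Ce Ce0 He] := @expR_taylor1 R.
have L0 : 0 <= 2 * M * N by rewrite !mulr_ge0// ltW.
have Ck0 : 0 <= A0 * Ce by rewrite mulr_ge0// ltW.
have [e1 [N2 [e10 N20 sol]]] := perturbed_linear_solve A0 l10 L0 Nm0 Ck0 kappa0 mlip mexp.
have [r3 [C3 [/andP[r30 r31] C30 H3]]] := @taylor2_expR R.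
have [s0 [CQ [/andP[s00 s01] CQ0 HQ]]] := taylor2_coefA d1 d2 te.
have Ck30 : 0 <= A0 * C3 by rewrite mulr_ge0// ltW.
have HQ' s : `|s| <= s0 -> `|A (g0 + s * d1) (h0 + s * d2) -
    (A0 + s * (A1 * d1 + A2 * d2) + s ^+ 2 * Q)| <= CQ * `|s| ^+ 3.
  move=> ss; have := HQ s ss; congr (`|_ - _| <= _).
  by rewrite /A1 /A2 /coefA1 /coefA2 /Q; move: d1 d2 => k1 k2; rewrite /coefA; field.
have [e2 [NV [e20 NV0 HV]]] := value_expansion M1 HA HB HC F kappa0 s00 CQ0 N20 Ck30 HQ'.
pose Np := N * (lam1 + N2) ^+ 2 + N2 * (`|drift1| + `|drift2|).
have Np0 : 0 <= Np.
  apply: addr_ge0; first exact: mulr_ge0 N0 (sqr_ge0 _).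
  exact: mulr_ge0 N20 (addr_ge0 (normr_ge0 _) (normr_ge0 _)).
exists (Num.min (Num.min e1 e2) r3), (NV + Np); split.
- by rewrite !lt_min e10 e20.
- exact: addr_ge0.
move=> x; rewrite !le_min => /andP[/andP[xe1 xe2] xr3].
have x1 := le_trans xr3 r31; have x20 := sqr_ge0 x; have x0 := normr_ge0 x.
(* The first-order expansion of the target selects the multiplier; the second-order one in [k3]
   enters the cubic coefficient. *)
have k2 : `|A0 * expR x - (A0 + A0 * x)| <= A0 * Ce * x ^+ 2.
  rewrite (_ : _ - _ = A0 * (expR x - (1 + x))); last by ring.
  by rewrite normrM (gtr0_norm A00) -mulrA ler_pM2l//; exact: He.
have k3 : `|A0 * expR x - A0 * (1 + x + x ^+ 2 / 2)| <= A0 * C3 * `|x| ^+ 3.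
  rewrite -mulrBr normrM (gtr0_norm A00) -mulrA ler_pM2l//.
  by have := H3 x xr3; rewrite mul1r [_^-1 * _]mulrC.
have [lam [laml lamx massk]] := sol x _ xe1 k2.
have cr := cf_ref F laml; have lam0 := normr_ge0 lam.
have [acy1 acy2 _ _] := ref_ac cr; have [gs hs] := ref_start cr.
have actV := exact_reference cr.
have tau0 : 0 <= 2 * `|lam| by rewrite mulr_ge0.
have tauM := family_tau M1 F laml.
have lamt : `|lam| <= 2 * `|lam| by rewrite ler_peMl// ler1n.
have EV := HV x lam _ _ xe2 laml lamx massk k3 actV.
exists (y1 lam), (y2 lam); move: actV EV; set V := (_ + _) => actV EV.
exists V; split => //.
- exact/admissibleE.
- move=> g h /admissibleE[acg ach gg hh massg].
  rewrite -actV; apply: (exact_reference_optimal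
    M1 HA HB HC cr tau0 tauM lamt (cf_small F laml)) => //.
  by rewrite massg -massk.
- apply: le_trans EV _; rewrite ler_wpM2r// ?lerDl//.
  by rewrite -[4%N]/(2 * 2)%N exprM sqr_ge0.
move=> t t01; have [E1 E2] := cf_first F laml t01.
have /andP[th0 th1] := theta_bound t01; set th := t - t ^+ 2 / 2 in E1 E2 th0 th1 *.
have thn : `|th| <= 1 by rewrite ger0_norm.
have xx : x ^+ 2 = `|x| * `|x| by rewrite -expr2 real_normK ?num_real.
have laml2 : `|lam| <= (lam1 + N2) * `|x|.
  rewrite -[lam](subrK (lam1 * x)); apply: le_trans (ler_normD _ _) _.
  rewrite mulrDl addrC; apply: lerD; first by rewrite normrM (gtr0_norm l0).
  by apply: le_trans lamx _; rewrite ler_wpM2l// xx ler_piMl.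
have lam2 : N * lam ^+ 2 <= N * (lam1 + N2) ^+ 2 * x ^+ 2.
  rewrite -mulrA ler_wpM2l// -(real_normK (num_real lam)) -(real_normK (num_real x)) -exprMn.
  by rewrite lerXn2r ?nnegrE// mulr_ge0// addr_ge0// ltW.
have key (y c k : R) : `|y - (c + lam * (k * th))| <= N * lam ^+ 2 -> 
    `|k| <= `|drift1| + `|drift2| ->
    `|y - (c + x * (lam1 * k * th))| <= (NV + Np) * x ^+ 2.
  move=> E kd.
  rewrite (_ : y - _ = y - (c + lam * (k * th)) + (lam - lam1 * x) * (k * th)); last by ring.
  apply: le_trans (ler_normD _ _) _.
  have F2 := ler_normM lamx (ler_normM kd thn).
  apply: le_trans (lerD (le_trans E lam2) F2) _.
  rewrite (_ : (NV + Np) * x ^+ 2 = NV * x ^+ 2 + (N * (lam1 + N2) ^+ 2 * x ^+ 2 +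
    N2 * x ^+ 2 * ((`|drift1| + `|drift2|) * 1))); last by rewrite /Np; ring.
  by rewrite lerDr mulr_ge0.
by split; apply: key => //; rewrite ?lerDl ?lerDr.
Qed.

Local Notation e0 := (eta (expR g0)).
Local Notation e1 := (deta g0).
Local Notation s0 := (sigma (expR h0)).
Local Notation s1 := (dsigma h0).
Local Notation V := (expR h0).
Local Notation r := (expR (h0 / 2)).
Local Notation D := (s0 ^+ 2 + 4 * rho * s0 * r * e1 + 4 * e1 ^+ 2 * V).

Lemma expR_half_sqr : V = r ^+ 2.
Proof. by rewrite expr2 -expRD; congr expR; field. Qed.

(** A sum of two squares, the second one positive and with the positive factor [1 - rho ^+ 2]. *)
Lemma discriminant_gt0 : 0 < D.
Proof.
have s00 : 0 < s0 by rewrite sigma_gt0 ?expR_gt0.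
(* Generalising [s0] first protects the argument [expR h0] of [sigma] when [V] becomes [r ^+ 2]. *)
move: s00; move: s0 => w w0; rewrite expR_half_sqr.
rewrite (_ : w ^+ 2 + _ + _ =
  (w * rho + 2 * e1 * r) ^+ 2 + (1 - rho ^+ 2) * w ^+ 2); last by ring.
by rewrite ltr_wpDl ?sqr_ge0// mulr_gt0 ?exprn_gt0// one_rho2_gt0.
Qed.

(** This identifies [D]: it is the squared length of the gradient of [ln A] in the inverse
    metric. *)
Lemma mass_slopeE : kappa = A0 ^+ 2 * D / 3.
Proof.
rewrite /mass_slope /drift1 /drift2 /coefA1 /coefA2 /coefA /coefB /coefC.
by move: s0 => w; rewrite expR_half_sqr; field.
Qed.

Lemma coefA_gt0 : 0 < A0.
Proof. by rewrite /coefA !mulr_gt0 ?expR_gt0// eta_gt0 ?expR_gt0. Qed.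

Lemma mass_slope_gt0 : 0 < kappa.
Proof.
by rewrite mass_slopeE divr_gt0// mulr_gt0 ?discriminant_gt0 ?exprn_gt0 ?coefA_gt0.
Qed.

Lemma multiplierE : lam1 = 3 / (A0 * D).
Proof.
rewrite mass_slopeE; move: discriminant_gt0 coefA_gt0.
move: D A0 => Dv Av D0 A_0; field; by rewrite !gt_eqF.
Qed.

Lemma drift1E : d1 = 3 * ((2 * e1 * r + rho * s0) * r * e0 / D).
Proof.
have D0 := discriminant_gt0; have A_0 := coefA_gt0.
rewrite multiplierE (_ : drift1 = A0 * ((2 * e1 * r + rho * s0) * r * e0)); last first.
  rewrite /drift1 /coefA1 /coefA2 /coefA /coefB; move: s0 => w; rewrite expR_half_sqr; ring.
by move: D0 A_0; move: D A0 => Dv Av D0 A_0; field; rewrite !gt_eqF.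
Qed.

Lemma drift2E : d2 = 3 * (s0 * (s0 + 2 * e1 * rho * r) / D).
Proof.
have D0 := discriminant_gt0; have A_0 := coefA_gt0.
rewrite multiplierE (_ : drift2 = A0 * (s0 * (s0 + 2 * e1 * rho * r))); last first.
  rewrite /drift2 /coefA1 /coefA2 /coefA /coefB /coefC; move: s0 => w; rewrite expR_half_sqr; ring.
by move: D0 A_0; move: D A0 => Dv Av D0 A_0; field; rewrite !gt_eqF.
Qed.

Lemma quadratic_coefficient : lam1 * A0 / 2 = 3 / (2 * D).
Proof.
rewrite multiplierE; move: discriminant_gt0 coefA_gt0.
by move: D A0 => Dv Av D0 A_0; field; rewrite !gt_eqF.
Qed.

(** The left side is the coefficient from [value_expansion]. With [V] written as [r ^+ 2] both sides
    are rational functions of independent quantities, and the identity is purely algebraic. *)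
Lemma cubic_coefficient (e2 : R) :
  let A1 := coefA1 g0 h0 in let A2 := coefA2 g0 h0 in
  let Q := ((e1 ^+ 2 + 2 * e0 * e2) * d1 ^+ 2 + 2 * e0 * e1 * d1 * d2
    + e0 ^+ 2 * d2 ^+ 2 / 2) * V in
  let h1 :=
    dham coefA1 coefB1 coefC1 g0 h0 A1 A2 * d1 +
    dham coefA2 coefB2 coefC2 g0 h0 A1 A2 * d2 in
  let beta0 := 16 * e1 ^+ 2 * V ^+ 2 * (e1 ^+ 2 + 6 * e0 * e2) in
  let beta1 := 8 * e1 * rho * V *
    (3 * e1 * rho * s1 + 7 * e1 ^+ 2 * r + 12 * e0 * e2 * r) in
  let beta2 := 4 *
    (6 * e1 * rho * s1 * r + 6 * e0 * e2 * rho ^+ 2 * V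
     + e1 ^+ 2 * (5 + 7 * rho ^+ 2) * V) in
  lam1 * A0 / 2 - lam1 ^+ 2 * h1 / 15 - 2 / 15 * lam1 * Q =
  - (3 / (10 * D ^+ 3) * (s0 ^+ 4 + 2 * s0 ^+ 3 * (3 * s1 + 7 * e1 * rho * r)
              + beta2 * s0 ^+ 2 + beta1 * s0 + beta0)).
Proof.
move=> A1 A2 Q h1 beta0 beta1 beta2.
rewrite quadratic_coefficient /h1 /Q {Q h1} drift1E drift2E multiplierE.
have := discriminant_gt0; have e00 : 0 < e0 by rewrite eta_gt0 ?expR_gt0.
have r0 : 0 < r by exact: expR_gt0.
rewrite /A1 /A2 /beta0 /beta1 /beta2 {A1 A2 beta0 beta1 beta2}.
rewrite /dham /coefA1 /coefA2 /coefA /coefB1 /coefB2 /coefC1 /coefC2.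
move: s0 s1 => w0 w1; rewrite expR_half_sqr.
move: e00 r0; move: e0 e1 r => u0 u1 q u00 q0 D0.
by field; rewrite !gt_eqF.
Qed.

End optimum.

End model.

Lemma sqrt_expR (R : realType) (y : R) : Num.sqrt (expR y) = expR (y / 2).
Proof. by rewrite expR_half_sqr sqrtr_sqr ger0_norm// expR_ge0. Qed.

Lemma rate_function_attained (R : realType) (rho : R) (eta sigma : R -> R)
    (S0 V0 K : R) (y1 y2 : R -> R) : admissible eta S0 V0 K y1 y2 ->
  (forall g h, admissible eta S0 V0 K g h ->
    (action rho eta sigma y1 y2 <= action rho eta sigma g h)%E) ->
  rate_function rho eta sigma S0 V0 K = action rho eta sigma y1 y2.
Proof.
move=> adm low; apply/eqP; rewrite eq_le; apply/andP; split.
  by apply: ereal_inf_lbound; exists y1, y2.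
by apply: le_ereal_inf_tmp => _ [g [h [gh ->]]]; exact: low.
Qed.

(** Finiteness near 0 gives [fine] its meaning, and uniqueness of the minimiser allows the last
    conjunct to speak of every optimal pair, with one constant for all [t]. *)
Theorem proposition19 (R : realType) (rho S0 V0 : R) (eta sigma : R -> R)
    (eta2 sigma2 : R)
    (rho_lt1 : -1 < rho < 1) (S0_gt0 : 0 < S0) (V0_gt0 : 0 < V0)
    (eta_gt0 : forall s : R, 0 < s -> 0 < eta s)
    (sigma_gt0 : forall v : R, 0 < v -> 0 < sigma v)
    (eta_C2 : twice_continuously_differentiable_pos eta)
    (sigma_C2 : twice_continuously_differentiable_pos sigma) :
  let eta0 := eta S0 in
  let eta1 := S0 * derive1 eta S0 in
  let sigma0 := sigma V0 in
  let sigma1 := V0 * derive1 sigma V0 in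
  (fun s : R => eta s
     - (eta0 + eta1 * ln (s / S0) + eta2 * ln (s / S0) ^+ 2))
    =O_ S0 (fun s : R => ln (s / S0) ^+ 3) ->
  (fun v : R => sigma v
     - (sigma0 + sigma1 * ln (v / V0) + sigma2 * ln (v / V0) ^+ 2))
    =O_ V0 (fun v : R => ln (v / V0) ^+ 3) ->
  let rV0 := Num.sqrt V0 in
  let D := sigma0 ^+ 2 + 4 * rho * sigma0 * rV0 * eta1 + 4 * eta1 ^+ 2 * V0 in
  let beta0 := 16 * eta1 ^+ 2 * V0 ^+ 2 * (eta1 ^+ 2 + 6 * eta0 * eta2) in
  let beta1 := 8 * eta1 * rho * V0 *
    (3 * eta1 * rho * sigma1 + 7 * eta1 ^+ 2 * rV0 + 12 * eta0 * eta2 * rV0) in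
  let beta2 := 4 *
    (6 * eta1 * rho * sigma1 * rV0 + 6 * eta0 * eta2 * rho ^+ 2 * V0
     + eta1 ^+ 2 * (5 + 7 * rho ^+ 2) * V0) in
  let K (x : R) := V0 * eta0 ^+ 2 * expR x in
  let I (x : R) := rate_function rho eta sigma S0 V0 (K x) in
  let g1 (t : R) := 3 / 2 * ((2 * eta1 * rV0 + rho * sigma0) * rV0 * eta0 / D)
    * (2 * t - t ^+ 2) in
  let h1 (t : R) := 3 / 2 * (sigma0 * (sigma0 + 2 * eta1 * rho * rV0) / D)
    * (2 * t - t ^+ 2) in
  [/\ (\forall x \near (0 : R), I x \is a fin_num),
      (fun x : R => fine (I x) -
        (3 / (2 * D) * x ^+ 2
         - 3 / (10 * D ^+ 3)
           * (sigma0 ^+ 4 + 2 * sigma0 ^+ 3 * (3 * sigma1 + 7 * eta1 * rho * rV0)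
              + beta2 * sigma0 ^+ 2 + beta1 * sigma0 + beta0) * x ^+ 3))
        =O_ (0 : R) (fun x : R => x ^+ 4),
      (\forall x \near (0 : R),
         exists g h : R -> R, optimal rho eta sigma S0 V0 (K x) g h) &
      exists C : R, \forall x \near (0 : R),
        forall g h : R -> R, optimal rho eta sigma S0 V0 (K x) g h ->
        forall t : R, 0 <= t <= 1 ->
          `|g t - (ln S0 + x * g1 t)| <= C * x ^+ 2 /\
          `|h t - (ln V0 + x * h1 t)| <= C * x ^+ 2].
Proof.
have [g0 ES] : exists g0, S0 = expR g0 by exists (ln S0); rewrite lnK.
have [h0 EV] : exists h0, V0 = expR h0 by exists (ln V0); rewrite lnK.
subst S0 V0 => {S0_gt0 V0_gt0} eta0 eta1 sigma0 sigma1 Heta _.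
move=> rV0 D beta0 beta1 beta2 K I g1 h1.
have te := taylor2_comp_expR Heta.
have rE : rV0 = expR (h0 / 2) by exact: sqrt_expR.
have k0 := mass_slope_gt0 rho_lt1 eta_gt0 sigma_gt0 g0 h0.
have KE x : K x = coefA eta g0 h0 * expR x.
  by rewrite /K /coefA -/eta0 expr2 [_ * expR h0]mulrC.
have [e [N [e0 N0 H]]] := optimum_expansion rho_lt1 eta_gt0 sigma_gt0 eta_C2 sigma_C2 te k0.
have D0 := discriminant_gt0 eta rho_lt1 sigma_gt0 g0 h0.
move: H; rewrite (cubic_coefficient rho_lt1 eta_gt0 sigma_gt0).
rewrite (quadratic_coefficient rho_lt1 eta_gt0 sigma_gt0).
rewrite !(drift1E rho_lt1 eta_gt0 sigma_gt0) !(drift2E rho_lt1 eta_gt0 sigma_gt0) -rE.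
rewrite -/sigma0 -/eta0 -/eta1 -[deta eta g0]/eta1 -[dsigma sigma h0]/sigma1.
rewrite -/D -/beta0 -/beta1 -/beta2.
move=> H.
have near0 (P : R -> Prop) : (forall x, `|x| <= e -> P x) -> \forall x \near (0 : R), P x.
  move=> HP; apply/nbhs_ballP; exists e => // x.
  by rewrite -ball_normE /= sub0r normrN => /ltW; exact: HP.
have HI x y1 y2 V : admissible eta (expR g0) (expR h0) (K x) y1 y2 ->
    action rho eta sigma y1 y2 = V%:E ->
    (forall g h, admissible eta (expR g0) (expR h0) (K x) g h ->
        (V%:E <= action rho eta sigma g h)%E /\
        (action rho eta sigma g h = V%:E ->
          forall t, 0 <= t <= 1 -> g t = y1 t /\ h t = y2 t)) -> I x = V%:E.
  move=> adm act low; rewrite -act.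
  by apply: rate_function_attained adm _ => g h /low[low_gh _]; rewrite act.
split.
- apply: near0 => x /H[y1 [y2 [V []]]]; rewrite -KE => adm act low _ _.
  by rewrite (HI _ _ _ _ adm act low).
(* [N + 1] because the constant must be positive while [N] may vanish. *)
- apply/eqO_exP; exists (N + 1); first by rewrite /= ltr_wpDl.
  apply: near0 => x /H[y1 [y2 [V []]]]; rewrite -KE => adm act low EV _.
  rewrite (HI _ _ _ _ adm act low) /= -mulNr; apply: le_trans EV _.
  have x40 : 0 <= x ^+ 4 by rewrite -[4%N]/(2 * 2)%N exprM sqr_ge0.
  by rewrite (ger0_norm x40) ler_wpM2r// lerDl.
- apply: near0 => x /H[y1 [y2 [V []]]]; rewrite -KE => adm act low _ _.
  by exists y1, y2; split; rewrite // act -(HI _ _ _ _ adm act low).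
exists N; apply: near0 => x /H[y1 [y2 [V []]]]; rewrite -KE => adm act low _ path.
move=> g h [admg]; rewrite -/(I x) (HI _ _ _ _ adm act low) => actg t t01.
have [_ uniq] := low g h admg; have [-> ->] := uniq actg t t01.
have [E1 E2] := path t t01; rewrite !expRK.
have E k : x * (3 / 2 * k * (2 * t - t ^+ 2)) = x * (3 * k * (t - t ^+ 2 / 2)) by field.
by rewrite /g1 /h1 !E.
Qed.
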